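(* Let $\alpha\in(0,1)$. For every $\lambda>\frac{1}{8\pi^2\alpha}$ there exists $C_\lambda>0$ such that for every nonzero function $u\in (H^2_{0,rad}\cap \dot C^{\alpha})(B)$, $$\|u\|_{L^{\infty}}^2\leq\lambda\,\|\Delta u\|_{L^2}^2\,\log\big(C_{\lambda}+N_{\alpha}(u)\big).$$ Moreover, this is false for $\lambda=\frac{1}{8\pi^2\alpha}$: there is no constant $C>0$ such that $\|u\|_{L^{\infty}}^2\leq\frac{1}{8\pi^2\alpha}\|\Delta u\|_{L^2}^2\log(C+N_{\alpha}(u))$ for all nonzero $u\in (H^2_{0,rad}\cap \dot C^{\alpha})(B)$.
   Context: $B$ is the open unit ball of $\mathbb{R}^4$ centered at the origin. $H^2_0(B)$ is the closure in the Sobolev space $H^2=W^{2,2}$ of the smooth functions compactly supported in $B$, and $H^2_{0,rad}(B)$ is the space of radially symmetric functions in $H^2_0(B)$. $\dot C^\alpha$ is the homogeneous space of $\alpha$-Hölder continuous functions with seminorm $\|u\|_{\dot C^\alpha}=\sup_{x\neq y}\frac{|u(x)-u(y)|}{|x-y|^\alpha}$ (functions in $H^2_0(B)$ being extended by zero outside $B$). $N_\alpha(u):=\frac{\|u\|_{\dot C^\alpha}}{\|\Delta u\|_{L^2}}$. *)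

(* Defs.v *)
From HB Require Import structures.
From mathcomp Require Import all_boot all_order all_algebra.
From mathcomp Require Import all_classical all_reals all_analysis.

Set Implicit Arguments.
Unset Strict Implicit.
Unset Printing Implicit Defensive.

Import Order.TTheory GRing.Theory Num.Theory.
Import numFieldNormedType.Exports.

Local Open Scope classical_set_scope.
Local Open Scope ring_scope.

(* R^4 as an iterated product: the library equips it with its topology, the
   product (Borel) sigma-algebra and product measures. The library's norm on
   products is the sup norm, so the Euclidean norm is defined below. *)
Notation R4 R := ((R * R * R * R)%type).

(* [mR4 R] is convertible to [R4 R]: [measurableTypeR R] is the copy of [R]
   on which the library defines [lebesgue_measure]. *)
Notation mR4 R := ((measurableTypeR R * measurableTypeR R
                    * measurableTypeR R * measurableTypeR R)%type).

Section sobolev.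
Context {R : realType}.
Implicit Types (x y : R4 R) (u f g phi : R4 R -> R).

Definition coord4 (i : 'I_4) x : R :=
  [:: x.1.1.1; x.1.1.2; x.1.2; x.2]`_i.

Definition std_basis (i : 'I_4) : R4 R :=
  ((i == 0 :> nat)%:R, (i == 1 :> nat)%:R,
   (i == 2 :> nat)%:R, (i == 3 :> nat)%:R).

Definition enorm x : R := Num.sqrt (\sum_(i < 4) coord4 i x ^+ 2).

Definition leb4 : {measure set (mR4 R) -> \bar R} :=
  (@lebesgue_measure R \x @lebesgue_measure R \x @lebesgue_measure R
   \x @lebesgue_measure R)%E.

Definition unit_ball : set (R4 R) := [set x | enorm x < 1].

(* [partials [:: i1; ...; ik] f] is d_i1 ... d_ik f *)
Definition partials (s : seq 'I_4) f : R4 R -> R :=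
  foldr (fun i g => 'D_(std_basis i) g) f s.

Definition smooth f := forall s : seq 'I_4,
  continuous (partials s f) /\
  forall i x, derivable (partials s f) x (std_basis i).

(* C_c^oo(B) *)
Definition test_function phi :=
  [/\ smooth phi, compact (closure [set x | phi x != 0])
    & closure [set x | phi x != 0] `<=` unit_ball].

Definition L2norm f : \bar R := 'N[leb4]_2%:E[EFin \o f]%E.
Definition Linfnorm f : \bar R := 'N[leb4]_+oo[EFin \o f]%E.

(* A function on B is represented by its extension by zero to R^4. *)
Definition L2B f :=
  f \in Lfun leb4 2%:E /\ forall x, ~ unit_ball x -> f x = 0.

Definition is_weak_partial (s : seq 'I_4) u g :=
  L2B g /\ forall phi, test_function phi ->
    \int[leb4]_(x in unit_ball) (u x * partials s phi x) =
    (-1) ^+ size s * \int[leb4]_(x in unit_ball) (g x * phi x).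

(* A chosen representative (unique up to null sets) of the weak derivative;
   the zero function if there is none in L^2(B). *)
Definition weak_partial (s : seq 'I_4) u : R4 R -> R :=
  xget (cst 0) [set g | is_weak_partial s u g].

Definition H2 u :=
  L2B u /\ forall s, (size s <= 2)%N -> exists g, is_weak_partial s u g.

Definition H2norm u : \bar R :=
  ((L2norm u ^+ 2
    + \sum_(i < 4) L2norm (weak_partial [:: i] u) ^+ 2
    + \sum_(i < 4) \sum_(j < 4) L2norm (weak_partial [:: i; j] u) ^+ 2)
   `^ 2^-1)%E.

Definition H20 u :=
  H2 u /\ forall e : R, 0 < e ->
    exists2 phi, test_function phi & (H2norm (u \- phi)%R < e%:E)%E.

Definition radial u := forall x y, enorm x = enorm y -> u x = u y.

Definition laplacian u : R4 R -> R :=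
  fun x => \sum_(i < 4) weak_partial [:: i; i] u x.

Definition holder_seminorm (alpha : R) u : \bar R :=
  ereal_sup [set (`|u p.1 - u p.2| / enorm (p.1 - p.2) `^ alpha)%:E
            | p in [set p : R4 R * R4 R | p.1 != p.2]].

(* Elements of the intersection are taken to be the continuous
   representatives, extended by zero outside B. *)
Definition H20rad_holder (alpha : R) u :=
  [/\ H20 u, radial u & (holder_seminorm alpha u < +oo)%E].

Definition N_holder (alpha : R) u : R :=
  fine (holder_seminorm alpha u) / fine (L2norm (laplacian u)).

End sobolev.

(* Main.v *)
Require Import Defs.
From HB Require Import structures.
From mathcomp Require Import all_boot all_order all_algebra.
From mathcomp Require Import all_classical all_reals all_analysis.
From mathcomp Require Import measurable_realfun ess_sup_inf ring lra.
Set Implicit Arguments. Unset Strict Implicit. Unset Printing Implicit Defensive.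
Import Order.TTheory GRing.Theory Num.Theory.
Import numFieldNormedType.Exports.

Local Open Scope classical_set_scope.
Local Open Scope ring_scope.

(** Fix a point [c], let [rho] be the squared distance to [c], and let
    [0 < a < 1].

    The upper bound comes from an explicit approximate identity. In dimension
    four, [w = 1/(rho + a) + a/(rho + a)^2] satisfies [- Delta w = 4 pi^2 P],
    where [P = (6 a^2/pi^2) (rho + a)^-4] is a probability density that
    concentrates at [c] as [a] tends to [0]. For [u] in H^2_0(B) with Hoelder
    seminorm [D], the value [u(c)] therefore differs from the integral of
    [u P] by at most [3 D a^(alpha/2)] ([average_error]), while that integral
    is [-1/(4 pi^2)] times the integral of [w Delta u] over the ball, hence at
    most [||Delta u|| ||w|| / (4 pi^2)] in absolute value
    ([laplacian_duality]). Since [||w||^2 <= pi^2 log(1/a) + O(1)] on the ball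
    ([bubble_potential_L2]), the choice [a^(alpha/2) = 1/(2 + N)], where [N] is
    the quotient of [D] by [||Delta u||], makes the second error comparable to
    [||Delta u||] and the main term equal to
    [||Delta u||^2 log(2 + N)/(8 pi^2 alpha)] after squaring ([sup_bound]). The
    bounded remainder is absorbed by any larger constant in front of the
    logarithm together with a large additive constant inside it
    ([logarithmic_inequality]).

    The integrals involved are computed without polar coordinates. Over the
    whole space, [(rho + a)^-(n+1)] is a Laplace transform in [rho], so that
    its integral is an integral of Gaussian ones ([integral_sqdist_power]);
    over the ball, [(rho + a)^-1] and [(rho + a)^-2] are, up to bounded terms,
    integrals in [t] from [a] to [1] of multiples of [(rho + t)^-3]
    ([ball_integral_le]).

    Integration by parts against [w], which does not vanish on the boundary of
    the ball, is legitimate because [u] is an H^2 limit of test functions.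
    Weak derivatives of the approximants are chosen representatives, and are
    identified with the classical ones by uniqueness of weak derivatives
    ([is_weak_partial_unique]). This uniqueness requires a supply of test
    functions; it is obtained from coordinates and [exp(-1/y)] inside a class
    of functions that is closed under partial derivatives ([elementary]).

    At the critical constant, with [c = 0] and [a = exp(-2 L)], the inequality
    is violated by [u = 1/2 (log k - log(rho + a))] for large [L], where [k] is
    smooth, bounded below independently of [a], and equal to [rho + a] near
    the boundary ([log_peak]). Indeed [u(0) >= L - 1]
    and [||Delta u||^2 <= 8 pi^2 L + O(1)], while the Hoelder seminorm is
    [O(exp(alpha L))]. As [t^2 log(C + H/t)] is increasing in [t] up to a change
    of [C] ([sqr_ln_le]), the inequality would give
    [(L - 1)^2 <= (L + O(1)) (L - log L/(2 alpha) + O(1))]: the term [log L]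
    appears because [N] is of order [exp(alpha L)/sqrt L], and it makes the
    right-hand side too small ([log_gap]). *)

(** * Derivatives along coordinate directions *)

Section directional.
Context {R : realType}.

(** Directional derivatives only depend on the restriction of the function to a
    line, so that the rules for one real variable apply to them. *)
Lemma is_derive_lineP (V : normedModType R) (f : V -> R) x v d :
  is_derive x v f d <-> is_derive (0 : R) 1 (fun h => f (h *: v + x)) d.
Proof.
have E : 'D_v f x = 'D_1 (fun h : R => f (h *: v + x)) 0.
  rewrite /derive; set g1 := fun h => h^-1 *: _; set g2 := fun h => h^-1 *: _.
  suff -> : g1 = g2 by [].
  by rewrite funeqE /g1 /g2 => h /=; rewrite addr0 scale0r add0r [_%:A]mulr1.
split=> -[fd fE].
  by apply: DeriveDef; [exact: (derivable1P f x v).1|rewrite -E].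
by apply: DeriveDef; [exact: (derivable1P f x v).2|rewrite E].
Qed.

Lemma is_derive_comp1 (V : normedModType R) (f : V -> R) (G : R -> R) x v d e :
  is_derive x v f d -> is_derive (f x) 1 G e ->
  is_derive x v (fun y => G (f y)) (e * d).
Proof.
move=> /is_derive_lineP fd Gd; apply/is_derive_lineP.
have Gd0 : is_derive (f ((0:R) *: v + x)) 1 G e by rewrite scale0r add0r.
by have := is_derive1_comp Gd0 fd; rewrite mulrC.
Qed.

Lemma coord4_line i (h : R) (v x : R4 R) :
  coord4 i (h *: v + x) = h * coord4 i v + coord4 i x.
Proof.
by move: v x => [[[v0 v1] v2] v3] [[[x0 x1] x2] x3]; case: i => -[|[|[|[|]]]].
Qed.

Lemma coord4_std_basis i j : coord4 j (std_basis i : R4 R) = (i == j)%:R.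
Proof.
by case: i => -[|[|[|[|]]]]// ?; case: j => -[|[|[|[|]]]].
Qed.

Lemma is_derive_coord4 i j (x : R4 R) :
  is_derive x (std_basis i) (coord4 j) (i == j)%:R.
Proof.
apply/is_derive_lineP.
rewrite (_ : (fun h => _) = (fun h => h * (i == j)%:R + coord4 j x)); last first.
  by apply/funext => h; rewrite coord4_line coord4_std_basis.
apply: is_derive_eq; rewrite /GRing.scale/=; ring.
Qed.

Lemma continuous_coord4 i : continuous (@coord4 R i).
Proof.
move=> x; case: i => -[|[|[|[|]]]]// ?.
- apply: (@continuous_comp _ _ _ (fst \o fst) fst); last exact: cvg_fst.
  by apply: continuous_comp; exact: cvg_fst.
- apply: (@continuous_comp _ _ _ (fst \o fst) snd); last exact: cvg_snd.
  by apply: continuous_comp; exact: cvg_fst.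
- by apply: continuous_comp; [exact: cvg_fst|exact: cvg_snd].
- exact: cvg_snd.
Qed.

End directional.

(** * A class of smooth functions closed under partial derivatives *)

Section elementary.
Context {R : realType}.

(** Functions built from coordinates by a syntax that is stable under
    differentiation, so that smoothness is proved by exhibiting an expression.
    In [elementary_comp] the [G k] are the successive derivatives of [G 0],
    and only on the range of [f]: this covers inverses and logarithms of
    positive functions, and the gluing of [exp(-1/y)] with [0]. *)
Inductive elementary : (R4 R -> R) -> Prop :=
| elementary_cst c : elementary (fun=> c)
| elementary_coord i : elementary (coord4 i)
| elementaryD f g : elementary f -> elementary g ->
    elementary (fun x => f x + g x)
| elementaryM f g : elementary f -> elementary g ->
    elementary (fun x => f x * g x)
| elementary_comp (G : nat -> R -> R) n f : elementary f ->
    (forall k x, is_derive (f x) 1 (G k) (G k.+1 (f x))) ->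
    elementary (fun x => G n (f x)).

Lemma elementary_continuous f : elementary f -> continuous f.
Proof.
elim=> [c|i|{}f g _ cf _ cg|{}f g _ cf _ cg|G n {}f _ cf dG] x.
- exact: cvg_cst.
- exact: continuous_coord4.
- by apply: cvgD; [exact: cf|exact: cg].
- by apply: cvgM; [exact: cf|exact: cg].
- apply: (@continuous_comp _ _ _ f (G n)); first exact: cf.
  by apply/differentiable_continuous/derivable1_diffP; have [] := dG n x.
Qed.

Lemma elementary_is_derive i f : elementary f ->
  exists2 g, elementary g & forall x, is_derive x (std_basis i) f (g x).
Proof.
elim=> [c|j|{}f g ef [f' ef' df] eg [g' eg' dg]
  |{}f g ef [f' ef' df] eg [g' eg' dg]|G n {}f ef [f' ef' df] dG].
- by exists (fun=> 0); [exact: elementary_cst|move=> x; exact: is_derive_cst].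
- exists (fun=> (i == j)%:R); first exact: elementary_cst.
  by move=> x; exact: is_derive_coord4.
- exists (fun x => f' x + g' x); first exact: elementaryD.
  by move=> x; exact: is_deriveD.
- exists (fun x => f x * g' x + g x * f' x).
    by apply: elementaryD; exact: elementaryM.
  by move=> x; exact: is_deriveM.
- exists (fun x => G n.+1 (f x) * f' x).
    by apply: elementaryM => //; exact: elementary_comp.
  by move=> x; exact: is_derive_comp1.
Qed.

Lemma elementary_partials s f : elementary f -> elementary (partials s f).
Proof.
move=> ef; elim: s => //= i s IHs.
have [g eg dg] := elementary_is_derive i IHs.
rewrite (_ : (fun _ => _) = g)//; apply/funext => x.
by have [] := dg x.
Qed.

Lemma elementary_smooth f : elementary f -> smooth f.
Proof.
move=> ef s; have es := elementary_partials s ef; split.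
  exact: elementary_continuous.
move=> i x; have [g eg dg] := elementary_is_derive i es.
by have [] := dg x.
Qed.

Lemma elementary_sum n (f : 'I_n -> R4 R -> R) : (forall i, elementary (f i)) ->
  elementary (fun x => \sum_(i < n) f i x).
Proof.
elim: n f => [|n IHn] f ef.
  rewrite (_ : (fun _ => _) = fun=> 0); first exact: elementary_cst.
  by apply/funext => x; rewrite big_ord0.
rewrite (_ : (fun _ => _) =
    fun x => (\sum_(i < n) f (widen_ord (leqnSn n) i) x) + f ord_max x).
  by apply: elementaryD => //; exact: IHn.
by apply/funext => x; rewrite big_ord_recr.
Qed.

Lemma elementaryB f g : elementary f -> elementary g ->
  elementary (fun x => f x - g x).
Proof.
move=> ef eg; rewrite (_ : (fun _ => _) = fun x => f x + (-1) * g x).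
  by apply: elementaryD => //; apply: elementaryM => //; exact: elementary_cst.
by apply/funext => x; rewrite mulN1r.
Qed.

Definition sqdist (c x : R4 R) : R := \sum_(i < 4) (coord4 i x - coord4 i c) ^+ 2.

Lemma elementary_sqdist c : elementary (sqdist c).
Proof.
apply: elementary_sum => i.
rewrite (_ : (fun _ => _) =
  fun x => (coord4 i x - coord4 i c) * (coord4 i x - coord4 i c)).
  by apply: elementaryM; apply: elementaryB;
    [exact: elementary_coord|exact: elementary_cst
    |exact: elementary_coord|exact: elementary_cst].
by apply/funext => x; rewrite expr2.
Qed.

Lemma sqdist_ge0 c x : 0 <= sqdist c x.
Proof. by apply: sumr_ge0 => i _; exact: sqr_ge0. Qed.

Lemma is_derive_sqdist i c x :
  is_derive x (std_basis i) (sqdist c) (2 * (coord4 i x - coord4 i c)).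
Proof.
pose h j y : R := (coord4 j y - coord4 j c) ^+ 2.
have dh j : is_derive x (std_basis i) (h j) (2 * (i == j)%:R * (coord4 j x - coord4 j c)).
  have dj := is_derive_coord4 i j x.
  apply: is_derive_eq; rewrite /GRing.scale/= subr0; ring.
rewrite (_ : sqdist c = \sum_(j < 4) h j); last first.
  by apply/funext => y; rewrite fct_sumE.
apply: is_derive_eq; rewrite (bigD1 i)//= eqxx mulr1 big1 ?addr0// => j ji.
by rewrite eq_sym (negbTE ji) mulr0 mul0r.
Qed.

Lemma partial_radial i c (F F' : R -> R) :
  (forall s : R, 0 <= s -> is_derive s 1 F (F' s)) -> forall x,
  is_derive x (std_basis i) (fun x => F (sqdist c x))
    (F' (sqdist c x) * (2 * (coord4 i x - coord4 i c))).
Proof.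
move=> dF x; apply: is_derive_comp1; first exact: is_derive_sqdist.
by apply: dF; exact: sqdist_ge0.
Qed.

Lemma partial2_radial i c (F F' F'' : R -> R) :
  (forall s : R, 0 <= s -> is_derive s 1 F (F' s)) ->
  (forall s : R, 0 <= s -> is_derive s 1 F' (F'' s)) -> forall x,
  partials [:: i; i] (fun x => F (sqdist c x)) x =
  4 * (coord4 i x - coord4 i c) ^+ 2 * F'' (sqdist c x) + 2 * F' (sqdist c x).
Proof.
move=> dF dF' x /=.
rewrite (_ : (fun y => 'D_(std_basis i) _ y) =
   fun y => F' (sqdist c y) * (2 * (coord4 i y - coord4 i c))); last first.
  by apply/funext => y; have [] := partial_radial i c dF y.
have d1 := partial_radial i c dF' x.
have d2 := is_derive_coord4 i i x.
have : is_derive x (std_basis i)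
  (fun y => F' (sqdist c y) * (2 * (coord4 i y - coord4 i c)))
  (4 * (coord4 i x - coord4 i c) ^+ 2 * F'' (sqdist c x) + 2 * F' (sqdist c x)).
  apply: is_derive_eq; rewrite /GRing.scale/= eqxx subr0 (_ : true%:R = 1 :> R)//; ring.
by case.
Qed.

(** The profile [F] is a function of the squared distance, which has
    gradient [2 (x - c)] everywhere, also at [c]. The coefficient [8] is twice
    the dimension. *)
Lemma laplacian_radial c (F F' F'' : R -> R) :
  (forall s : R, 0 <= s -> is_derive s 1 F (F' s)) ->
  (forall s : R, 0 <= s -> is_derive s 1 F' (F'' s)) -> forall x,
  \sum_(i < 4) partials [:: i; i] (fun x => F (sqdist c x)) x =
  4 * sqdist c x * F'' (sqdist c x) + 8 * F' (sqdist c x).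
Proof.
move=> dF dF' x.
under eq_bigr do rewrite (partial2_radial _ _ dF dF').
rewrite big_split/= -mulr_suml -mulr_sumr sumr_const card_ord -/(sqdist c x).
ring.
Qed.

End elementary.

Section inverse_powers.
Context {R : realType}.

Lemma is_derive_Vn k (y : R) : y != 0 ->
  is_derive y 1 (fun z : R => z ^- k) (- k%:R * y ^- k.+1).
Proof.
move=> y0.
have d : is_derive y 1 (fun z : R => z ^+ k) (k%:R * y ^+ k.-1).
  apply: DeriveDef; first exact: exprn_derivable.
  by rewrite exp_derive /GRing.scale/= mulr1.
have dV := @is_deriveV R (fun z => z ^+ k) y _ 1 (expf_neq0 k y0) d.
apply: (is_derive_eq dV); rewrite /GRing.scale/=.
case: k {d dV} => [|k]; first by rewrite !mul0r mulr0 oppr0 mul0r.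
rewrite [k.+1.-1]/= ![_ ^+ k.+2]exprS ![_ ^+ k.+1]exprS; field.
by rewrite y0 expf_neq0.
Qed.

Lemma elementaryV (f : R4 R -> R) : (forall x, f x != 0) -> elementary f ->
  elementary (fun x => (f x)^-1).
Proof.
move=> f0 ef; pose G k (y : R) := (-1) ^+ k * k`!%:R * y ^- k.+1.
rewrite (_ : (fun _ => _) = fun x => G 0%N (f x)); last first.
  by apply/funext => x; rewrite /G expr0 fact0 !mul1r expr1.
apply: elementary_comp => // k x.
have d := is_deriveZ ((-1) ^+ k * k`!%:R) (is_derive_Vn k.+1 (f0 x)).
apply: (is_derive_eq d); rewrite /G /GRing.scale/= factS natrM [(-1) ^+ k.+1]exprS; ring.
Qed.

Lemma elementary_ln (f : R4 R -> R) : (forall x, 0 < f x) -> elementary f ->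
  elementary (fun x => ln (f x)).
Proof.
move=> f0 ef.
pose G k (y : R) := if k is k'.+1 then (-1) ^+ k' * k'`!%:R * y ^- k'.+1 else ln y.
apply: (@elementary_comp _ G 0%N) => // -[|k] x.
  apply: (is_derive_eq (is_derive1_ln (f0 x))).
  by rewrite /G expr0 fact0 !mul1r expr1.
have d := is_deriveZ ((-1) ^+ k * k`!%:R) (is_derive_Vn k.+1 (lt0r_neq0 (f0 x))).
apply: (is_derive_eq d); rewrite /G /GRing.scale/= factS natrM [(-1) ^+ k.+1]exprS; ring.
Qed.

End inverse_powers.

(** * The product measure and the unit ball *)

Section measurability.
Context {R : realType}.

(** Balls for the sup norm are products of intervals: measurable for the
    product sigma-algebra, of known measure, and a basis of the topology. *)
Definition box4 (q : R * R * R * R) (e : R) : set (mR4 R) :=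
  ball q.1.1.1 e `*` ball q.1.1.2 e `*` ball q.1.2 e `*` ball q.2 e.

Lemma measurable_box4 q e : measurable (box4 q e).
Proof.
by do 3?apply: measurableX; rewrite ball_itv; exact: measurable_itv.
Qed.

(** An open set is the countable union of the boxes with rational centre and
    radius [1/(n+1)] that it contains. *)
Lemma open_measurable4 (U : set (R4 R)) : open U -> measurable (U : set (mR4 R)).
Proof.
move=> oU.
pose I := (rat * rat * rat * rat * nat)%type.
pose c (i : I) : R4 R :=
  (ratr i.1.1.1.1, ratr i.1.1.1.2, ratr i.1.1.2, ratr i.1.2).
pose B (i : I) : set (mR4 R) := box4 (c i) (i.2.+1%:R^-1).
pose D : set I := [set i | B i `<=` U].
have -> : U = \bigcup_(i in D) B i.
  apply/seteqP; split=> [x Ux|x [i Di Bix]]; last exact: Di.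
  have /nbhs_ballP[e/= e0 xeU] : nbhs x U by exact: open_nbhs_nbhs.
  have [n ne] : exists n : nat, n.+1%:R^-1 < e / 2 :> R.
    exists (Num.truncn (e / 2)^-1).
    rewrite invf_plt ?posrE// ?divr_gt0// ?truncnS_gt//.
  pose r : R := n.+1%:R^-1.
  have r0 : 0 < r by rewrite invr_gt0.
  have rq (y : R) : exists q : rat, `|ratr q - y| < r.
    have [q /andP[q1 q2]] : exists q : rat, (y - r < ratr q < y + r)%R.
      have : y - r < y + r by rewrite ltrD2l gtrN.
      by move=> /rat_in_itvoo[q]; rewrite in_itv/= => ?; exists q.
    by exists q; rewrite ltr_distl; apply/andP; split.
  case: x Ux xeU => -[[x0 x1] x2] x3 Ux xeU.
  have [q0 h0] := rq x0; have [q1 h1] := rq x1.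
  have [q2 h2] := rq x2; have [q3 h3] := rq x3.
  exists (q0, q1, q2, q3, n); last by [].
  move=> [[[y0 y1] y2] y3] [[[/= k0 k1] k2] k3]; apply: xeU.
  have T (q : rat) (x y : R) : `|ratr q - x| < r -> ball (ratr q : R) r y -> ball x e y.
    rewrite /ball/= => a b.
    rewrite -(subrK (ratr q) x) -addrA (le_lt_trans (ler_normD _ _))//.
    rewrite [e]splitr ltrD//; last exact: lt_trans b ne.
    by rewrite distrC; exact: lt_trans a ne.
  by split; [split; [split|]|]; [exact: T h0 k0|exact: T h1 k1|exact: T h2 k2|exact: T h3 k3].
rewrite bigcup_mkcond.
apply: countable_bigcupT_measurable => [|i]; first exact: countableP.
by case: ifPn => // _; exact: measurable_box4.
Qed.

Lemma continuous_measurable4 (f : R4 R -> R) : continuous f ->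
  measurable_fun [set: mR4 R] (f : mR4 R -> measurableTypeR R).
Proof.
move=> /continuousP cf; apply: (measurability _ (measurable_realfun.RGenOpens.measurableE R)).
move=> _ [_ [a [b ->] <-]]; rewrite setTI; apply: open_measurable4.
by apply: cf; exact: interval_open.
Qed.

Lemma enorm_sub (x c : R4 R) : enorm (x - c) = Num.sqrt (sqdist c x).
Proof.
congr Num.sqrt; apply: eq_bigr => i _; congr (_ ^+ 2).
by case: x c => [[[x0 x1] x2] x3] [[[y0 y1] y2] y3]; case: i => -[|[|[|[|]]]].
Qed.

Lemma enorm_sqdist (x : R4 R) : enorm x = Num.sqrt (sqdist 0 x).
Proof. by rewrite -enorm_sub subr0. Qed.

Lemma unit_ballE : unit_ball = [set x : R4 R | sqdist 0 x < 1].
Proof.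
apply/seteqP; split=> x; rewrite /unit_ball/= enorm_sqdist => x1.
  rewrite ltNge; apply/negP => s1; move: x1; apply/negP.
  by rewrite -leNgt -[leLHS]sqrtr1; apply: ler_wsqrtr.
by rewrite -[ltRHS]sqrtr1 ltr_sqrt.
Qed.

Lemma open_unit_ball : open (@unit_ball R).
Proof.
rewrite unit_ballE.
have /continuousP := elementary_continuous (@elementary_sqdist R 0).
by move=> /(_ [set y | y < 1]); apply; exact: open_lt.
Qed.

Lemma measurable_unit_ball : measurable (unit_ball : set (mR4 R)).
Proof. by apply: open_measurable4; exact: open_unit_ball. Qed.

Lemma unit_ball_box : (unit_ball : set (mR4 R)) `<=` box4 0 1.
Proof.
rewrite unit_ballE => -[[[x0 x1] x2] x3]; rewrite /sqdist/= !big_ord_recl big_ord0.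
rewrite /coord4/= !subr0 addr0 => h.
have k (y z : R) : 0 <= z -> y ^+ 2 + z < 1 -> ball (0 : R) 1 y.
  rewrite /ball/= sub0r normrN => z0 yz.
  by rewrite -(@ltr_pXn2r _ 2) ?nnegrE// expr1n real_normK ?num_real//; lra.
have := sqr_ge0 x0; have := sqr_ge0 x1; have := sqr_ge0 x2; have := sqr_ge0 x3.
move=> ? ? ? ?.
by split; [split; [split|]|];
  [apply: (k _ (x1 ^+ 2 + x2 ^+ 2 + x3 ^+ 2))
  |apply: (k _ (x0 ^+ 2 + x2 ^+ 2 + x3 ^+ 2))
  |apply: (k _ (x0 ^+ 2 + x1 ^+ 2 + x3 ^+ 2))
  |apply: (k _ (x0 ^+ 2 + x1 ^+ 2 + x2 ^+ 2))] => /=; lra.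
Qed.

Lemma leb4X (A B C D : set (measurableTypeR R)) : measurable A -> measurable B ->
  measurable C -> measurable D ->
  leb4 (A `*` B `*` C `*` D) = (lebesgue_measure A * lebesgue_measure B *
    lebesgue_measure C * lebesgue_measure D)%E.
Proof.
move=> mA mB mC mD.
apply: etrans; first by apply: product_measure1E => //; do 2?apply: measurableX.
congr (_ * _)%E.
apply: etrans; first by apply: product_measure1E => //; exact: measurableX.
by congr (_ * _)%E; exact: product_measure1E.
Qed.

Lemma leb4_box (q : R4 R) e : 0 < e -> leb4 (box4 q e) = ((e *+ 2) ^+ 4)%:E.
Proof.
move=> e0; rewrite leb4X; [|by rewrite ball_itv; exact: measurable_itv..].
by rewrite !lebesgue_measure_ball ?ltW// -!EFinM; congr EFin; ring.
Qed.

Lemma leb4_unit_ball : (leb4 (@unit_ball R) < +oo)%E.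
Proof.
apply: (@le_lt_trans _ _ (leb4 (@box4 0 1))); last by rewrite leb4_box// ltry.
apply: le_measure; rewrite ?inE; [|exact: measurable_box4|exact: unit_ball_box].
exact: measurable_unit_ball.
Qed.

End measurability.

(** * Partial derivatives of compactly supported functions have integral zero *)

Section integration_basics.
Context d (T : measurableType d) (R : realType).
Variable mu : {measure set T -> \bar R}.

Lemma integrable_bounded (A : set T) (f : T -> R) (M : R) : measurable A ->
  (mu A < +oo)%E -> measurable_fun setT f -> (forall x, `|f x| <= M) ->
  (forall x, ~ A x -> f x = 0) -> mu.-integrable setT (EFin \o f).
Proof.
move=> mA fA mf fM f0.
have : mu.-integrable A (EFin \o f).
  apply: measurable_bounded_integrable => //.
    exact: measurable_funS mf.
  exists M; split; first exact: num_real.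
  by move=> y My x _ /=; rewrite (le_trans (fM x))// ltW.
move/(integrable_mkcond _ mA); rewrite (_ : _ \_ A = EFin \o f)//.
apply/funext => x; rewrite /patch; case: ifPn => //= xA.
by rewrite f0//; move: xA; rewrite notin_setE.
Qed.

End integration_basics.

Section sigma_finite_product.
Local Open Scope ereal_scope.
Context d1 d2 (T1 : measurableType d1) (T2 : measurableType d2) (R : realType).
Variables (m1 : {sigma_finite_measure set T1 -> \bar R})
          (m2 : {sigma_finite_measure set T2 -> \bar R}).

(** The product measure under a name of its own, which carries the
    sigma-finite structure needed to iterate products. *)
Definition sfprod : set (T1 * T2) -> \bar R := m1 \x m2.

HB.instance Definition _ := Measure.on sfprod.

Let sfprod_sigma_finite : sigma_finite setT sfprod.
Proof.
have [F FT F_oo] := sigma_finiteT m1; have [G GT G_oo] := sigma_finiteT m2.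
exists (fun n => if unpickle n is Some (i, j) then F i `*` G j else set0).
  apply/seteqP; split=> // -[x y] _.
  have [i _ Fx] : (\bigcup_i F i) x by rewrite -FT.
  have [j _ Gy] : (\bigcup_i G i) y by rewrite -GT.
  by exists (pickle (i, j)); rewrite ?pickleK.
move=> n; case: (unpickle n) => [[i j]|]; last by rewrite measure0; split.
have [mF Fi] := F_oo i; have [mG Gj] := G_oo j.
split; first exact: measurableX.
by rewrite /sfprod [ltLHS]product_measure1E// lte_mul_pinfty// ge0_fin_numE.
Qed.

HB.instance Definition _ :=
  Measure_isSigmaFinite.Build _ _ _ sfprod sfprod_sigma_finite.

End sigma_finite_product.

Section fubini_zero.
Context d1 d2 (T1 : measurableType d1) (T2 : measurableType d2) (R : realType).
Variables (m1 : {sigma_finite_measure set T1 -> \bar R})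
          (m2 : {sigma_finite_measure set T2 -> \bar R}).
Variables (A : set T1) (B : set T2) (f : T1 * T2 -> R) (M : R).
Hypotheses (mA : measurable A) (mB : measurable B).
Hypotheses (fA : (m1 A < +oo)%E) (fB : (m2 B < +oo)%E).
Hypotheses (mf : measurable_fun setT f) (fM : forall x, `|f x| <= M).
Hypothesis f0 : forall x, ~ (A `*` B) x -> f x = 0.

Let integrablef : (m1 \x m2)%E.-integrable setT (EFin \o f).
Proof.
apply: (@integrable_bounded _ _ _ _ (A `*` B) f M) => //.
  exact: measurableX.
by rewrite [ltLHS]product_measure1E// lte_mul_pinfty// ge0_fin_numE.
Qed.

Lemma integral_product_eq0r :
  (forall x, \int[m2]_y (f (x, y))%:E = 0)%E -> (\int[(m1 \x m2)%E]_z (f z)%:E = 0)%E.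
Proof.
move=> h; rewrite -(integral12_prod_meas1 integrablef).
by apply: integral0_eq => x _; exact: h.
Qed.

Lemma integral_product_eq0l :
  (forall y, \int[m1]_x (f (x, y))%:E = 0)%E -> (\int[(m1 \x m2)%E]_z (f z)%:E = 0)%E.
Proof.
move=> h; rewrite -(integral21_prod_meas1 integrablef).
by apply: integral0_eq => x _; exact: h.
Qed.

End fubini_zero.

Section divergence.
Context {R : realType}.
Notation lam := (@lebesgue_measure R).

(** The interval [-1, 1] is the trace of the unit ball on a coordinate axis; a
    line parallel to it meets the ball in a smaller interval. *)
Lemma integral_derive_eq0 (F G : R -> R) : continuous G ->
  (forall t : R, is_derive t 1 F (G t)) ->
  (forall t, 1 <= `|t| -> F t = 0) -> (forall t, 1 <= `|t| -> G t = 0) ->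
  (\int[lam]_t (G t)%:E = 0)%E.
Proof.
move=> cG dF F0 G0.
have cF : continuous F.
  by move=> t; apply/differentiable_continuous/derivable1_diffP; have [] := dF t.
transitivity (\int[lam]_(t in `[(-1)%R, 1%R]) (G t)%:E)%E.
  rewrite [RHS]integral_mkcond; apply: eq_integral => t _; rewrite /patch.
  case: ifPn => //; rewrite notin_setE/= in_itv/= => /negP ht.
  rewrite G0// leNgt; apply: contraNN ht.
  by rewrite ltr_norml => /andP[/ltW -> /ltW ->].
rewrite (@continuous_FTC2 _ _ F)//.
- by rewrite !F0 ?normrN ?normr1// subee.
- exact: continuous_subspaceT.
- split; first by move=> t _; have [] := dF t.
    exact: cvg_at_right_filter (cF _).
  exact: cvg_at_left_filter (cF _).
- by move=> t _; rewrite derive1E; have [] := dF t.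
Qed.

Lemma is_derive_section (i : 'I_4) (c : R -> R4 R) (f : R4 R -> R) t e :
  (forall h : R, h *: std_basis i + c t = c (h + t)) ->
  is_derive (c t) (std_basis i) f e -> is_derive t 1 (fun s => f (c s)) e.
Proof.
move=> hc /is_derive_lineP df; apply/is_derive_lineP.
rewrite (_ : (fun h => _) = (fun h : R => f (h *: std_basis i + c t)))//.
by apply/funext => h; rewrite hc [h *: 1]mulr1.
Qed.

Variables (i : 'I_4) (f g : R4 R -> R).
Hypotheses (cg : continuous g) (df : forall x, is_derive x (std_basis i) f (g x)).
Hypotheses (f0 : forall x, ~ unit_ball x -> f x = 0)
           (g0 : forall x, ~ unit_ball x -> g x = 0).
Variables (M : R) (gM : forall x, `|g x| <= M).

Let box0 (h : R4 R -> R) : (forall x, ~ unit_ball x -> h x = 0) ->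
  forall x, ~ box4 0 1 x -> h x = 0.
Proof. by move=> h0 x xB; apply: h0 => /unit_ball_box. Qed.

Let line0 (c : R -> R4 R) (h : R4 R -> R) :
  (forall x, ~ unit_ball x -> h x = 0) ->
  (forall t, coord4 i (c t) = t) -> forall t, 1 <= `|t| -> h (c t) = 0.
Proof.
move=> h0 ci t t1; apply: h0; rewrite unit_ballE/= => ct.
have : t ^+ 2 < 1.
  apply: le_lt_trans ct; rewrite /sqdist (bigD1 i)//= ci.
  rewrite (_ : coord4 i 0 = 0) ?subr0; last by case: (i) => -[|[|[|[|]]]].
  by rewrite lerDl; apply: sumr_ge0 => j _; exact: sqr_ge0.
apply/negP; rewrite -leNgt -[leRHS]real_normK ?num_real//.
by rewrite -[leLHS](expr1n _ 2) lerXn2r ?nnegrE.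
Qed.

Let line_integral0 (c : R -> R4 R) : continuous c ->
  (forall t, coord4 i (c t) = t) ->
  (forall t (h : R), h *: std_basis i + c t = c (h + t)) ->
  (\int[lam]_t (g (c t))%:E = 0)%E.
Proof.
move=> cc ci hc; apply: (@integral_derive_eq0 (fun t => f (c t))).
- by move=> t; apply: (@continuous_comp _ _ _ c g); [exact: cc|exact: cg].
- by move=> t; exact: is_derive_section.
- by move=> t; exact: (@line0 c).
- by move=> t; exact: (@line0 c).
Qed.

Let mu2 : {sigma_finite_measure set (measurableTypeR R * measurableTypeR R)%type -> \bar R} :=
  sfprod lam lam.
Let mu3 : {sigma_finite_measure
    set (measurableTypeR R * measurableTypeR R * measurableTypeR R)%type -> \bar R} :=
  sfprod mu2 lam.

(** By Fubini it suffices to integrate along the lines in direction [i], where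
    the fundamental theorem of calculus applies. The four directions sit at
    different depths of the iterated product, whence the four cases. *)
Lemma integral_partial_eq0 : (\int[leb4]_x (g x)%:E = 0)%E.
Proof.
have mg := continuous_measurable4 cg.
have mI : measurable (ball (0:R) 1 : set (measurableTypeR R)).
  by rewrite ball_itv; exact: measurable_itv.
have mI2 := measurableX mI mI; have mI3 := measurableX mI2 mI.
have fI : (lam (ball 0%R 1%R) < +oo)%E by rewrite lebesgue_measure_ball ?ltry.
have fI2 : (mu2 (ball 0%R 1%R `*` ball 0%R 1%R) < +oo)%E.
  by rewrite /mu2 /mu3 /sfprod/= [ltLHS]product_measure1E// lte_mul_pinfty// ge0_fin_numE.
have fI3 : (mu3 (ball 0%R 1%R `*` ball 0%R 1%R `*` ball 0%R 1%R) < +oo)%E.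
  by rewrite /mu2 /mu3 /sfprod/= [ltLHS]product_measure1E// lte_mul_pinfty// ge0_fin_numE.
have mg3 a : measurable_fun setT (fun z : measurableTypeR R * measurableTypeR R * measurableTypeR R => g (z, a)).
  by apply: (measurableT_comp mg); exact: pair2_measurable.
have mg2 a b : measurable_fun setT (fun z : measurableTypeR R * measurableTypeR R => g (z, b, a)).
  by apply: (measurableT_comp (mg3 a)); exact: pair2_measurable.
have gB x : ~ box4 0 1 x -> g x = 0 by move=> xB; exact: box0 xB.
have gB' (x0 x1 x2 x3 : R) : ~ (ball (0 : R) 1 `*` ball (0 : R) 1 `*` ball (0 : R) 1) (x0, x1, x2)
  \/ ~ ball (0 : R) 1 x3 -> g (x0, x1, x2, x3) = 0.
  by move=> h; apply: gB => -[h1 h2]; case: h; apply.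
have P0 (y : R) : continuous (fun t : R => y) by move=> t; exact: cvg_cst.
have PI : continuous (fun t : R => t) by move=> t; exact: cvg_id.
have PP (U V : normedModType R) (f1 : R -> U) (f2 : R -> V) : continuous f1 -> continuous f2 ->
  continuous (fun t => (f1 t, f2 t)).
  by move=> cf1 cf2 t; apply: cvg_pair; [exact: cf1|exact: cf2].
have L (c : R -> R4 R) := @line_integral0 c.
case: (i) L => -[|[|[|[|]]]]// ? L.
- have := (@integral_product_eq0l _ _ _ _ _ mu3 lam _ _ _ _ mI3 mI fI3 fI mg gM gB).
  apply => x3.
  apply: (@integral_product_eq0l _ _ _ _ _ mu2 lam _ _ _ _ mI2 mI fI2 fI (mg3 x3)) => //.
    by move=> [[x0 x1] x2] h; apply: gB'; left.
  move=> x2.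
  apply: (@integral_product_eq0l _ _ _ _ _ lam lam _ _ _ _ mI mI fI fI (mg2 x3 x2)) => //.
    by move=> [x0 x1] h; apply: gB'; left => -[].
  move=> x1; apply: (L (fun t => (t, x1, x2, x3))) => //.
    exact: (PP _ _ _ _ (PP _ _ _ _ (PP _ _ _ _ PI (P0 _)) (P0 _)) (P0 _)).
  by move=> t h; do 3?congr pair; rewrite /= /GRing.scale/= ?mulr0 ?add0r ?mulr1.
- have := (@integral_product_eq0l _ _ _ _ _ mu3 lam _ _ _ _ mI3 mI fI3 fI mg gM gB).
  apply => x3.
  apply: (@integral_product_eq0l _ _ _ _ _ mu2 lam _ _ _ _ mI2 mI fI2 fI (mg3 x3)) => //.
    by move=> [[x0 x1] x2] h; apply: gB'; left.
  move=> x2.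
  apply: (@integral_product_eq0r _ _ _ _ _ lam lam _ _ _ _ mI mI fI fI (mg2 x3 x2)) => //.
    by move=> [x0 x1] h; apply: gB'; left => -[].
  move=> x0; apply: (L (fun t => (x0, t, x2, x3))) => //.
    exact: (PP _ _ _ _ (PP _ _ _ _ (PP _ _ _ _ (P0 _) PI) (P0 _)) (P0 _)).
  by move=> t h; do 3?congr pair; rewrite /= /GRing.scale/= ?mulr0 ?add0r ?mulr1.
- have := (@integral_product_eq0l _ _ _ _ _ mu3 lam _ _ _ _ mI3 mI fI3 fI mg gM gB).
  apply => x3.
  apply: (@integral_product_eq0r _ _ _ _ _ mu2 lam _ _ _ _ mI2 mI fI2 fI (mg3 x3)) => //.
    by move=> [[x0 x1] x2] h; apply: gB'; left.
  move=> [x0 x1]; apply: (L (fun t => (x0, x1, t, x3))) => //.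
    exact: (PP _ _ _ _ (PP _ _ _ _ (PP _ _ _ _ (P0 _) (P0 _)) PI) (P0 _)).
  by move=> t h; do 3?congr pair; rewrite /= /GRing.scale/= ?mulr0 ?add0r ?mulr1.
- have := (@integral_product_eq0r _ _ _ _ _ mu3 lam _ _ _ _ mI3 mI fI3 fI mg gM gB).
  apply => -[[x0 x1] x2]; apply: (L (fun t => (x0, x1, x2, t))) => //.
    exact: (PP _ _ _ _ (PP _ _ _ _ (PP _ _ _ _ (P0 _) (P0 _)) (P0 _)) PI).
  by move=> t h; do 3?congr pair; rewrite /= /GRing.scale/= ?mulr0 ?add0r ?mulr1.
Qed.

End divergence.

(** * Square integrable functions *)

Section L2_toolkit.
Context d (T : measurableType d) (R : realType).
Variable mu : {measure set T -> \bar R}.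
Implicit Types f g : T -> R.
Notation L2 := (Lfun mu 2%:E).
Notation nrm f := ('N[mu]_2%:E[EFin \o f])%E.

Lemma sqr_Lnorm2 f : (nrm f ^+ 2 = \int[mu]_x (f x ^+ 2)%:E)%E.
Proof.
have sqrE (x : \bar R) : (0 <= x -> x ^+ 2 = x `^ 2)%E.
  by case: x => [r r0|_|//]; rewrite ?poweRyr// poweR_EFin powR_mulrn.
rewrite sqrE ?Lnorm_ge0// poweR_Lnorm//.
by apply: eq_integral => x _ /=; rewrite powR_mulrn// real_normK ?num_real.
Qed.

Lemma Lfun2P f : f \in L2 <->
  measurable_fun setT f /\ (\int[mu]_x (f x ^+ 2)%:E < +oo)%E.
Proof.
split=> [fL|[mf fL]].
  split; first by move: fL; rewrite inE => /andP[/[!inE]/= ].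
  have /integrableP[_] := Lfun2_integrable_sqr fL.
  by under eq_integral do rewrite /= ger0_norm ?sqr_ge0//.
rewrite inE; apply/andP; split; rewrite inE//= /finite_norm.
rewrite unlock poweR_lty//; apply: le_lt_trans fL.
apply: ge0_le_integral => //.
- by move=> x _; exact: poweR_ge0.
- apply/measurable_EFinP; apply: (@measurableT_comp _ _ _ _ _ _ (fun x : R => x `^ 2)%R) => //.
  exact/measurableT_comp.
- by apply/measurable_EFinP; exact: measurable_funX.
- by move=> x _/=; rewrite lee_fin powR_mulrn// real_normK ?num_real.
Qed.

Lemma Lfun2_measurable f : f \in L2 -> measurable_fun setT f.
Proof. by move=> /Lfun2P[]. Qed.

Lemma Lfun2_fin_num f : f \in L2 -> nrm f \is a fin_num.
Proof.
rewrite inE => /andP[_ /[!inE]/=]; rewrite /finite_norm => h.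
by rewrite ge0_fin_numE ?Lnorm_ge0.
Qed.

Lemma Lfun2D f g : f \in L2 -> g \in L2 -> (fun x => f x + g x) \in L2.
Proof.
have p1 : (1 <= 2%:E :> \bar R)%E by rewrite lee_fin; lra.
by move=> fL gL; apply: (Lfun_addr_closed mu p1).2.
Qed.

Lemma Lfun2N f : f \in L2 -> (fun x => - f x) \in L2.
Proof.
move=> /Lfun2P[mf fi]; apply/Lfun2P; split; first exact: measurableT_comp.
by under eq_integral do rewrite sqrrN.
Qed.

Lemma Lfun2B f g : f \in L2 -> g \in L2 -> (fun x => f x - g x) \in L2.
Proof. by move=> fL gL; apply: Lfun2D => //; exact: Lfun2N. Qed.

Lemma Lfun2_mul_integrable f g : f \in L2 -> g \in L2 ->
  mu.-integrable setT (EFin \o (fun x => f x * g x)).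
Proof. by move=> fL gL; apply/Lfun1_integrable; exact: Lfun2_mul_Lfun1. Qed.

Lemma cauchy_schwarz f g : f \in L2 -> g \in L2 ->
  `|\int[mu]_x (f x * g x)| <= fine (nrm f) * fine (nrm g).
Proof.
move=> fL gL; have ifg := Lfun2_mul_integrable fL gL.
rewrite -lee_fin EFinM !fineK ?Lfun2_fin_num// EFin_normr_Rintegral//.
apply: (le_trans (le_abse_integral _ _ _)) => //; first exact: measurable_int ifg.
have := @hoelder _ _ _ mu f g 2 2 (Lfun2_measurable fL) (Lfun2_measurable gL).
by rewrite Lnorm1; apply=> //; lra.
Qed.

Lemma fine_Lnorm2_ge0 f : 0 <= fine (nrm f).
Proof. by rewrite fine_ge0// Lnorm_ge0. Qed.

Lemma ae_eq_Lnorm2 f g : measurable_fun setT f -> measurable_fun setT g ->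
  ae_eq mu setT (EFin \o f) (EFin \o g) -> nrm f = nrm g.
Proof.
move=> mf mg fg; rewrite unlock; congr (_ `^ _)%E.
have m2 (h : T -> R) : measurable_fun setT h ->
    measurable_fun setT (fun x => `|(EFin \o h) x| `^ 2)%E.
  move=> mh; apply/measurable_EFinP; apply: (@measurableT_comp _ _ _ _ _ _ (fun x : R => x `^ 2)%R) => //.
  exact/measurableT_comp.
apply: ge0_ae_eq_integral => //; [exact: m2|exact: m2|..].
- by move=> x _; exact: poweR_ge0.
- by move=> x _; exact: poweR_ge0.
- by apply: filterS fg => x /(_ I) fgx _; rewrite fgx.
Qed.

End L2_toolkit.

(** * Test functions and integration by parts *)

Section test_functions.
Context {R : realType}.
Implicit Types (f g phi : R4 R -> R).
Notation mu := (@leb4 R).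

Lemma bounded_of_compact_support f (K : set (R4 R)) : continuous f -> compact K ->
  (forall x, ~ K x -> f x = 0) -> exists M, forall x, `|f x| <= M.
Proof.
move=> cf cK f0.
have : compact (f @` K) by apply: continuous_compact => //; exact: continuous_subspaceT.
move=> /compact_bounded[M [_ HM]]; exists (`|M| + 1) => x.
have M1 : M < `|M| + 1 by rewrite ltr_pwDr// ler_norm.
have [Kx|/f0 ->] := pselect (K x); last by rewrite normr0 addr_ge0.
by apply: HM => //; exists x.
Qed.

Lemma partials_cat s t f : partials (s ++ t) f = partials s (partials t f).
Proof. by rewrite /partials foldr_cat. Qed.

Lemma smooth_partials s f : smooth f -> smooth (partials s f).
Proof. by move=> sf t; rewrite -partials_cat; exact: sf. Qed.

Lemma smooth_continuous f : smooth f -> continuous f.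
Proof. by move=> /(_ [::])[]. Qed.

Lemma smooth_is_derive i f x : smooth f ->
  is_derive x (std_basis i) f (partials [:: i] f x).
Proof. by move=> /(_ [::])[_ /(_ i x)] /derivableP. Qed.

Lemma partials_eq0 s f (K : set (R4 R)) : closed K ->
  (forall x, ~ K x -> f x = 0) -> forall x, ~ K x -> partials s f x = 0.
Proof.
move=> cK f0; elim: s => //= i s IHs x Kx.
rewrite (@near_eq_derive _ _ _ _ (cst 0)) ?derive_cst//.
have : nbhs x (~` K) by apply: open_nbhs_nbhs; split=> //; exact: closed_openC.
by apply: filterS => y /= /IHs.
Qed.

Lemma test_function_compact_support phi : test_function phi ->
  exists K : set (R4 R), [/\ compact K, closed K, K `<=` unit_ball &
    forall s x, ~ K x -> partials s phi x = 0].
Proof.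
move=> [_ cK Ksub]; exists (closure [set x | phi x != 0]); split=> //.
  exact: closed_closure.
move=> s; apply: partials_eq0; first exact: closed_closure.
move=> x Kx; apply/eqP; apply: contra_notT Kx => xn; exact: subset_closure.
Qed.

Lemma test_function_partials s phi : test_function phi ->
  test_function (partials s phi).
Proof.
move=> tphi; have [sphi cphi phiB] := tphi.
have sub : closure [set x | partials s phi x != 0] `<=` closure [set x | phi x != 0].
  rewrite [X in _ `<=` X]((closure_id _).1 (@closed_closure _ _)).
  apply: closure_subset => x /= /eqP; apply: contra_notP.
  apply: partials_eq0; first exact: closed_closure.
  by move=> y Ky; apply/eqP; apply: contra_notT Ky => yn; exact: subset_closure.
split; first exact: smooth_partials.
  by apply: subclosed_compact sub => //; exact: closed_closure.
exact: subset_trans sub phiB.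
Qed.

Lemma test_function_smooth phi : test_function phi -> smooth phi.
Proof. by case. Qed.

Lemma test_function_out phi x : test_function phi -> ~ unit_ball x -> phi x = 0.
Proof.
move=> /test_function_compact_support[K [_ _ KB K0]] xB.
by apply: (K0 [::]) => /KB.
Qed.

Lemma smooth_measurable f : smooth f -> measurable_fun [set: mR4 R] f.
Proof. by move=> /smooth_continuous; exact: continuous_measurable4. Qed.

Lemma test_function_bounded phi : test_function phi -> exists M, forall x, `|phi x| <= M.
Proof.
move=> tphi; have [K [cK _ _ K0]] := test_function_compact_support tphi.
apply: (bounded_of_compact_support _ cK); last exact: (K0 [::]).
by apply: smooth_continuous; exact: test_function_smooth.
Qed.

Lemma L2B_bounded f (M : R) : measurable_fun [set: mR4 R] f ->
  (forall x, `|f x| <= M) -> (forall x, ~ unit_ball x -> f x = 0) -> L2B f.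
Proof.
move=> mf fM f0; split=> //; apply/Lfun2P; split=> //.
have := @integrable_bounded _ _ _ mu unit_ball (fun x => f x ^+ 2) (M ^+ 2).
move=> /(_ measurable_unit_ball leb4_unit_ball).
have M0 : 0 <= M by rewrite (le_trans _ (fM 0)).
have f2M x : `|f x ^+ 2| <= M ^+ 2 by rewrite normrX lerXn2r ?nnegrE.
have f20 x : ~ unit_ball x -> f x ^+ 2 = 0 by move=> /f0 ->; rewrite expr0n.
move=> /(_ (measurable_funX 2 mf) f2M f20)/integrableP[_].
by under eq_integral do rewrite /= ger0_norm ?sqr_ge0//.
Qed.

Lemma test_function_L2B phi : test_function phi -> L2B phi.
Proof.
move=> tphi; have [M phiM] := test_function_bounded tphi.
apply: L2B_bounded phiM _; first by apply: smooth_measurable; exact: test_function_smooth.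
by move=> x; exact: test_function_out.
Qed.

Lemma Rintegral_ball f : (forall x, ~ unit_ball x -> f x = 0) ->
  \int[mu]_(x in unit_ball) f x = \int[mu]_x f x.
Proof.
move=> f0; rewrite Rintegral_mkcond; congr Rintegral; apply/funext => x.
by rewrite /patch; case: ifPn => //; rewrite notin_setE => /f0.
Qed.

Lemma smooth_test_integrable f phi : smooth f -> test_function phi ->
  mu.-integrable setT (EFin \o (fun x => f x * phi x)).
Proof.
move=> sf tphi; have [K [cK _ KB K0]] := test_function_compact_support tphi.
have sphi := test_function_smooth tphi.
have cfphi : continuous (fun x => f x * phi x).
  by move=> x; apply: cvgM; exact: smooth_continuous.
have [|M HM] := @bounded_of_compact_support _ K cfphi cK.
  by move=> x /(K0 [::])/= ->; rewrite mulr0.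
apply: (@integrable_bounded _ _ _ mu unit_ball _ M) => //.
- exact: measurable_unit_ball.
- exact: leb4_unit_ball.
- exact: continuous_measurable4.
- by move=> x xB; rewrite (test_function_out tphi)// mulr0.
Qed.

Lemma partial_by_parts i f phi : smooth f -> test_function phi ->
  \int[mu]_x (f x * partials [:: i] phi x) =
  - \int[mu]_x (partials [:: i] f x * phi x).
Proof.
move=> sf tphi; have [K [cK _ KB K0]] := test_function_compact_support tphi.
have sphi := test_function_smooth tphi.
have sf' := smooth_partials [:: i] sf; have sphi' := smooth_partials [:: i] sphi.
(* The derivative of [f phi]. *)
pose g x := f x * partials [:: i] phi x + partials [:: i] f x * phi x.
have cg : continuous g.
  by move=> x; apply: cvgD; apply: cvgM; exact: smooth_continuous.
have [|M gM] := @bounded_of_compact_support _ K cg cK.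
  by move=> x Kx; rewrite /g (K0 [:: i])// (K0 [::] x Kx : phi x = 0) !mulr0 addr0.
have tphi' := test_function_partials [:: i] tphi.
have g0 : (\int[mu]_x (g x)%:E = 0)%E.
  apply: (@integral_partial_eq0 R i (fun x => f x * phi x) g cg _ _ _ M gM).
  - move=> x.
    have d1 := smooth_is_derive i x sf; have d2 := smooth_is_derive i x sphi.
    by apply: is_derive_eq; rewrite /g /GRing.scale/= [phi x * _]mulrC.
  - by move=> x xB; rewrite (test_function_out tphi)// mulr0.
  - move=> x xB; rewrite /g (test_function_out tphi)// (test_function_out tphi')//.
    by rewrite !mulr0 addr0.
apply/eqP; rewrite -addr_eq0 -RintegralD//; last 2 first.
- exact: smooth_test_integrable.
- exact: smooth_test_integrable.
by rewrite /Rintegral g0.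
Qed.

(** Moving the derivatives one at a time reverses their order; keeping track
    of this avoids the symmetry of second derivatives. *)
Lemma partials_by_parts s f phi : smooth f -> test_function phi ->
  \int[mu]_x (f x * partials s phi x) =
  (-1) ^+ size s * \int[mu]_x (partials (rev s) f x * phi x).
Proof.
move=> + tphi; elim: s f => [|i s IHs] f sf; first by rewrite mul1r.
rewrite -[partials (i :: s) phi]/(partials [:: i] (partials s phi)).
rewrite partial_by_parts//; last exact: test_function_partials.
rewrite IHs; last exact: smooth_partials.
by rewrite exprS mulN1r mulNr rev_cons -cats1 partials_cat.
Qed.

Lemma test_function_weak_partial s phi : test_function phi ->
  is_weak_partial s phi (partials (rev s) phi).
Proof.
move=> tphi; split; first by apply: test_function_L2B; exact: test_function_partials.
move=> chi tchi; rewrite !Rintegral_ball.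
- by apply: partials_by_parts => //; exact: test_function_smooth.
- by move=> x xB; rewrite (test_function_out tchi)// mulr0.
- by move=> x xB; rewrite (test_function_out tphi)// mul0r.
Qed.

Lemma test_function_H2 phi : test_function phi -> H2 phi.
Proof.
move=> tphi; split; first exact: test_function_L2B.
by move=> s _; exists (partials (rev s) phi); exact: test_function_weak_partial.
Qed.

End test_functions.

(** * A smooth function that is flat at the origin *)

Section flat.
Context {R : realType}.
Implicit Types (p : {poly R}) (t y : R).

Lemma exprn_le_expR n t : 0 <= t -> t ^+ n <= n`!%:R * expR t.
Proof.
move=> t0; case: n => [|n]; first by rewrite expr0 mul1r -expR0 ler_expR.
rewrite mulrC -ler_pdivrMr ?ltr0n ?fact_gt0//.
by rewrite (le_trans _ (expR_ge1Dxn n t0))// lerDr.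
Qed.

Lemma horner_le_expR p : exists C : R, forall t, 0 <= t -> `|p.[t]| <= C * expR t.
Proof.
exists (\sum_(i < size p) `|p`_i| * i`!%:R) => t t0.
rewrite horner_coef (le_trans (ler_norm_sum _ _ _))// mulr_suml.
apply: ler_sum => i _; rewrite normrM -mulrA ler_wpM2l//.
by rewrite ger0_norm ?exprn_ge0// exprn_le_expR.
Qed.

(** The derivative at the origin of all functions [flatn n] comes from this
    bound, because [exp(-1/y)] beats every power of [1/y]. *)
Lemma is_derive0_quadratic (F : R -> R) (C : R) :
  (forall y, `|F y| <= C * y ^+ 2) -> is_derive (0 : R) 1 F 0.
Proof.
move=> FC; have F0 : F 0 = 0.
  by apply/eqP; rewrite -normr_le0 (le_trans (FC 0))// expr0n mulr0.
have cF : h^-1 *: (F (h *: 1 + 0) - F 0) @[h --> 0^'] --> (0 : R).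
  apply/cvgr0Pnorm_lt => e e0.
  have C0 : 0 < `|C| + 1 by rewrite ltr_wpDl.
  near=> h; rewrite F0 subr0 addr0 [h *: 1]mulr1 normrM normfV.
  have h0 : h != 0 by near: h; exact: nbhs_dnbhs_neq.
  rewrite mulrC ltr_pdivrMr ?normr_gt0//.
  have he : `|h| < e / (`|C| + 1).
    near: h; apply: dnbhs0_lt; exact: divr_gt0.
  rewrite (le_lt_trans (FC _))// -[h ^+ 2]real_normK ?num_real// expr2 mulrA.
  rewrite ltr_pM2r ?normr_gt0//.
  rewrite ltr_pdivlMr// in he; apply: le_lt_trans he; rewrite [leRHS]mulrC.
  by rewrite ler_wpM2r// (le_trans (ler_norm C))// lerDl.
by apply: DeriveDef; [apply/cvg_ex; exists 0|exact/cvg_lim].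
Unshelve. all: by end_near. Qed.

(** The derivative of order [n] of [exp(-1/y)] is [p(1/y) exp(-1/y)] for the
    polynomial [p = flat_poly n]; differentiating once more replaces [p] by
    [X^2 (p - p')]. *)
Fixpoint flat_poly (n : nat) : {poly R} :=
  if n is n'.+1 then 'X^2 * (flat_poly n' - (flat_poly n')^`()) else 1.

Definition flatn (n : nat) (y : R) : R :=
  if 0 < y then (flat_poly n).[y^-1] * expR (- y^-1) else 0.

Lemma is_derive_flatn n y : is_derive y 1 (flatn n) (flatn n.+1 y).
Proof.
have [y0|y0|->] := ltgtP y 0.
- have -> : flatn n.+1 y = 0 by rewrite /flatn ltNge (ltW y0).
  have E : \forall z \near y, (cst 0 : R -> R) z = flatn n z.
    have : \forall z \near y, z < 0 by exact: lt_nbhsl.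
    by apply: filterS => z z0; rewrite /flatn ltNge ltW.
  exact: near_eq_is_derive E (is_derive_cst (0 : R) y 1).
- have dV : is_derive y 1 (fun z : R => z^-1) (- y ^- 2).
    have := @is_deriveV R id y 1 1; rewrite /GRing.scale/= mulr1; apply.
    by rewrite gt_eqF.
  have dE : is_derive y 1 (fun z : R => expR (- z^-1)) (expR (- y^-1) * (y ^- 2)).
    have dN : is_derive y 1 (fun z : R => - z^-1) (y ^- 2).
      by apply: is_derive_eq; rewrite opprK.
    exact: (is_derive_comp1 dN (is_derive_expR _)).
  have dP : is_derive y 1 (fun z : R => (flat_poly n).[z^-1])
      ((flat_poly n)^`().[y^-1] * - y ^- 2).
    exact: (is_derive_comp1 dV (is_derive_poly (flat_poly n) _)).
  have E : \forall z \near y, (flat_poly n).[z^-1] * expR (- z^-1) = flatn n z.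
    have : \forall z \near y, 0 < z by exact: lt_nbhsr.
    by apply: filterS => z z0; rewrite /flatn z0.
  apply: (near_eq_is_derive E).
  apply: is_derive_eq; rewrite /flatn y0/= /GRing.scale/= hornerM hornerXn hornerD hornerN.
  rewrite -exprVn; ring.
- have -> : flatn n.+1 0 = 0 by rewrite /flatn ltxx.
  have [C HC] := horner_le_expR ('X^2 * flat_poly n).
  apply: (@is_derive0_quadratic _ `|C|) => z; rewrite /flatn.
  case: ifPn => z0; last by rewrite normr0 mulr_ge0 ?sqr_ge0.
  have := HC z^-1; rewrite invr_ge0 (ltW z0) => /(_ isT).
  rewrite hornerM hornerXn normrM ger0_norm ?exprn_ge0 ?invr_ge0 ?(ltW z0)//.
  rewrite exprVn mulrC ler_pdivrMr ?exprn_gt0// => h.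
  rewrite normrM (ger0_norm (expR_ge0 _)) expRN ler_pdivrMr ?expR_gt0//.
  rewrite (le_trans h)// mulrAC; apply: ler_wpM2r; first exact: expR_ge0.
  by apply: ler_wpM2r; [exact: sqr_ge0|exact: ler_norm].
Qed.

Definition flat : R -> R := flatn 0.

Lemma flatE y : 0 < y -> flat y = expR (- y^-1).
Proof. by move=> y0; rewrite /flat /flatn y0 hornerC mul1r. Qed.

Lemma flat_eq0 y : y <= 0 -> flat y = 0.
Proof. by rewrite leNgt /flat /flatn => /negbTE ->. Qed.

Lemma flat_ge0 y : 0 <= flat y.
Proof.
have [/flat_eq0 ->//|y0] := leP y 0; by rewrite flatE// expR_ge0.
Qed.

Lemma flat_le1 y : flat y <= 1.
Proof.
have [/flat_eq0 ->//|y0] := leP y 0.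
by rewrite flatE// -expR0 ler_expR lerNl oppr0 invr_ge0 ltW.
Qed.

Lemma elementary_flat f : elementary f -> elementary (fun x => flat (f x)).
Proof.
move=> ef; apply: (@elementary_comp _ flatn 0) => // k x; exact: is_derive_flatn.
Qed.

End flat.

(** * Functions with vanishing integrals over a generating family *)

Section product_generators.
Context d1 d2 (T1 : measurableType d1) (T2 : measurableType d2).
Variables (C1 : set (set T1)) (C2 : set (set T2)).
Hypotheses (C1T : C1 setT) (C2T : C2 setT).
Hypotheses (C1E : @measurable _ T1 = <<s C1 >>) (C2E : @measurable _ T2 = <<s C2 >>).

Definition rectangles : set (set (T1 * T2)) :=
  [set A `*` B | A in C1 & B in C2].

Lemma rectanglesT : rectangles setT.
Proof. by exists setT => //; exists setT => //; rewrite setXTT. Qed.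

(** Requiring the whole spaces to be among the generators makes the cylinders
    over generators rectangles. *)
Lemma measurable_rectanglesE : @measurable _ (T1 * T2)%type = <<s rectangles >>.
Proof.
apply/seteqP; split.
  apply: smallest_sub; first exact: smallest_sigma_algebra.
  rewrite C1E C2E -2!g_sigma_preimageE subUset; split.
    apply: smallest_sub; first exact: smallest_sigma_algebra.
    move=> _ [A CA <-]; apply: sub_gen_smallest.
    by exists A => //; exists setT => //; rewrite setTI setXT.
  apply: smallest_sub; first exact: smallest_sigma_algebra.
  move=> _ [A CA <-]; apply: sub_gen_smallest.
  by exists setT => //; exists A => //; rewrite setTI setTX.
apply: smallest_sub; first exact: sigma_algebra_measurable.
move=> _ [A CA [B CB <-]]; apply: measurableX.
  by rewrite C1E; exact: sub_gen_smallest.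
by rewrite C2E; exact: sub_gen_smallest.
Qed.

Lemma rectangles_setI : setI_closed C1 -> setI_closed C2 -> setI_closed rectangles.
Proof.
move=> C1I C2I _ _ [A CA [B CB <-]] [A' CA' [B' CB' <-]].
by exists (A `&` A'); [exact: C1I|exists (B `&` B'); [exact: C2I|rewrite setXI]].
Qed.

End product_generators.

Section vanishing_on_generators.
Context d (T : measurableType d) (R : realType).
Variable mu : {measure set T -> \bar R}.

(** The sets over which [g] has integral zero form a Dynkin system. *)
Lemma ae_eq0_of_generators (G : set (set T)) (g : T -> R) :
  @measurable _ T = <<s G >> -> setI_closed G -> G setT ->
  mu.-integrable setT (EFin \o g) ->
  (forall A, G A -> (\int[mu]_(x in A) (g x)%:E = 0)%E) ->
  ae_eq mu setT (EFin \o g) (cst 0%E).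
Proof.
move=> GE GI GT ig g0.
have igS A : measurable A -> mu.-integrable A (EFin \o g).
  by move=> mA; apply: integrableS ig.
have z : forall A, <<s G >> A -> (\int[mu]_(x in A) (g x)%:E = 0)%E.
  apply: dynkin_induction => //.
  - exact: g0.
  - move=> S mS S0; have := g0 _ GT; rewrite -(setUv S) integral_setU//.
    + by rewrite S0 add0e.
    + exact: measurableC.
    + by rewrite setUv; apply: measurable_int ig.
    + by apply/disj_setPCl.
  - move=> F mF tF F0; rewrite integral_bigcup//; last exact/igS/bigcup_measurable.
    by rewrite eseries0.
apply: integral_ae_eq => // E _ mE.
by rewrite integral0 z// -GE.
Qed.

End vanishing_on_generators.

(** * Functions orthogonal to all test functions *)

Section half_space_approximation.
Context {R : realType}.
Notation mu := (@leb4 R).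

(** The value [None] adds the full line, so that the rectangles over this
    family contain the whole space. *)
Definition halfline (o : option R) : set (measurableTypeR R) :=
  if o is Some b then [set` `]-oo, b[%R] else setT.

Lemma measurable_halflineE :
  @measurable _ (measurableTypeR R) = <<s range halfline >>.
Proof.
have mh o : measurable (halfline o).
  by case: o => [b|]; [exact: measurable_itv|exact: measurableT].
apply/seteqP; split.
  rewrite measurable_realfun.RGenInftyO.measurableE.
  apply: smallest_sub; first exact: smallest_sigma_algebra.
  by move=> _ [b ->]; apply: sub_gen_smallest; exists (Some b).
apply: smallest_sub; first exact: (@sigma_algebra_measurable _ (measurableTypeR R)).
by move=> _ [ob _ <-].
Qed.

Lemma halfline_setI : setI_closed (range halfline).
Proof.
move=> _ _ [ob _ <-] [ob' _ <-].
case: ob => [b|]; last by rewrite setTI; exists ob'.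
case: ob' => [b'|]; last by rewrite setIT; exists (Some b).
exists (Some (Num.min b b')) => //=.
by apply/seteqP; split => x /=; rewrite !in_itv/= lt_min => /andP.
Qed.

Definition halfline_cutoff (o : option R) (n : nat) (y : R) : R :=
  if o is Some b then flat (n%:R * (b - y)) else 1.

Lemma flat_cvg1 (u : nat -> R) : u @ \oo --> +oo -> flat (u n) @[n --> \oo] --> (1 : R).
Proof.
move=> uy; have Vu : (u n)^-1 @[n --> \oo] --> (0 : R).
  by apply/gtr0_cvgV0 => //; move/cvgryPgt : uy; exact.
have cE : expR (- (u n)^-1) @[n --> \oo] --> (1 : R).
  rewrite -(expR0 R) -(oppr0 R); apply: continuous_cvg; first exact: continuous_expR.
  exact: cvgN.
apply: cvg_trans cE; apply: near_eq_cvg.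
have : \forall n \near \oo, 0 < u n by move/cvgryPgt : uy; exact.
by apply: filterS => n un; rewrite flatE.
Qed.

Lemma cvgy_linear (a b : R) : 0 < a -> n%:R * a - b @[n --> \oo] --> +oo.
Proof.
move=> a0; apply/cvgryPge => A.
have : \forall n \near \oo, (A + b) / a <= n%:R :> R.
  by move: (@cvgr_idn R) => /cvgryPge; exact.
by apply: filterS => n; rewrite ler_pdivrMr// lerBrDr.
Qed.

Lemma halfline_cutoff_cvg o y :
  halfline_cutoff o n y @[n --> \oo] --> (\1_(halfline o) y : R).
Proof.
case: o => [b|]/=; last by rewrite indicT; exact: cvg_cst.
rewrite indicE; have [yb|by_] := ltP y b.
  rewrite mem_set ?in_itv//=; apply: flat_cvg1.
  by under eq_fun do rewrite -[_ * _]subr0; apply: cvgy_linear; rewrite subr_gt0.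
rewrite memNset/=; last by rewrite in_itv/= => /lt_geF; rewrite by_.
under eq_fun do rewrite flat_eq0 ?mulr_ge0_le0 ?subr_le0//.
exact: cvg_cst.
Qed.

Lemma halfline_cutoff01 o n y : 0 <= halfline_cutoff o n y <= 1.
Proof. by case: o => [b|]/=; rewrite ?flat_ge0 ?flat_le1 ?ler01 ?lexx. Qed.

Lemma elementary_halfline_cutoff o n f : elementary f ->
  elementary (fun x => halfline_cutoff o n (f x)).
Proof.
case: o => [b|] ef; last exact: elementary_cst.
apply: elementary_flat; apply: elementaryM; first exact: elementary_cst.
by apply: elementaryB => //; exact: elementary_cst.
Qed.

(** The term [-1] keeps the support inside a strictly smaller ball. *)
Definition ball_cutoff (n : nat) (x : R4 R) : R := flat (n%:R * (1 - sqdist 0 x) - 1).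

Lemma ball_cutoff_cvg x : unit_ball x -> ball_cutoff n x @[n --> \oo] --> (1 : R).
Proof.
rewrite unit_ballE/= => x1; apply: flat_cvg1.
by apply: cvgy_linear; rewrite subr_gt0.
Qed.

Lemma compact_sqdist_le (c : R) : compact [set x : R4 R | sqdist 0 x <= c].
Proof.
pose K : set (R4 R) := `[- (`|c| + 1), `|c| + 1] `*` `[- (`|c| + 1), `|c| + 1]
  `*` `[- (`|c| + 1), `|c| + 1] `*` `[- (`|c| + 1), `|c| + 1].
have cK : compact K by do 3?apply: compact_setX; exact: segment_compact.
apply: (subclosed_compact _ cK).
  have /continuousP := elementary_continuous (@elementary_sqdist R 0) => cs.
  have -> : [set x : R4 R | sqdist 0 x <= c] = ~` (sqdist 0 @^-1` [set y | c < y]).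
    by apply/seteqP; split => x /=; rewrite leNgt => /negP.
  by apply: open_closedC; apply: cs; exact: open_gt.
move=> [[[x0 x1] x2] x3]; rewrite /sqdist/= !big_ord_recl big_ord0.
rewrite /coord4/= !subr0 addr0 => h.
have k (y z : R) : 0 <= z -> y ^+ 2 + z <= c -> - (`|c| + 1) <= y <= `|c| + 1.
  move=> z0 yz; rewrite -ler_norml -(@ler_pXn2r _ 2) ?nnegrE ?addr_ge0//.
  rewrite real_normK ?num_real//; have := ler_norm c; have := normr_ge0 c.
  nra.
have := sqr_ge0 x0; have := sqr_ge0 x1; have := sqr_ge0 x2; have := sqr_ge0 x3.
move=> ? ? ? ?.
by split; [split; [split|]|] => /=; rewrite in_itv/=;
  [apply: (k _ (x1 ^+ 2 + x2 ^+ 2 + x3 ^+ 2))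
  |apply: (k _ (x0 ^+ 2 + x2 ^+ 2 + x3 ^+ 2))
  |apply: (k _ (x0 ^+ 2 + x1 ^+ 2 + x3 ^+ 2))
  |apply: (k _ (x0 ^+ 2 + x1 ^+ 2 + x2 ^+ 2))] => /=; lra.
Qed.

Lemma test_function_of_support f (c : R) : smooth f -> c < 1 ->
  (forall x, c < sqdist 0 x -> f x = 0) -> test_function f.
Proof.
move=> sf c1 f0; set K := [set x : R4 R | sqdist 0 x <= c].
have cK : compact K := @compact_sqdist_le c.
have clK : closed K.
  by apply: compact_closed => //; exact: norm_hausdorff.
have sub : closure [set x | f x != 0] `<=` K.
  rewrite [X in _ `<=` X]((closure_id _).1 clK); apply: closure_subset => x /= fx.
  by rewrite /K/= leNgt; apply: contra fx => /f0 ->.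
split=> //; first by apply: subclosed_compact sub => //; exact: closed_closure.
by apply: (subset_trans sub) => x; rewrite unit_ballE/= => /le_lt_trans; apply.
Qed.

Lemma test_function_ball_cutoff n f : elementary f -> test_function (fun x => ball_cutoff n x * f x).
Proof.
move=> ef.
have sm : smooth (fun x => ball_cutoff n x * f x).
  apply/elementary_smooth/elementaryM => //; apply: elementary_flat.
  apply: elementaryB; last exact: elementary_cst.
  apply: elementaryM; first exact: elementary_cst.
  by apply: elementaryB; [exact: elementary_cst|exact: elementary_sqdist].
have c1 : 1 - n.+1%:R^-1 < 1 :> R by rewrite gtrBl invr_gt0 ltr0n.
apply: (test_function_of_support sm c1) => x hx; rewrite /ball_cutoff flat_eq0 ?mul0r// subr_le0.
have n1 : n%:R * n.+1%:R^-1 <= 1 :> R by rewrite ler_pdivrMr ?ltr0n// mul1r ler_nat.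
by apply: le_trans n1; rewrite ler_wpM2l// lerBlDl -lerBlDr ltW.
Qed.

Lemma L2B_integrable g : L2B g -> mu.-integrable setT (EFin \o g).
Proof.
move=> [g2 g0].
have b2 : L2B (\1_unit_ball : R4 R -> R).
  apply: (@L2B_bounded _ _ 1) => //.
  - by apply: measurable_indic; exact: measurable_unit_ball.
  - by move=> x; rewrite ger0_norm ?indicE//; case: (_ \in _); rewrite ?lexx ?ler01.
  - by move=> x xB; rewrite indicE memNset.
have := Lfun2_mul_integrable g2 b2.1.
rewrite (_ : EFin \o _ = EFin \o g)//; apply/funext => x /=; congr EFin.
rewrite indicE; have [xB|xB] := pselect (unit_ball x); first by rewrite mem_set// mulr1.
by rewrite memNset// mulr0 g0.
Qed.

(** The fundamental lemma of the calculus of variations. Products of cut-offs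
    of half-lines with a cut-off of the ball are test functions; they converge
    boundedly to indicators of rectangles, which generate the Borel sets. *)
Lemma L2B_orthogonal_ae_eq0 g : L2B g ->
  (forall chi, test_function chi -> \int[mu]_x (g x * chi x) = 0) ->
  ae_eq mu setT (EFin \o g) (cst 0%E).
Proof.
move=> gL gchi; have ig := L2B_integrable gL; have [g2 g0] := gL.
pose H := rectangles (rectangles (rectangles (range halfline) (range halfline))
  (range halfline)) (range halfline).
have HT : range halfline setT by exists None.
have E := measurable_halflineE.
apply: (@ae_eq0_of_generators _ _ _ _ H) => //.
- apply: measurable_rectanglesE => //; first by do 2?apply: rectanglesT.
  apply: measurable_rectanglesE => //; first exact: rectanglesT.
  exact: measurable_rectanglesE.
- by do 3?[apply: rectangles_setI]; exact: halfline_setI.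
- by do 3?apply: rectanglesT.
move=> _ [_ [_ [_ [p0 _ <-] [_ [p1 _ <-] <-]] [_ [p2 _ <-] <-]] [_ [p3 _ <-] <-]].
set A := _ `*` _.
have mA : measurable A.
  by do 3?apply: measurableX; rewrite E; apply: sub_gen_smallest; eexists.
pose h n x : R := halfline_cutoff p0 n (coord4 0 x) * halfline_cutoff p1 n (coord4 1 x) *
  halfline_cutoff p2 n (coord4 2 x) * halfline_cutoff p3 n (coord4 3 x).
pose chi n x := ball_cutoff n x * h n x.
have tchi n : test_function (chi n).
  apply: test_function_ball_cutoff; do 3?apply: elementaryM;
  by apply: elementary_halfline_cutoff; exact: elementary_coord.
have h01 n x : 0 <= h n x <= 1.
  have M01 (a b : R) : 0 <= a <= 1 -> 0 <= b <= 1 -> 0 <= a * b <= 1.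
    by move=> /andP[a0 a1] /andP[b0 b1]; rewrite mulr_ge0// mulr_ile1.
  have k p y := halfline_cutoff01 p n y.
  by rewrite /h; exact: M01 (M01 _ _ (M01 _ _ (k _ _) (k _ _)) (k _ _)) (k _ _).
have gchiA x : g x * chi n x @[n --> \oo] --> g x * \1_A x.
  have [xB|xB] := pselect (unit_ball x); last first.
    rewrite g0// mul0r; under eq_fun do rewrite mul0r; exact: cvg_cst.
  apply: cvgM; first exact: cvg_cst.
  rewrite -[\1_A x]mul1r; apply: cvgM; first exact: ball_cutoff_cvg.
  have -> : \1_A x = \1_(halfline p0) (coord4 0 x) * \1_(halfline p1) (coord4 1 x) *
      \1_(halfline p2) (coord4 2 x) * \1_(halfline p3) (coord4 3 x) :> R.
    by case: x xB => [[[x0 x1] x2] x3] _; rewrite !indicE /A !in_setX -!natrM !mulnb.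
  by do 3?apply: cvgM; exact: halfline_cutoff_cvg.
have mg : measurable_fun [set: mR4 R] g := Lfun2_measurable g2.
have mgchi n : measurable_fun [set: mR4 R] (fun x => (g x * chi n x)%:E).
  apply/measurable_EFinP; apply: measurable_funM => //.
  by apply: smooth_measurable; exact: test_function_smooth.
have mgA : measurable_fun [set: mR4 R] (fun x => (g x * \1_A x)%:E).
  by apply/measurable_EFinP; apply: measurable_funM => //; exact: measurable_indic.
have cvA : {ae mu, forall x, [set: mR4 R] x ->
    (g x * chi n x)%:E @[n --> \oo] --> (g x * \1_A x)%:E}.
  by apply: aeW => x _; apply: cvg_EFin; [exact: nearW|exact: gchiA].
have dom : {ae mu, forall x n, [set: mR4 R] x ->
    (`|(g x * chi n x)%:E| <= (abse \o (EFin \o g)) x)%E}.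
  apply: aeW => x n _; rewrite /= lee_fin normrM ler_piMr//.
  have /andP[h0 h1] := h01 n x.
  rewrite /chi ger0_norm; first by rewrite mulr_ile1 ?flat_ge0 ?flat_le1.
  by rewrite mulr_ge0 ?flat_ge0.
have [_ _ cvI] := dominated_convergence measurableT mgchi mgA cvA (integrable_abse ig) dom.
rewrite integral_mkcond; transitivity (\int[mu]_x (g x * \1_A x)%:E)%E.
  apply: eq_integral => x _; rewrite /patch indicE.
  by case: ifPn => _; rewrite ?mulr1 ?mulr0.
apply/esym; apply: cvg_unique cvI; first exact: ereal_hausdorff.
rewrite [X in X @ _](_ : _ = cst 0%E); first exact: cvg_cst.
apply/funext => n; have := gchi _ (tchi n); rewrite /Rintegral => gchi0.
rewrite -[LHS]fineK; first by congr EFin; exact: gchi0.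
apply: integrable_fin_num => //.
by apply: Lfun2_mul_integrable => //; exact: (test_function_L2B (tchi n)).1.
Qed.

End half_space_approximation.

(** * Weak derivatives and the Laplacian of a function in the closure of test functions *)

Section weak_partial_theory.
Context {R : realType}.
Notation mu := (@leb4 R).
Implicit Types (u v g h f phi psi : R4 R -> R).

Lemma weak_partialP s u : (exists g, is_weak_partial s u g) ->
  is_weak_partial s u (weak_partial s u).
Proof. by move=> ug; exact: (@xgetPex _ (cst 0) [set g | is_weak_partial s u g]). Qed.

Lemma L2B_mul_integrable g h : L2B g -> L2B h ->
  mu.-integrable setT (EFin \o (fun x => g x * h x)).
Proof. by move=> [gL _] [hL _]; exact: Lfun2_mul_integrable. Qed.

Lemma L2BB g h : L2B g -> L2B h -> L2B (fun x => g x - h x).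
Proof.
by move=> [gL g0] [hL h0]; split; [exact: Lfun2B|move=> x xB; rewrite g0// h0// subr0].
Qed.

Lemma Rintegral_ballM g h : L2B g ->
  \int[mu]_(x in unit_ball) (g x * h x) = \int[mu]_x (g x * h x).
Proof. by move=> [_ g0]; apply: Rintegral_ball => x /g0 ->; rewrite mul0r. Qed.

Lemma is_weak_partialB s u v g h : L2B u -> L2B v ->
  is_weak_partial s u g -> is_weak_partial s v h ->
  is_weak_partial s (fun x => u x - v x) (fun x => g x - h x).
Proof.
move=> uL vL [gL ug] [hL vh]; split; first exact: L2BB.
move=> chi tchi; have := ug _ tchi; have := vh _ tchi.
rewrite !Rintegral_ballM//; [|exact: L2BB..].
have tchi' := test_function_partials s tchi.
have cL := test_function_L2B tchi; have cL' := test_function_L2B tchi'.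
have E a b c : L2B a -> L2B b -> L2B c ->
    \int[mu]_x ((a x - b x) * c x) = \int[mu]_x (a x * c x) - \int[mu]_x (b x * c x).
  move=> aL bL ccL; rewrite -RintegralB//; last 2 first.
  - exact: L2B_mul_integrable.
  - exact: L2B_mul_integrable.
  by apply: eq_Rintegral => x _; rewrite mulrBl.
by move=> hv gu; rewrite !E// hv gu mulrBr.
Qed.

Lemma is_weak_partial_unique s u g h :
  is_weak_partial s u g -> is_weak_partial s u h ->
  ae_eq mu setT (EFin \o g) (EFin \o h).
Proof.
move=> [gL ug] [hL uh].
have gh : ae_eq mu setT (EFin \o (fun x => g x - h x)) (cst 0%E).
  apply: L2B_orthogonal_ae_eq0; first exact: L2BB.
  move=> chi tchi.
  have cL := test_function_L2B tchi.
  have -> : (fun x => (g x - h x) * chi x) = (fun x => g x * chi x - h x * chi x).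
    by apply/funext => x; rewrite mulrBl.
  rewrite RintegralB//; [|exact: L2B_mul_integrable..].
  apply/eqP; rewrite subr_eq0; apply/eqP.
  apply: (@mulfI _ ((-1) ^+ size s)); first by rewrite signr_eq0.
  have := ug _ tchi; rewrite uh// => /esym.
  by rewrite (Rintegral_ballM _ gL) (Rintegral_ballM _ hL).
apply: filterS gh => x /(_ I)/= [/eqP]; rewrite subr_eq0 => /eqP-> _.
by [].
Qed.

(** The norms in [H2norm] are those of chosen weak derivatives; this allows
    replacing them by explicit ones. *)
Lemma L2norm_unique s u g h : is_weak_partial s u g -> is_weak_partial s u h ->
  L2norm g = L2norm h.
Proof.
move=> ug uh; apply: ae_eq_Lnorm2; last exact: is_weak_partial_unique ug uh.
  by case: ug => -[/Lfun2_measurable].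
by case: uh => -[/Lfun2_measurable].
Qed.

Lemma test_function_laplacian phi : test_function phi ->
  ae_eq mu setT (EFin \o laplacian phi)
    (EFin \o (fun x => \sum_(i < 4) partials [:: i; i] phi x)).
Proof.
move=> tphi.
have H i : ae_eq mu setT (EFin \o weak_partial [:: i; i] phi)
    (EFin \o partials [:: i; i] phi).
  have w := test_function_weak_partial [:: i; i] tphi.
  by apply: (is_weak_partial_unique _ w); apply: weak_partialP; exists (partials [:: i; i] phi).
have HA : {ae mu, forall x : mR4 R, forall i, weak_partial [:: i; i] phi x = partials [:: i; i] phi x}.
  apply: filter_forall => i; apply: filterS (H i) => x /(_ I)[].
  by [].
apply: filterS HA => x Hx _ /=; congr EFin; rewrite /laplacian.
by apply: eq_bigr => i _; exact: Hx.
Qed.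

(** Smooth functions such as [bubble_potential] live on the whole space. Only
    their restriction to the ball is square integrable a priori, and it is all
    that matters in products with functions vanishing outside the ball. *)
Definition trunc f x : R := f x * \1_unit_ball x.

Lemma trunc_L2B f : continuous f -> L2B (trunc f).
Proof.
move=> cf.
have /compact_bounded[M [_ HM]] : compact (f @` [set x : R4 R | sqdist 0 x <= 1]).
  by apply: continuous_compact; [exact: continuous_subspaceT|exact: compact_sqdist_le].
have M1 : M < `|M| + 1 by rewrite ltr_pwDr// ler_norm.
apply: (@L2B_bounded _ _ (`|M| + 1)).
- apply: measurable_funM; first exact: continuous_measurable4.
  by apply: measurable_indic; exact: measurable_unit_ball.
- move=> x; rewrite /trunc indicE.
  have [xB|xB] := pselect (unit_ball x); last by rewrite memNset// mulr0 normr0 addr_ge0.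
  rewrite mem_set// mulr1; apply: HM => //; exists x => //=.
  by move: xB; rewrite unit_ballE => /ltW.
- by move=> x xB; rewrite /trunc indicE memNset// mulr0.
Qed.

Lemma mul_trunc g f : L2B g -> (fun x => g x * f x) = (fun x => g x * trunc f x).
Proof.
move=> [_ g0]; apply/funext => x; rewrite /trunc indicE.
have [xB|xB] := pselect (unit_ball x); first by rewrite mem_set// mulr1.
by rewrite g0// !mul0r.
Qed.

Lemma le_of_sqre_le (x S : \bar R) (e : R) : (0 <= x)%E -> (x ^+ 2 <= S)%E ->
  (S `^ 2^-1 < e%:E)%E -> (x < e%:E)%E.
Proof.
move=> x0 xS; apply: le_lt_trans.
rewrite [leLHS](_ : x = ((x ^+ 2) `^ 2^-1)%E); last first.
  case: x x0 {xS} => [r r0| _|//].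
    by rewrite -EFin_expe poweR_EFin powR12_sqrt ?sqr_ge0// sqrtr_sqr ger0_norm.
  by rewrite expeS mulyy// poweRyr// gt_eqF// invr_gt0.
have x2 : (0 <= x ^+ 2)%E by rewrite expe_ge0.
apply: gt0_ler_poweR => //.
- by rewrite in_itv/= leey andbT.
- by rewrite in_itv/= leey andbT (le_trans _ xS).
Qed.

Lemma le_sume_term n (F : 'I_n -> \bar R) i : (forall j, 0 <= F j)%E ->
  (F i <= \sum_(j < n) F j)%E.
Proof. by move=> F0; rewrite (bigD1 i)//= leeDl// sume_ge0. Qed.

Lemma H2norm_lt u e : (H2norm u < e%:E)%E -> (L2norm u < e%:E)%E /\
  forall i, (L2norm (weak_partial [:: i; i] u) < e%:E)%E.
Proof.
move=> uE; have sq f : (0 <= L2norm f ^+ 2)%E by rewrite expe_ge0// Lnorm_ge0.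
have sqs i : (0 <= \sum_(j < 4) L2norm (weak_partial [:: i; j] u) ^+ 2)%E.
  by apply: sume_ge0 => j _; exact: sq.
split=> [|i]; apply: (le_of_sqre_le (Lnorm_ge0 _ _ _) _ uE).
  by rewrite -addeA leeDl// adde_ge0// sume_ge0.
rewrite (@le_trans _ _ (\sum_(i < 4) \sum_(j < 4) L2norm (weak_partial [:: i; j] u) ^+ 2)%E)//.
  apply: le_trans (le_sume_term i sqs).
  exact: (@le_sume_term _ (fun j => L2norm (weak_partial [:: i; j] u) ^+ 2)%E).
by rewrite leeDr// adde_ge0// sume_ge0.
Qed.

(** For the test function [phi] within distance [e] of [u] the two integrals
    agree; the difference [u - phi] contributes at most [e] times an L^2 norm
    to each of them. *)
Lemma L2B_ibp_error u psi e i : 0 < e -> H20 u -> smooth psi -> 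
  `|\int[mu]_x (u x * partials [:: i; i] psi x) - \int[mu]_x (weak_partial [:: i; i] u x * psi x)|
  <= e * (fine (L2norm (trunc psi)) + fine (L2norm (trunc (partials [:: i; i] psi)))).
Proof.
move=> e0 [[uL2 uH] uapp] spsi; have [phi tphi uphi] := uapp e e0.
have [w1 w2] := H2norm_lt uphi; have {}w2 := w2 i.
set g := weak_partial [:: i; i] u in w2 *.
have wg : is_weak_partial [:: i; i] u g by apply: weak_partialP; exact: uH.
have wphi := test_function_weak_partial [:: i; i] tphi.
have phiL := test_function_L2B tphi.
have wB := is_weak_partialB uL2 phiL wg wphi.
have wB' : is_weak_partial [:: i; i] (u \- phi) (weak_partial [:: i; i] (u \- phi)).
  by apply: weak_partialP; eexists; exact: wB.
rewrite (L2norm_unique wB' wB) in w2.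
set dphi := partials [:: i; i] phi.
have dphiL : L2B dphi by apply: test_function_L2B; exact: test_function_partials.
have spsi' := smooth_partials [:: i; i] spsi.
set dpsi := partials [:: i; i] psi in spsi' *.
have tL := trunc_L2B (smooth_continuous spsi).
have tL' := trunc_L2B (smooth_continuous spsi').
have gL : L2B g by case: wg.
have I1 : \int[mu]_x (phi x * dpsi x) = \int[mu]_x (dphi x * psi x).
  have := partials_by_parts [:: i; i] spsi tphi; rewrite [size _]/= sqrrN expr1n mul1r => E.
  under eq_Rintegral do rewrite mulrC.
  by rewrite -[LHS]E; apply: eq_Rintegral => x _; rewrite mulrC.
have -> : \int[mu]_x (u x * dpsi x) - \int[mu]_x (g x * psi x) =
    \int[mu]_x ((u x - phi x) * trunc dpsi x) - \int[mu]_x ((g x - dphi x) * trunc psi x).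
  have E (a b c : R4 R -> R) : L2B a -> L2B b -> L2B (trunc c) ->
      \int[mu]_x ((a x - b x) * trunc c x) = \int[mu]_x (a x * c x) - \int[mu]_x (b x * c x).
    move=> aL bL ccL; rewrite (mul_trunc c aL) (mul_trunc c bL) -RintegralB//; last 2 first.
    - exact: L2B_mul_integrable.
    - exact: L2B_mul_integrable.
    by apply: eq_Rintegral => x _; rewrite mulrBl.
  rewrite (E _ _ _ uL2 phiL tL') (E _ _ _ gL dphiL tL) I1; ring.
rewrite (le_trans (ler_normB _ _))// mulrDr addrC; apply: lerD.
  have dL := L2BB gL dphiL.
  rewrite (le_trans (cauchy_schwarz dL.1 tL.1))// ler_wpM2r ?fine_Lnorm2_ge0//.
  by rewrite -lee_fin fineK ?Lfun2_fin_num ?dL.1// ltW.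
have dL := L2BB uL2 phiL.
rewrite (le_trans (cauchy_schwarz dL.1 tL'.1))// ler_wpM2r ?fine_Lnorm2_ge0//.
by rewrite -lee_fin fineK ?Lfun2_fin_num ?dL.1// ltW.
Qed.

(** The function [psi] may be nonzero on the boundary of the ball: the absence
    of boundary terms comes from the vanishing of [u] and its gradient there,
    encoded by approximation in H^2. *)
Lemma H20_ibp u psi i : H20 u -> smooth psi ->
  \int[mu]_x (u x * partials [:: i; i] psi x) = \int[mu]_x (weak_partial [:: i; i] u x * psi x).
Proof.
move=> uH spsi; apply/eqP; rewrite -subr_eq0 -normr_le0.
set K := fine (L2norm (trunc psi)) + fine (L2norm (trunc (partials [:: i; i] psi))).
have K0 : 0 <= K by rewrite addr_ge0 ?fine_Lnorm2_ge0.
apply/ler_addgt0Pl => e e0; rewrite addr0.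
have K1 : 0 < K + 1 by rewrite ltr_wpDl.
rewrite (le_trans (@L2B_ibp_error u psi (e / (K + 1)) i _ uH spsi)) ?divr_gt0//.
by rewrite -/K -mulrA ler_piMr ?(ltW e0)// mulrC ler_pdivrMr// mul1r lerDl.
Qed.

Lemma L2B_sum n (F : 'I_n -> R4 R -> R) : (forall i, L2B (F i)) ->
  L2B (fun x => \sum_(i < n) F i x).
Proof.
move=> FL; split; last by move=> x xB; rewrite big1// => i _; exact: (FL i).2.
have {}FL i := (FL i).1; elim: n F FL => [|n IHn] F FL.
  apply/Lfun2P; split.
    by under eq_fun do rewrite big_ord0; exact: measurable_cst.
  by under eq_integral do rewrite big_ord0 expr0n; rewrite integral0.
rewrite (_ : (fun _ => _) = fun x =>
    \sum_(i < n) F (widen_ord (leqnSn n) i) x + F ord_max x).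
  by apply: Lfun2D => //; exact: IHn.
by apply/funext => x; rewrite big_ord_recr.
Qed.

Lemma Rintegral_sum n (F : 'I_n -> R4 R -> R) :
  (forall i, mu.-integrable setT (EFin \o F i)) ->
  \int[mu]_x (\sum_(i < n) F i x) = \sum_(i < n) \int[mu]_x F i x.
Proof.
move=> iF; rewrite /Rintegral.
under eq_integral do rewrite -sumEFin.
rewrite integral_sum// -[RHS]/(fine (_%:E)) -sumEFin; congr fine.
by apply: eq_bigr => i _; rewrite fineK//; apply: integrable_fin_num => //; exact: iF.
Qed.

Lemma weak_partial_L2B i u : H2 u -> L2B (weak_partial [:: i; i] u).
Proof.
move=> [uL uH].
have [] // : is_weak_partial [:: i; i] u (weak_partial [:: i; i] u).
by apply: weak_partialP; exact: uH.
Qed.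

Lemma laplacian_L2B u : H2 u -> L2B (laplacian u).
Proof.
move=> uH; have w i := weak_partial_L2B i uH.
exact: L2B_sum.
Qed.

Lemma laplacian_duality u psi : H20 u -> smooth psi ->
  `|\int[mu]_x (u x * \sum_(i < 4) partials [:: i; i] psi x)| <=
    fine (L2norm (laplacian u)) * fine (L2norm (trunc psi)).
Proof.
move=> uH spsi; have [uH2 _] := uH; have lL := laplacian_L2B uH2.
have tL := trunc_L2B (smooth_continuous spsi).
have tsm i := trunc_L2B (smooth_continuous (smooth_partials [:: i; i] spsi)).
have w i := weak_partial_L2B i uH2.
have -> : \int[mu]_x (u x * \sum_(i < 4) partials [:: i; i] psi x) =
    \int[mu]_x (laplacian u x * trunc psi x).
  rewrite -(mul_trunc psi lL) /laplacian.
  under eq_Rintegral do rewrite mulr_sumr.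
  under [RHS]eq_Rintegral do rewrite mulr_suml.
  rewrite Rintegral_sum; last first.
    by move=> i; rewrite (mul_trunc _ uH2.1); exact: L2B_mul_integrable uH2.1 (tsm i).
  rewrite Rintegral_sum; last first.
    by move=> i; rewrite (mul_trunc _ (w i)); exact: L2B_mul_integrable.
  by apply: eq_bigr => i _; exact: H20_ibp.
exact: (cauchy_schwarz lL.1 tL.1).
Qed.

End weak_partial_theory.

(** * Gaussian and radial integrals in dimension four *)

Section laplace.
Context {R : realType}.
Notation lam := (@lebesgue_measure R).

(** The antiderivative of [t^n exp(-s t)] that tends to [0] at infinity, obtained
    by repeated integration by parts. *)
Fixpoint laplace_prim (s : R) (n : nat) (t : R) : R :=
  if n is n'.+1 then
    (n%:R * laplace_prim s n' t - t ^+ n * expR (- s * t)) / s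
  else - expR (- s * t) / s.

Lemma is_derive_laplace_prim (s : R) n (t : R) : s != 0 ->
  is_derive t 1 (laplace_prim s n) (t ^+ n * expR (- s * t)).
Proof.
move=> s0.
have dN : is_derive t 1 (fun z : R => - s * z) (- s).
  by apply: is_derive_eq; rewrite /GRing.scale/= mulr1.
have dE : is_derive t 1 (fun z : R => expR (- s * z)) (expR (- s * t) * - s).
  exact: (is_derive1_comp (is_derive_expR _) dN).
elim: n => [|n IHn].
  rewrite /=; apply: is_derive_eq; rewrite /GRing.scale/=; field.
  exact: s0.
have dX : is_derive t 1 (fun z : R => z ^+ n.+1) (n.+1%:R * t ^+ n).
  apply: DeriveDef; first exact: exprn_derivable.
  by rewrite exp_derive /GRing.scale/= mulr1 mulr_natl.
have dXE := is_deriveM dX dE; have dcI := is_deriveZ n.+1%:R IHn.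
have H := is_deriveZ s^-1 (is_deriveB dcI dXE).
have E : laplace_prim s n.+1 = (s^-1 \*: (n.+1%:R \*: laplace_prim s n -
    (fun z => z ^+ n.+1) * (fun z => expR (- s * z)))).
  by apply/funext => z; rewrite /= mulrC.
by rewrite E; apply: (is_derive_eq H); rewrite /GRing.scale/= !exprS; field.
Qed.

Lemma cvg_exprn_expR (s : R) n : 0 < s -> t ^+ n * expR (- s * t) @[t --> +oo] --> (0 : R).
Proof.
move=> s0.
pose C : R := n.+1`!%:R / s ^+ n.+1.
have C0 : 0 < C by rewrite divr_gt0 ?exprn_gt0// ltr0n fact_gt0.
have b (t : R) : 0 < t -> `|t ^+ n * expR (- s * t)| <= C / t.
  move=> t0; rewrite ger0_norm ?mulr_ge0 ?exprn_ge0 ?expR_ge0 ?(ltW t0)//.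
  have := @exprn_le_expR R n.+1 (s * t) (ltW (mulr_gt0 s0 t0)).
  rewrite mulNr expRN ler_pdivlMr// ler_pdivlMr ?exprn_gt0// => h.
  rewrite (_ : _ * s ^+ n.+1 = (s * t) ^+ n.+1 / expR (s * t)).
    by rewrite ler_pdivrMr ?expR_gt0.
  by rewrite exprMn ![_ ^+ n.+1]exprS; ring.
apply/cvgr0Pnorm_lt => e e0.
have h1 : \forall t \near +oo, C / e < t :> R by apply: nbhs_pinfty_gt; rewrite num_real.
have h2 : \forall t \near +oo, 0 < t :> R by apply: nbhs_pinfty_gt; rewrite num_real.
near=> t; have t0 : 0 < t by near: t.
rewrite (le_lt_trans (b t t0))// ltr_pdivrMr// mulrC -ltr_pdivrMr//.
by near: t.
Unshelve. all: by end_near. Qed.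

Lemma laplace_prim_cvg (s : R) n : 0 < s -> laplace_prim s n t @[t --> +oo] --> (0 : R).
Proof.
move=> s0; elim: n => [|n IHn] /=.
  rewrite -(mul0r s^-1) -oppr0; apply: cvgM; last exact: cvg_cst.
  apply: cvgN; have := @cvg_exprn_expR s 0 s0.
  by under eq_fun do rewrite expr0 mul1r.
rewrite -(mul0r s^-1) -(subr0 0) -[X in X - _](mulr0 n.+1%:R).
apply: cvgM; last exact: cvg_cst.
apply: cvgB; last exact: (@cvg_exprn_expR s n.+1 s0).
by apply: cvgM => //; exact: cvg_cst.
Qed.

Lemma laplace_prim0 (s : R) n : s != 0 -> laplace_prim s n 0 = - (n`!%:R / s ^+ n.+1).
Proof.
move=> s0; elim: n => [|n IHn] /=.
  by rewrite mulr0 expR0 expr1 mulNr.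
rewrite IHn expr0n/= mul0r subr0 factS natrM !exprS; field.
by rewrite s0 /= expf_neq0.
Qed.

Lemma laplace_monomial (s : R) n : 0 < s ->
  (\int[lam]_(t in `]0%R, +oo[) (t ^+ n * expR (- s * t))%:E = (n`!%:R / s ^+ n.+1)%:E)%E.
Proof.
move=> s0; have sn0 : s != 0 by rewrite gt_eqF.
have cf : continuous (fun t : R => t ^+ n * expR (- s * t)).
  move=> t; have [] := @is_derive_laplace_prim s n t sn0 => _ _.
  apply: cvgM; first exact: exprn_continuous.
  apply: continuous_comp; last exact: continuous_expR.
  by apply: cvgM; [exact: cvg_cst|exact: cvg_id].
rewrite integral_itv_obnd_cbnd; last first.
  by apply/measurable_EFinP/measurable_funTS; exact: continuous_measurable_fun.
rewrite (@ge0_continuous_FTC2y _ _ (laplace_prim s n) 0 0).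
- by rewrite laplace_prim0// EFinN oppeK add0e.
- by move=> t t0; rewrite mulr_ge0 ?exprn_ge0 ?expR_ge0.
- exact: continuous_subspaceT.
- exact: laplace_prim_cvg.
- by move=> t _; have [] := @is_derive_laplace_prim s n t sn0.
- apply: cvg_at_right_filter; apply/differentiable_continuous/derivable1_diffP.
  by have [] := @is_derive_laplace_prim s n 0 sn0.
- by move=> t _; rewrite derive1E; have [] := @is_derive_laplace_prim s n t sn0.
Qed.

End laplace.

Section gaussian.
Context {R : realType}.
Notation lam := (@lebesgue_measure R).
Notation mu := (@leb4 R).

(** The integral of the normal density with variance [1/(2 t)]. *)
Lemma gaussian1 (t m : R) : 0 < t ->
  (\int[lam]_x (expR (- t * (x - m) ^+ 2))%:E = (Num.sqrt (pi / t))%:E)%E.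
Proof.
move=> t0; pose s : R := Num.sqrt ((2 * t)^-1).
have t2 : 0 < (2 * t)^-1 by rewrite invr_gt0 mulr_gt0.
have s2 : s ^+ 2 = (2 * t)^-1 by rewrite sqr_sqrtr ?(ltW t2).
have s0 : s != 0 by rewrite gt_eqF// sqrtr_gt0.
have := integral_normal_pdf m s.
under eq_integral do rewrite normal_pdfE// EFinM.
rewrite ge0_integralZl//; last 3 first.
- by apply/measurable_EFinP; exact: measurable_normal_fun.
- by move=> x _; rewrite lee_fin normal_fun_ge0.
- by rewrite lee_fin normal_peak_ge0.
have -> : normal_peak s = (Num.sqrt (pi / t))^-1.
  by rewrite /normal_peak s2; congr (Num.sqrt _)^-1; field; rewrite gt_eqF.
have -> : (fun x => (normal_fun m s x)%:E) = (fun x => (expR (- t * (x - m) ^+ 2))%:E).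
  apply/funext => x; congr (expR _)%:E; rewrite s2; field.
  by rewrite gt_eqF.
set I := (\int[lam]_x _)%E; set p := Num.sqrt _ => pI.
have p0 : 0 < p by rewrite sqrtr_gt0 divr_gt0// pi_gt0.
by rewrite -[LHS]mul1e -[1%E]/(1%:E) -(@mulfV _ p) ?gt_eqF// EFinM -muleA pI mule1.
Qed.

End gaussian.

Section tonelli_product.
Context d1 d2 (T1 : measurableType d1) (T2 : measurableType d2) (R : realType).
Variables (m1 : {sigma_finite_measure set T1 -> \bar R})
          (m2 : {sigma_finite_measure set T2 -> \bar R}).

Lemma integral_tensor (f : T1 -> R) (g : T2 -> R) (a b : R) :
  measurable_fun setT f -> measurable_fun setT g ->
  (forall x, 0 <= f x) -> (forall y, 0 <= g y) ->
  (\int[m1]_x (f x)%:E = a%:E)%E -> (\int[m2]_y (g y)%:E = b%:E)%E ->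
  (\int[(m1 \x m2)%E]_z (f z.1 * g z.2)%:E = (a * b)%:E)%E.
Proof.
move=> mf mg f0 g0 fa gb; rewrite fubini_tonelli1//; last 2 first.
- apply/measurable_EFinP/measurable_funM.
    by apply: (measurableT_comp mf); exact: measurable_fst.
  by apply: (measurableT_comp mg); exact: measurable_snd.
- by move=> z; rewrite lee_fin mulr_ge0.
have b0 : 0 <= b by rewrite -lee_fin -gb; apply: integral_ge0 => y _; rewrite lee_fin.
transitivity (\int[m1]_x (b%:E * (f x)%:E))%E.
  apply: eq_integral => x _; rewrite /fubini_F/=.
  under eq_integral do rewrite EFinM.
  rewrite ge0_integralZl//.
  - by rewrite gb muleC.
  - exact/measurable_EFinP.
  - by move=> y _; rewrite lee_fin.
  - by rewrite lee_fin.
rewrite ge0_integralZl//; [by rewrite fa -EFinM mulrC|exact/measurable_EFinP|].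
by move=> x _; rewrite lee_fin.
Qed.

Lemma tonelli_setD (D : set T2) (k : T1 * T2 -> R) : measurable D ->
  measurable_fun setT k -> (forall x y, D y -> 0 <= k (x, y)) ->
  (\int[m1]_x \int[m2]_(y in D) (k (x, y))%:E =
   \int[m2]_(y in D) \int[m1]_x (k (x, y))%:E)%E.
Proof.
move=> mD mk k0; pose f (z : T1 * T2) := (k z * \1_D z.2)%:E.
have mf : measurable_fun setT f.
  apply/measurable_EFinP/measurable_funM => //.
  apply: (measurableT_comp (measurable_indic mD)); exact: measurable_snd.
have f0 z : (0 <= f z)%E.
  case: z => x y; rewrite lee_fin /= indicE.
  have [Dy|Dy] := pselect (D y); first by rewrite mem_set// mulr1 k0.
  by rewrite memNset// mulr0.
have fE x y : f (x, y) = ((fun y => (k (x, y))%:E) \_ D) y.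
  rewrite /f/= indicE /patch; case: ifPn => _; rewrite ?mulr1 ?mulr0//.
transitivity (\int[m1]_x \int[m2]_y f (x, y))%E.
  apply: eq_integral => x _; rewrite integral_mkcond.
  by apply: eq_integral => y _; rewrite fE.
rewrite fubini_tonelli// [RHS]integral_mkcond; apply: eq_integral => y _.
rewrite patchE; case: ifPn => Dy.
  by apply: eq_integral => x _; rewrite fE patchE Dy.
by apply: integral0_eq => x _; rewrite fE patchE (negbTE Dy).
Qed.

End tonelli_product.

Section radial_integrals.
Context {R : realType}.
Notation lam := (@lebesgue_measure R).
Notation mu := (@leb4 R).

(** The measure [leb4], bracketed so that its sigma-finite structure is found. *)
Definition sfleb4 : {sigma_finite_measure set (mR4 R) -> \bar R} :=
  sfprod (sfprod (sfprod lam lam) lam) lam.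

Lemma gaussian4 (t : R) (c : R4 R) : 0 < t ->
  (\int[mu]_x (expR (- t * sqdist c x))%:E = (pi ^+ 2 / t ^+ 2)%:E)%E.
Proof.
move=> t0; pose g (m x : R) := expR (- t * (x - m) ^+ 2).
have mg m : measurable_fun [set: measurableTypeR R] (g m).
  apply: measurable_funS (measurableT) _ _ => //; apply: continuous_measurable_fun => x.
  apply: continuous_comp; last exact: continuous_expR.
  apply: cvgM; first exact: cvg_cst.
  by apply: (@continuous_comp _ _ _ (fun x => x - m) (fun x => x ^+ 2));
    [apply: cvgB; [exact: cvg_id|exact: cvg_cst]|exact: exprn_continuous].
have g0 m x : 0 <= g m x by exact: expR_ge0.
have I1 m : (\int[lam]_x (g m x)%:E = (Num.sqrt (pi / t))%:E)%E by exact: gaussian1.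
have mM d1 d2 (U1 : measurableType d1) (U2 : measurableType d2) (a : U1 -> R) (b : U2 -> R) :
    measurable_fun setT a -> measurable_fun setT b ->
    measurable_fun setT (fun z : U1 * U2 => a z.1 * b z.2).
  move=> ma mb; apply: measurable_funM.
    by apply: (measurableT_comp ma); exact: measurable_fst.
  by apply: (measurableT_comp mb); exact: measurable_snd.
have m2 := mM _ _ _ _ _ _ (mg (coord4 0 c)) (mg (coord4 1 c)).
have m3 := mM _ _ _ _ _ _ m2 (mg (coord4 2 c)).
have I2 := integral_tensor (mg (coord4 0 c)) (mg (coord4 1 c)) (g0 _) (g0 _) (I1 _) (I1 _).
have I3 := @integral_tensor _ _ _ _ _ (sfprod lam lam) lam _ _ _ _ m2 (mg (coord4 2 c))
  (fun z => mulr_ge0 (g0 _ _) (g0 _ _)) (g0 _) I2 (I1 _).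
have I4 := @integral_tensor _ _ _ _ _ (sfprod (sfprod lam lam) lam) lam _ _ _ _ m3
  (mg (coord4 3 c)) (fun z => mulr_ge0 (mulr_ge0 (g0 _ _) (g0 _ _)) (g0 _ _)) (g0 _) I3 (I1 _).
transitivity (\int[mu]_z (g (coord4 0 c) z.1.1.1 * g (coord4 1 c) z.1.1.2 *
   g (coord4 2 c) z.1.2 * g (coord4 3 c) z.2)%:E)%E.
  apply: eq_integral => -[[[x0 x1] x2] x3] _; congr EFin.
  rewrite /g -!expRD /sqdist !big_ord_recl big_ord0; congr expR.
  rewrite /coord4/=; ring.
rewrite [LHS]I4; congr EFin; set q := Num.sqrt _.
have q2 : q ^+ 2 = pi / t by rewrite sqr_sqrtr// divr_ge0 ?pi_ge0// ltW.
have -> : q * q * q * q = (q ^+ 2) ^+ 2 by ring.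
by rewrite q2 expr_div_n.
Qed.

Lemma measurable_sqdist (c : R4 R) : measurable_fun [set: mR4 R] (sqdist c).
Proof. by apply: continuous_measurable4; apply: elementary_continuous; exact: elementary_sqdist. Qed.

(** Since [(n+2)!/(rho + a)^(n+3)] is the integral of
    [t^(n+2) exp(-t (rho + a))] over positive [t], exchanging the integrals
    leaves a Gaussian integral, equal to [pi^2/t^2], and then the Laplace
    transform of [t^n] at [a]. *)
Lemma integral_sqdist_power n (c : R4 R) (a : R) : 0 < a ->
  (\int[mu]_x ((n.+2)`!%:R / (sqdist c x + a) ^+ n.+3)%:E =
   (pi ^+ 2 * (n`!%:R / a ^+ n.+1))%:E)%E.
Proof.
move=> a0.
pose k (z : mR4 R * measurableTypeR R) : R :=
  z.2 ^+ n.+2 * expR (- (sqdist c z.1 + a) * z.2).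
have mk : measurable_fun setT k.
  have m2 : measurable_fun setT (fun z : mR4 R * measurableTypeR R => z.2) by exact: measurable_snd.
  apply: measurable_funM; first exact: measurable_funX.
  apply: measurableT_comp; first exact: measurable_expR.
  apply: measurable_funM => //; apply: measurableT_comp => //.
  apply: measurable_funD => //.
  apply: (measurableT_comp (measurable_sqdist c)); exact: measurable_fst.
transitivity (\int[sfleb4]_x \int[lam]_(t in `]0%R, +oo[) (k (x, t))%:E)%E.
  apply: eq_integral => x _; rewrite /k/= laplace_monomial//.
  by rewrite ltr_wpDl// sqdist_ge0.
rewrite tonelli_setD//; last first.
  move=> x t /=; rewrite in_itv/= andbT => t0.
  by rewrite mulr_ge0 ?exprn_ge0 ?expR_ge0// ltW.
transitivity (\int[lam]_(t in `]0%R, +oo[) ((pi ^+ 2)%:E * (t ^+ n * expR (- a * t))%:E))%E.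
  apply: eq_integral => t; rewrite inE/= in_itv/= andbT => t0.
  transitivity (\int[sfleb4]_x ((t ^+ n.+2 * expR (- a * t))%:E * (expR (- t * sqdist c x))%:E))%E.
    apply: eq_integral => x _; rewrite -EFinM; congr EFin.
    by rewrite /k/= -[RHS]mulrA -expRD; congr (_ * expR _); ring.
  rewrite ge0_integralZl//.
  - rewrite [X in (_ * X)%E](gaussian4 c t0) -!EFinM; congr EFin.
    by rewrite !exprS; field; rewrite gt_eqF.
  - apply/measurable_EFinP; apply: measurableT_comp; first exact: measurable_expR.
    by apply: measurable_funM => //; exact: measurable_sqdist.
  - by rewrite lee_fin mulr_ge0 ?exprn_ge0 ?expR_ge0// ltW.
rewrite ge0_integralZl//.
- by rewrite laplace_monomial.
- apply/measurable_EFinP; apply: measurable_funTS; apply: continuous_measurable_fun => t.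
  apply: cvgM; first exact: exprn_continuous.
  apply: continuous_comp; last exact: continuous_expR.
  by apply: cvgM; [exact: cvg_cst|exact: cvg_id].
- move=> t /=; rewrite in_itv/= andbT => t0.
  by rewrite lee_fin mulr_ge0 ?exprn_ge0 ?expR_ge0// ltW.
- by rewrite lee_fin exprn_ge0// pi_ge0.
Qed.

Lemma measurable_invr : measurable_fun [set: measurableTypeR R] (fun x : R => x^-1).
Proof.
rewrite -(setUv [set (0 : R)]); apply/measurable_funU => //; first exact: measurableC.
split; first exact: measurable_fun_set1.
apply: open_continuous_measurable_fun; first exact/closed_openC/closed_eq.
by move=> x; rewrite inE/= => /eqP x0; exact: inv_continuous.
Qed.

Lemma measurable_sqdistV c (a : R) k :
  measurable_fun [set: mR4 R] (fun x => (sqdist c x + a) ^- k).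
Proof.
apply: (measurableT_comp measurable_invr); apply: measurable_funX.
by apply: measurable_funD => //; exact: measurable_sqdist.
Qed.

Lemma integral_sqdistV3 c (a : R) : 0 < a ->
  (\int[mu]_x ((sqdist c x + a) ^- 3)%:E = (pi ^+ 2 / (2 * a))%:E)%E.
Proof.
move=> a0; have -> : (pi ^+ 2 / (2 * a))%:E = (2^-1%:E * (pi ^+ 2 * (0`!%:R / a ^+ 1))%:E)%E.
  by rewrite -EFinM; congr EFin; rewrite fact0; field; rewrite gt_eqF.
rewrite -(integral_sqdist_power 0 c a0) -ge0_integralZl//.
- apply: eq_integral => x _; rewrite -EFinM mulrA mulVf ?mul1r//.
- apply/measurable_EFinP; apply: measurable_funM => //; exact: measurable_sqdistV.
- by move=> x _; rewrite lee_fin divr_ge0// exprn_ge0// addr_ge0 ?sqdist_ge0// ltW.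
Qed.

Lemma integral_sqdistV4 c (a : R) : 0 < a ->
  (\int[mu]_x ((sqdist c x + a) ^- 4)%:E = (pi ^+ 2 / (6 * a ^+ 2))%:E)%E.
Proof.
move=> a0; have -> : (pi ^+ 2 / (6 * a ^+ 2))%:E = (6^-1%:E * (pi ^+ 2 * (1`!%:R / a ^+ 2))%:E)%E.
  by rewrite -EFinM; congr EFin; rewrite factS fact0 muln1; field; rewrite gt_eqF.
rewrite -(integral_sqdist_power 1 c a0) -ge0_integralZl//.
- apply: eq_integral => x _; rewrite -EFinM mulrA mulVf ?mul1r//.
- apply/measurable_EFinP; apply: measurable_funM => //; exact: measurable_sqdistV.
- by move=> x _; rewrite lee_fin divr_ge0// exprn_ge0// addr_ge0 ?sqdist_ge0// ltW.
Qed.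

Lemma integral_FTC_pos (F f : R -> R) (a b : R) : 0 < a -> a < b ->
  (forall t : R, 0 < t -> is_derive t 1 F (f t)) ->
  (forall t : R, 0 < t -> {for t, continuous f}) ->
  (\int[lam]_(t in `[a, b]) (f t)%:E = (F b - F a)%:E)%E.
Proof.
move=> a0 ab dF cf; rewrite (@continuous_FTC2 _ _ F)//.
- apply: continuous_in_subspaceT => t; rewrite inE/= in_itv/= => /andP[at_ _].
  by apply: cf; exact: lt_le_trans at_.
- have cF t : 0 < t -> {for t, continuous F}.
    move=> t0; apply/differentiable_continuous/derivable1_diffP.
    by have [] := dF t t0.
  split; last 2 first.
  + by apply: cvg_at_right_filter; exact: cF.
  + by apply: cvg_at_left_filter; apply: cF; exact: lt_trans ab.
  move=> t; rewrite in_itv/= => /andP[at_ _].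
  by have [] := dF t (lt_trans a0 at_).
- move=> t; rewrite in_itv/= => /andP[at_ _]; rewrite derive1E.
  by have [] := dF t (lt_trans a0 at_).
Qed.

End radial_integrals.

(** * Radial integrals over the unit ball *)

Section ball_integrals.
Context {R : realType}.
Notation lam := (@lebesgue_measure R).
Notation mu := (@leb4 R).

Definition ball_volume : R := fine (mu unit_ball).

Lemma leb4_ballE : mu unit_ball = ball_volume%:E.
Proof. by rewrite /ball_volume fineK// ge0_fin_numE// leb4_unit_ball. Qed.

Lemma ball_volume_ge0 : 0 <= ball_volume.
Proof. by rewrite fine_ge0. Qed.

(** Bounds the integral over the ball of a function dominated by a constant
    plus a superposition of the [(rho + t)^-3] for [t] between [a] and [1]:
    the latter have the integral [pi^2/(2 t)] over the whole space, at every
    centre [c]. *)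
Lemma ball_integral_le (c : R4 R) (a C L : R) (w : R -> R) (g F : R4 R -> R) :
  0 < a -> continuous w -> (forall t : R, a <= t -> 0 <= w t) -> 0 <= C ->
  measurable_fun [set: mR4 R] g -> (forall x, 0 <= g x) ->
  measurable_fun [set: mR4 R] F ->
  (forall x, \int[lam]_(t in `[a, 1%R]) (w t * (sqdist c x + t) ^- 3)%:E = (F x)%:E)%E ->
  (\int[lam]_(t in `[a, 1%R]) (w t * (pi ^+ 2 / (2 * t)))%:E = L%:E)%E ->
  (forall x, unit_ball x -> g x <= C + F x) ->
  (\int[mu]_(x in unit_ball) (g x)%:E <= (C * ball_volume + L)%:E)%E.
Proof.
move=> a0 cw w0 C0 mg g0 mF FE wL gF.
have k0 (x : R4 R) (t : R) : a <= t -> 0 <= w t * (sqdist c x + t) ^- 3.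
  move=> ta; rewrite mulr_ge0 ?w0// invr_ge0 exprn_ge0// addr_ge0 ?sqdist_ge0//.
  exact: le_trans (ltW a0) ta.
have F0 x : 0 <= F x.
  rewrite -lee_fin -FE; apply: integral_ge0 => t /=; rewrite in_itv/= => /andP[at_ _].
  by rewrite lee_fin k0.
have mB := @measurable_unit_ball R.
have mC : measurable_fun (unit_ball : set (mR4 R)) (fun=> C%:E) by exact: measurable_cst.
have mFB : measurable_fun (unit_ball : set (mR4 R)) (EFin \o F).
  by apply/measurable_EFinP; exact: measurable_funTS.
apply: (@le_trans _ _ (\int[mu]_(x in unit_ball) (C%:E + (F x)%:E))%E).
  apply: ge0_le_integral => //.
  - by move=> x _; rewrite lee_fin.
  - by apply/measurable_EFinP; exact: measurable_funTS.
  - exact: emeasurable_funD.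
rewrite ge0_integralD//; last by move=> x _; rewrite lee_fin.
rewrite integral_cst// [X in (_ * X)%E]leb4_ballE -EFinM EFinD leeD2l//.
apply: (@le_trans _ _ (\int[mu]_x (F x)%:E)%E).
  apply: ge0_subset_integral => //; first exact/measurable_EFinP.
  by move=> x _; rewrite lee_fin.
pose k (z : mR4 R * measurableTypeR R) : R := w z.2 * (sqdist c z.1 + z.2) ^- 3.
have mk : measurable_fun setT k.
  have m2 : measurable_fun setT (fun z : mR4 R * measurableTypeR R => z.2) by exact: measurable_snd.
  apply: measurable_funM.
    by apply: (measurableT_comp _ m2); exact: continuous_measurable_fun.
  apply: (measurableT_comp measurable_invr); apply: measurable_funX.
  apply: measurable_funD => //.
  apply: (measurableT_comp (measurable_sqdist c)); exact: measurable_fst.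
under eq_integral do rewrite -FE.
have := @tonelli_setD _ _ _ _ _ sfleb4 lam `[a, 1] k _ mk.
rewrite /k/= => ->//; last first.
  by move=> x t; rewrite in_itv/= => /andP[at_ _]; exact: k0.
rewrite -wL le_eqVlt; apply/orP; left; apply/eqP.
apply: eq_integral => t; rewrite inE/= in_itv/= => /andP[at_ _].
have t0 : 0 < t by exact: lt_le_trans at_.
under eq_integral do rewrite EFinM.
rewrite ge0_integralZl//.
- by rewrite [X in (_ * X)%E](integral_sqdistV3 c t0).
- by apply/measurable_EFinP; exact: measurable_sqdistV.
- by move=> x _; rewrite lee_fin invr_ge0 exprn_ge0// addr_ge0 ?sqdist_ge0// ltW.
- by rewrite lee_fin w0.
Qed.

Lemma is_derive_invX (s : R) k (t : R) : 0 <= s -> 0 < t ->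
  is_derive t 1 (fun z : R => (s + z) ^- k) (- k%:R * (s + t) ^- k.+1).
Proof.
move=> s0 t0; have st0 : s + t != 0 by rewrite gt_eqF// ltr_wpDl.
have d1 : is_derive t 1 (fun z : R => s + z) 1.
  by apply: is_derive_eq; rewrite add0r mulr1.
by apply: (is_derive_eq (is_derive_comp1 d1 (is_derive_Vn k st0))); rewrite mulr1.
Qed.

Lemma invX_continuous (s : R) k (t : R) : 0 <= s -> 0 < t ->
  {for t, continuous (fun z : R => (s + z) ^- k)}.
Proof.
move=> s0 t0; apply/differentiable_continuous/derivable1_diffP.
by have [] := is_derive_invX k s0 t0.
Qed.

(** The superposition is
    [(rho + a)^-2 - (rho + 1)^-2], the integral of [2 (rho + t)^-3] in [t]. *)
Lemma ball_integral_sqdistV2 (c : R4 R) (a : R) : 0 < a -> a < 1 ->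
  (\int[mu]_(x in unit_ball) ((sqdist c x + a) ^- 2)%:E <=
   (ball_volume + pi ^+ 2 * ln a^-1)%:E)%E.
Proof.
move=> a0 a1; rewrite -[X in X + _]mul1r.
have st0 x t : 0 < t -> 0 < sqdist c x + t by move=> t0; rewrite ltr_wpDl// sqdist_ge0.
apply: (@ball_integral_le c a 1 _ (cst 2) _ (fun x => (sqdist c x + a) ^- 2 - (sqdist c x + 1) ^- 2)) => //.
- by move=> x; exact: cvg_cst.
- exact: measurable_sqdistV.
- by move=> x; rewrite invr_ge0 exprn_ge0// ltW// st0.
- by apply: measurable_funB; exact: measurable_sqdistV.
- move=> x; have x0 := sqdist_ge0 c x.
  transitivity (- (sqdist c x + 1) ^- 2 - - (sqdist c x + a) ^- 2)%:E.
    2: by rewrite opprK addrC.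
  apply: (@integral_FTC_pos _ (fun t => - (sqdist c x + t) ^- 2)
    (fun t => 2 * (sqdist c x + t) ^- 3)) => //.
  + move=> t t0; have := is_derive_invX 2 x0 t0 => d.
    by apply: is_derive_eq; rewrite /=; ring.
  + move=> t t0; apply: cvgM; first exact: cvg_cst.
    exact: invX_continuous.
- transitivity (pi ^+ 2 * ln 1 - pi ^+ 2 * ln a)%:E.
    2: by rewrite ln1 mulr0 sub0r lnV// mulrN.
  apply: (@integral_FTC_pos _ (fun t => pi ^+ 2 * ln t)) => //.
  + move=> t t0; have d := is_derive1_ln t0.
    have d2 := is_deriveZ (pi ^+ 2) d; apply: (is_derive_eq d2).
    by rewrite /GRing.scale/=; field; rewrite gt_eqF.
  + move=> t t0; do 2!(apply: cvgM; first exact: cvg_cst).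
    apply: cvgV; first by rewrite gt_eqF// mulr_gt0.
    by apply: cvgM; [exact: cvg_cst|exact: cvg_id].
- move=> x _; rewrite addrCA lerDl subr_ge0 invf_le1 ?exprn_gt0 ?st0//.
  by rewrite exprn_ege1// lerDr sqdist_ge0.
Qed.

(** Here the weight is [2 t]; an antiderivative of [2 t (rho + t)^-3] in [t] is
    [- (rho + 2 t) (rho + t)^-2]. *)
Lemma ball_integral_sqdistV1 (c : R4 R) (a : R) : 0 < a -> a < 1 ->
  (\int[mu]_(x in unit_ball) ((sqdist c x + a)^-1)%:E <=
   (2 * ball_volume + pi ^+ 2)%:E)%E.
Proof.
move=> a0 a1.
have st0 x t : 0 < t -> 0 < sqdist c x + t by move=> t0; rewrite ltr_wpDl// sqdist_ge0.
pose G x t := (sqdist c x + 2 * t) * (sqdist c x + t) ^- 2.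
apply: (@le_trans _ _ (2 * ball_volume + pi ^+ 2 * (1 - a))%:E); last first.
  by rewrite lee_fin lerD2l ler_piMr ?sqr_ge0// gerBl ltW.
apply: (@ball_integral_le c a 2 _ (fun t => 2 * t) _ (fun x => G x a - G x 1)) => //.
- by move=> x; apply: cvgM; [exact: cvg_cst|exact: cvg_id].
- by move=> t at_; rewrite mulr_ge0// (le_trans _ at_)// ltW.
- exact: (measurable_sqdistV c a 1).
- by move=> x; rewrite invr_ge0 ltW// st0.
- have mG t : measurable_fun [set: mR4 R] (G^~ t).
    apply: measurable_funM; last exact: measurable_sqdistV.
    by apply: measurable_funD => //; exact: measurable_sqdist.
  exact: measurable_funB.
- move=> x; have x0 := sqdist_ge0 c x.
  transitivity (- G x 1 - - G x a)%:E.
    2: by rewrite opprK addrC.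
  apply: (@integral_FTC_pos _ (fun t => - G x t)
    (fun t => 2 * t * (sqdist c x + t) ^- 3)) => //.
  + move=> t t0; have d := is_derive_invX 2 x0 t0; rewrite /G.
    apply: is_derive_eq; rewrite /GRing.scale/=.
    have := st0 x t t0 => h; field; by rewrite gt_eqF.
  + move=> t t0; apply: cvgM; last exact: invX_continuous.
    by apply: cvgM; [exact: cvg_cst|exact: cvg_id].
- transitivity (pi ^+ 2 * 1 - pi ^+ 2 * a)%:E.
    2: by rewrite mulrBr.
  apply: (@integral_FTC_pos _ (fun t => pi ^+ 2 * t)) => //.
  + move=> t t0; apply: is_derive_eq; rewrite /GRing.scale/=; field.
    by rewrite gt_eqF.
  + move=> t t0; apply: cvgM; first by apply: cvgM; [exact: cvg_cst|exact: cvg_id].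
    apply: cvgM; first exact: cvg_cst.
    apply: cvgV; first by rewrite gt_eqF// mulr_gt0.
    by apply: cvgM; [exact: cvg_cst|exact: cvg_id].
- move=> x _; have x0 := sqdist_ge0 c x; have xa := st0 x a a0; have x1 := st0 x 1 ltr01.
  have h1 : G x 1 <= 2.
    rewrite /G ler_pdivrMr ?exprn_gt0//; nra.
  have h2 : (sqdist c x + a)^-1 <= G x a.
    rewrite /G ler_pdivlMr ?exprn_gt0// (_ : _^-1 * _ = sqdist c x + a); first lra.
    by field; rewrite gt_eqF.
  lra.
Qed.

End ball_integrals.

(** * An approximate identity that is a Laplacian *)

Section bubble.
Context {R : realType}.
Notation mu := (@leb4 R).
Variables (c : R4 R) (a : R).
Hypotheses (a0 : 0 < a).

(** Up to a factor, the fundamental solution [1/rho] of the Laplacian in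
    dimension four, truncated at scale [sqrt a]. The second term improves the
    decay of the Laplacian from [rho^-3] to [rho^-4], which makes it integrable
    against the weight [1 + rho/a] of [powR_le_interp]. *)
Definition bubble_potential (x : R4 R) : R := (sqdist c x + a)^-1 + a * (sqdist c x + a) ^- 2.

Definition bubble (x : R4 R) : R := 6 * a ^+ 2 / pi ^+ 2 * (sqdist c x + a) ^- 4.

Let sa x : 0 < sqdist c x + a. Proof. by rewrite ltr_wpDl// sqdist_ge0. Qed.

Lemma elementary_sqdistV : elementary (fun x : R4 R => (sqdist c x + a)^-1).
Proof.
apply: elementaryV => [x|]; first by rewrite gt_eqF.
by apply: elementaryD; [exact: elementary_sqdist|exact: elementary_cst].
Qed.

Lemma smooth_bubble_potential : smooth bubble_potential.
Proof.
apply: elementary_smooth; have e1 := elementary_sqdistV.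
rewrite (_ : bubble_potential = fun x => (sqdist c x + a)^-1 + a *
   ((sqdist c x + a)^-1 * (sqdist c x + a)^-1)); last first.
  by apply/funext => x; rewrite /bubble_potential -expr2 exprVn.
by apply: elementaryD => //; apply: elementaryM; [exact: elementary_cst|exact: elementaryM].
Qed.

(** With [F = 1/(s + a) + a/(s + a)^2], the combination [4 s F'' + 8 F'] of
    [laplacian_radial] is [-24 a^2/(s + a)^4]. *)
Lemma laplacian_bubble_potential x :
  \sum_(i < 4) partials [:: i; i] bubble_potential x = - (4 * pi ^+ 2) * bubble x.
Proof.
pose F (s : R) := (s + a)^-1 + a * (s + a) ^- 2.
pose F' (s : R) := - (s + a) ^- 2 - 2 * a * (s + a) ^- 3.
pose F'' (s : R) := 2 * (s + a) ^- 3 + 6 * a * (s + a) ^- 4.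
have dV k (s : R) : 0 <= s -> is_derive s 1 (fun z : R => (z + a) ^- k) (- k%:R * (s + a) ^- k.+1).
  move=> s0; have sa0 : s + a != 0 by rewrite gt_eqF// ltr_wpDl.
  have d1 : is_derive s 1 (fun z : R => z + a) 1 by apply: is_derive_eq; rewrite addr0.
  by apply: (is_derive_eq (is_derive_comp1 d1 (is_derive_Vn k sa0))); rewrite mulr1.
have dF (s : R) : 0 <= s -> is_derive s 1 F (F' s).
  move=> s0; have d1 := dV 1%N s s0; have d2 := dV 2%N s s0.
  by apply: (is_derive_eq (is_deriveD d1 (is_deriveZ a d2))); rewrite /F' /GRing.scale/=; ring.
have dF' (s : R) : 0 <= s -> is_derive s 1 F' (F'' s).
  move=> s0; have d1 := dV 2%N s s0; have d2 := dV 3%N s s0.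
  by apply: (is_derive_eq (is_deriveB (is_deriveN d1) (is_deriveZ (2 * a) d2)));
    rewrite /F'' /GRing.scale/=; ring.
rewrite (laplacian_radial c dF dF') /F' /F'' /bubble; have := sa x; set s := sqdist c x => s0.
have p0 : pi != 0 :> R by rewrite gt_eqF// pi_gt0.
by move: (pi : R) p0 => q q0; field; rewrite q0 (gt_eqF s0).
Qed.

Let bubble_cst_ge0 : 0 <= 6 * a ^+ 2 / pi ^+ 2.
Proof.
by apply: divr_ge0; [apply: mulr_ge0; [exact: ler0n|exact: sqr_ge0]|exact: sqr_ge0].
Qed.

Lemma bubble_ge0 x : 0 <= bubble x.
Proof.
apply: mulr_ge0; first exact: bubble_cst_ge0.
by rewrite invr_ge0 exprn_ge0// ltW.
Qed.

Lemma measurable_bubble : measurable_fun [set: mR4 R] bubble.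
Proof. by apply: measurable_funM => //; exact: measurable_sqdistV. Qed.

Lemma integral_bubble : (\int[mu]_x (bubble x)%:E = 1)%E.
Proof.
have p0 : pi != 0 :> R by rewrite gt_eqF// pi_gt0.
under eq_integral do rewrite EFinM.
rewrite ge0_integralZl//.
- rewrite integral_sqdistV4// -EFinM; congr EFin; move: (pi : R) p0 => q q0; field.
  by rewrite q0 (gt_eqF a0).
- by apply/measurable_EFinP; exact: measurable_sqdistV.
- by move=> x _; rewrite lee_fin invr_ge0 exprn_ge0// ltW// sa.
Qed.

Lemma integrable_bubble : mu.-integrable setT (EFin \o bubble).
Proof.
apply/integrableP; split; first by apply/measurable_EFinP; exact: measurable_bubble.
under eq_integral do rewrite /= ger0_norm ?bubble_ge0//.
by rewrite integral_bubble ltry.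
Qed.

Lemma continuous_bubble : continuous bubble.
Proof.
apply: elementary_continuous; have e1 := elementary_sqdistV.
rewrite (_ : bubble = fun x => 6 * a ^+ 2 / pi ^+ 2 * ((sqdist c x + a)^-1 *
   (sqdist c x + a)^-1 * ((sqdist c x + a)^-1 * (sqdist c x + a)^-1))); last first.
  by apply/funext => x; rewrite /bubble -!expr2 -exprM exprVn.
by apply: elementaryM; [exact: elementary_cst|apply: elementaryM; exact: elementaryM].
Qed.

(** As [a/(rho + a) <= 1], the square of the potential is at most
    [(rho + a)^-2 + 3 a (rho + a)^-3]. Only the first term carries a logarithm. *)
Lemma bubble_potential_L2 : a < 1 ->
  fine (L2norm (trunc bubble_potential)) ^+ 2 <=
    ball_volume + pi ^+ 2 * ln a^-1 + 3 / 2 * pi ^+ 2.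
Proof.
move=> a1; have tL := trunc_L2B (smooth_continuous smooth_bubble_potential).
rewrite -lee_fin EFin_expe fineK ?Lfun2_fin_num ?tL.1// sqr_Lnorm2.
have mB := @measurable_unit_ball R.
apply: (@le_trans _ _ (\int[mu]_(x in unit_ball) ((sqdist c x + a) ^- 2)%:E +
  \int[mu]_x ((3 * a) * (sqdist c x + a) ^- 3)%:E)%E); last first.
  rewrite EFinD; apply: leeD; first exact: ball_integral_sqdistV2.
  under eq_integral do rewrite EFinM.
  rewrite ge0_integralZl//.
  - rewrite integral_sqdistV3// -EFinM lee_fin le_eqVlt; apply/orP; left; apply/eqP.
    by field; rewrite gt_eqF.
  - by apply/measurable_EFinP; exact: measurable_sqdistV.
  - by move=> x _; rewrite lee_fin invr_ge0 exprn_ge0// ltW// sa.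
  - by rewrite lee_fin mulr_ge0// ltW.
have P2 x : 0 <= (sqdist c x + a) ^- 2 by rewrite invr_ge0 exprn_ge0// ltW// sa.
have P3 x : 0 <= 3 * a * (sqdist c x + a) ^- 3.
  by rewrite !mulr_ge0 ?(ltW a0)// invr_ge0 exprn_ge0// ltW// sa.
have m3 : measurable_fun [set: mR4 R] (fun x => 3 * a * (sqdist c x + a) ^- 3).
  by apply: measurable_funM => //; exact: measurable_sqdistV.
have mp : measurable_fun [set: mR4 R] ((fun x => ((sqdist c x + a) ^- 2)%:E) \_ unit_ball).
  apply/(measurable_restrict _ mB measurableT); rewrite setTI.
  by apply/measurable_EFinP; apply: measurable_funTS; exact: measurable_sqdistV.
rewrite [X in (X + _)%E]integral_mkcond -ge0_integralD//; last 3 first.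
- by move=> x _; rewrite /patch; case: ifPn => // _; rewrite lee_fin.
- by move=> x _; rewrite lee_fin.
- exact/measurable_EFinP.
apply: ge0_le_integral => //.
- by move=> x _; rewrite lee_fin sqr_ge0.
- by apply/measurable_EFinP; apply: measurable_funX; exact: (Lfun2_measurable tL.1).
- by apply: emeasurable_funD => //; exact/measurable_EFinP.
- move=> x _.
  rewrite /trunc indicE /patch; case: ifPn => xB; rewrite ?mulr1 ?mulr0; last first.
    by rewrite expr0n/= add0e lee_fin.
  rewrite -EFinD lee_fin /bubble_potential; have := sa x; set y := _ + a => y0.
  have ya : a * y^-1 <= 1 by rewrite ler_pdivrMr// mul1r /y lerDr sqdist_ge0.
  have z0 : 0 < y^-1 by rewrite invr_gt0.
  rewrite -![y ^- _]exprVn; move: ya z0; set z := y^-1 => za z0.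
  have : 0 <= z ^+ 3 * a * (1 - a * z).
    by rewrite mulr_ge0 ?mulr_ge0 ?exprn_ge0 ?(ltW z0) ?(ltW a0)// subr_ge0.
  by move=> h; rewrite -subr_ge0; apply: (le_trans h); rewrite le_eqVlt; apply/orP; left; apply/eqP; ring.
Qed.

End bubble.

(** * Point values of Hoelder continuous functions *)

Lemma integralZ_EFin d (T : measurableType d) (R : realType)
    (mu : {measure set T -> \bar R}) (k : R) (f : T -> R) :
  measurable_fun setT f -> (forall x, 0 <= f x) -> 0 <= k ->
  (\int[mu]_x (k * f x)%:E = k%:E * \int[mu]_x (f x)%:E)%E.
Proof.
move=> mf f0 k0; under eq_integral do rewrite EFinM.
apply: ge0_integralZl => //; first exact/measurable_EFinP.
by move=> x _; rewrite lee_fin.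
Qed.

Section holder.
Context {R : realType}.
Implicit Types (u : R4 R -> R) (x y c : R4 R).

Lemma coord4_inj x y : (forall i, coord4 i x = coord4 i y) -> x = y.
Proof.
case: x y => [[[x0 x1] x2] x3] [[[y0 y1] y2] y3] h.
have := h 0; have := h 1; have := h 2; have := h 3.
by rewrite /coord4/= => -> -> -> ->.
Qed.

Lemma sqdist_gt0 x c : x != c -> 0 < sqdist c x.
Proof.
rewrite lt_neqAle sqdist_ge0 andbT; apply: contra => /eqP h.
apply/eqP/coord4_inj => i; apply/eqP; rewrite -subr_eq0 -sqrf_eq0.
have /psumr_eq0P : forall i : 'I_4, true -> 0 <= (coord4 i x - coord4 i c) ^+ 2.
  by move=> j _; exact: sqr_ge0.
by move=> /(_ (esym h)) ->.
Qed.

Lemma holder_seminorm_ge0 (alpha : R) u : (0 <= holder_seminorm alpha u)%E.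
Proof.
pose p : R4 R * R4 R := (std_basis 0, 0).
apply: (@le_trans _ _ (`|u p.1 - u p.2| / enorm (p.1 - p.2) `^ alpha)%:E).
  by rewrite lee_fin divr_ge0// powR_ge0.
apply: ereal_sup_ubound; exists p => //=.
by apply/eqP => -[] /eqP; rewrite oner_eq0.
Qed.

Lemma holder_le (alpha : R) u x y : 0 < alpha -> (holder_seminorm alpha u < +oo)%E ->
  `|u x - u y| <= fine (holder_seminorm alpha u) * sqdist y x `^ (alpha / 2).
Proof.
move=> al0 hu.
have hf : holder_seminorm alpha u \is a fin_num by rewrite ge0_fin_numE// holder_seminorm_ge0.
have D0 : 0 <= fine (holder_seminorm alpha u) by rewrite fine_ge0// holder_seminorm_ge0.
have [->|xy] := eqVneq x y; first by rewrite subrr normr0 mulr_ge0// powR_ge0.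
have s0 := sqdist_gt0 xy.
have E : sqdist y x `^ (alpha / 2) = enorm (x - y) `^ alpha.
  by rewrite enorm_sub -powR12_sqrt ?sqdist_ge0// -powRrM mulrC.
rewrite E -ler_pdivrMr; last by rewrite -E powR_gt0.
rewrite -lee_fin fineK//; apply: ereal_sup_ubound.
by exists (x, y).
Qed.

(** Replaces the fractional power in the Hoelder estimate by an affine function
    of [s/a], whose average against [bubble] is explicit. *)
Lemma powR_le_interp (alpha a s : R) : 0 < alpha -> alpha < 1 -> 0 < a -> 0 <= s ->
  s `^ (alpha / 2) <= a `^ (alpha / 2) * (1 + s / a).
Proof.
move=> al0 al1 a0 s0.
have z0 : 0 <= s / a by rewrite divr_ge0// ltW.
rewrite -[s in leLHS](divfK (lt0r_neq0 a0)) [_ / a * a]mulrC powRM ?(ltW a0)//.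
rewrite ler_wpM2l ?powR_ge0//.
have [z1|/ltW z1] := leP (s / a) 1.
  have h : (s / a) `^ (alpha / 2) <= 1 `^ (alpha / 2).
    by apply: ge0_ler_powR; rewrite ?nnegrE//; lra.
  by rewrite powR1 in h; rewrite (le_trans h)// lerDl.
rewrite (le_trans (ler1_powR z1 _))//; first lra.
by rewrite lerDr.
Qed.

End holder.

Section pointwise_estimate.
Context {R : realType}.
Notation mu := (@leb4 R).
Variables (alpha : R) (u : R4 R -> R).
Hypotheses (al0 : 0 < alpha) (al1 : alpha < 1).
Hypotheses (uH : H20 u) (uh : (holder_seminorm alpha u < +oo)%E).
Let D := fine (holder_seminorm alpha u).
Let T := fine (L2norm (laplacian u)).
Let D0 : 0 <= D. Proof. by rewrite fine_ge0// holder_seminorm_ge0. Qed.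
Let T0 : 0 <= T. Proof. exact: fine_Lnorm2_ge0. Qed.

Definition bubble_const : R := ball_volume + 3 / 2 * pi ^+ 2.

Let integrable_mul_bubble (c : R4 R) (a : R) : 0 < a ->
  mu.-integrable setT (EFin \o (fun x => u x * bubble c a x)).
Proof.
move=> a0; have uL : L2B u by have [[]] := uH.
rewrite (mul_trunc _ uL); apply: L2B_mul_integrable => //.
exact: (trunc_L2B (@continuous_bubble R c a a0)).
Qed.

(** The density [bubble] has mass one, so the difference is an average of
    [u c - u x], bounded by the Hoelder estimate. The product of [1 + rho/a]
    with the density is [6 a/pi^2 (rho + a)^-3], of integral [3]. *)
Lemma average_error (c : R4 R) (a : R) : 0 < a -> a < 1 ->
  `|u c - \int[mu]_x (u x * bubble c a x)| <= 3 * D * a `^ (alpha / 2).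
Proof.
move=> a0 a1.
have sa x : 0 < sqdist c x + a by rewrite ltr_wpDl// sqdist_ge0.
have iP := @integrable_bubble R c a a0.
have iuP := integrable_mul_bubble c a0.
have icP : mu.-integrable setT (EFin \o (fun x => u c * bubble c a x)).
  exact: (integrableZl measurableT (u c) iP).
have -> : u c = \int[mu]_x (u c * bubble c a x).
  by rewrite RintegralZl// /Rintegral integral_bubble// mulr1.
rewrite -RintegralB//.
have iD := integrableB measurableT icP iuP.
apply: (le_trans (le_normr_Rintegral measurableT iD)).
pose b x : R := D * a `^ (alpha / 2) * (6 * a / pi ^+ 2) * (sqdist c x + a) ^- 3.
have p0 : pi != 0 :> R by rewrite gt_eqF// pi_gt0.
have b0 : 0 <= D * a `^ (alpha / 2) by rewrite mulr_ge0// powR_ge0.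
have k0 : 0 <= D * a `^ (alpha / 2) * (6 * a / pi ^+ 2).
  apply: mulr_ge0 => //.
  by apply: divr_ge0; [apply: mulr_ge0; [exact: ler0n|exact: ltW]|exact: sqr_ge0].
have y0 x : 0 <= (sqdist c x + a) ^- 3 by rewrite invr_ge0 exprn_ge0// ltW.
have bb0 x : 0 <= b x by exact: mulr_ge0.
have Ib : (\int[mu]_x (b x)%:E = (3 * D * a `^ (alpha / 2))%:E)%E.
  rewrite integralZ_EFin//; last exact: measurable_sqdistV.
  rewrite integral_sqdistV3// -EFinM; congr EFin.
  by move: (pi : R) p0 => q q0; field; rewrite q0 gt_eqF.
have ib : mu.-integrable setT (EFin \o b).
  apply/integrableP; split.
    by apply/measurable_EFinP; apply: measurable_funM => //; exact: measurable_sqdistV.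
  under eq_integral do rewrite /= ger0_norm//.
  by rewrite Ib ltry.
have -> : 3 * D * a `^ (alpha / 2) = \int[mu]_x b x by rewrite /Rintegral Ib.
apply: le_Rintegral => //.
  exact: integrable_norm.
move=> x _; rewrite -mulrBl normrM (ger0_norm (@bubble_ge0 R c a a0 x)).
have h := @holder_le R alpha u x c al0 uh; rewrite distrC in h.
apply: (@le_trans _ _ (D * (a `^ (alpha / 2) * (1 + sqdist c x / a)) * bubble c a x)).
  rewrite ler_wpM2r ?bubble_ge0// (le_trans h)// ler_wpM2l//.
  by apply: powR_le_interp => //; exact: sqdist_ge0.
rewrite le_eqVlt; apply/orP; left; apply/eqP.
rewrite /b /bubble; have := sa x; set s := sqdist c x => s0.
by move: (pi : R) p0 => q q0; field; rewrite q0 !gt_eqF.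
Qed.

Lemma pointwise_bound (c : R4 R) (a : R) : 0 < a -> a < 1 ->
  `|u c| <= T * Num.sqrt ((ln a^-1 + bubble_const / pi ^+ 2) / (16 * pi ^+ 2))
    + 3 * D * a `^ (alpha / 2).
Proof.
move=> a0 a1; have p0 : 0 < pi :> R := pi_gt0 R.
have := @average_error c a a0 a1; set I := \int[mu]_x _ => h.
rewrite -(subrK I (u c)) (le_trans (ler_normD _ _))// addrC lerD//.
have q0 : 4 * pi ^+ 2 != 0 :> R by rewrite mulf_neq0// expf_neq0// gt_eqF.
have k0 : 0 <= (4 * pi ^+ 2)^-1 :> R by rewrite invr_ge0; apply: mulr_ge0 => //; exact: sqr_ge0.
have -> : I = - (4 * pi ^+ 2)^-1 *
   \int[mu]_x (u x * \sum_(i < 4) partials [:: i; i] (bubble_potential c a) x).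
  rewrite (_ : (fun x => _) = fun x => - (4 * pi ^+ 2) * (u x * bubble c a x)); last first.
    by apply/funext => x; rewrite laplacian_bubble_potential//; ring.
  rewrite RintegralZl//; last exact: integrable_mul_bubble.
  by rewrite mulrA mulrNN mulVf// mul1r.
rewrite normrM normrN (ger0_norm k0).
have := laplacian_duality uH (@smooth_bubble_potential R c a a0).
have := @bubble_potential_L2 R c a a0 a1; rewrite -/T.
set P := fine (L2norm (trunc _)) => P2 dual.
have P0 : 0 <= P by exact: fine_Lnorm2_ge0.
rewrite (le_trans (ler_wpM2l k0 dual))// mulrCA ler_wpM2l//.
rewrite -[leLHS]ger0_norm ?mulr_ge0// -sqrtr_sqr ler_wsqrtr//.
rewrite ler_pdivlMr; last by rewrite mulr_gt0// exprn_gt0.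
rewrite (_ : _ * (16 * _) = P ^+ 2 / pi ^+ 2); last first.
  by move: (pi : R) p0 => q qp; field; rewrite gt_eqF.
rewrite ler_pdivrMr ?exprn_gt0// (le_trans P2)// le_eqVlt; apply/orP; left; apply/eqP.
by rewrite /bubble_const; move: (pi : R) p0 => q qp; field; rewrite gt_eqF.
Qed.

End pointwise_estimate.

(** * The logarithmic inequality above the critical constant *)

Section upper_bound.
Context {R : realType}.
Notation mu := (@leb4 R).

Lemma leb4_setT_gt0 : (0 < mu setT)%E.
Proof.
apply: (@lt_le_trans _ _ (mu (box4 0 1))).
  by rewrite leb4_box// lte_fin exprn_gt0.
by apply: le_measure; rewrite ?inE//; exact: measurable_box4.
Qed.

Lemma Linfnorm_le (u : R4 R -> R) (M : R) : (forall x, `|u x| <= M) ->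
  (Linfnorm u <= M%:E)%E.
Proof.
move=> uM; rewrite /Linfnorm unlock leb4_setT_gt0; apply/ess_supP.
by apply: aeW => x; rewrite /= lee_fin.
Qed.

Lemma Linfnorm_sqr_le (u : R4 R -> R) (M : R) : (forall x, `|u x| ^+ 2 <= M) ->
  (Linfnorm u ^+ 2 <= M%:E)%E.
Proof.
move=> uM; have M0 : 0 <= M by rewrite (le_trans _ (uM 0))// sqr_ge0.
have : (Linfnorm u <= (Num.sqrt M)%:E)%E.
  apply: Linfnorm_le => x; rewrite -[leLHS]ger0_norm// -sqrtr_sqr ler_wsqrtr//.
rewrite -[in X in _ -> X](sqr_sqrtr M0) EFin_expe !expe2 => h.
by apply: lee_pmul => //; exact: Lnorm_ge0.
Qed.

Lemma sqr_add_le (eta s k : R) : 0 < eta ->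
  (s + k) ^+ 2 <= (1 + eta) * s ^+ 2 + (1 + eta^-1) * k ^+ 2.
Proof.
move=> e0; rewrite -subr_ge0.
rewrite (_ : _ - _ = eta^-1 * (eta * s - k) ^+ 2); last by field; rewrite gt_eqF.
by rewrite mulr_ge0 ?sqr_ge0// invr_ge0 ltW.
Qed.

Variables (alpha : R).
Hypotheses (al0 : 0 < alpha) (al1 : alpha < 1).

Section one_function.
Variable (u : R4 R -> R).
Hypotheses (uH : H20 u) (uh : (holder_seminorm alpha u < +oo)%E).
Let D := fine (holder_seminorm alpha u).
Let T := fine (L2norm (laplacian u)).
Let D0 : 0 <= D. Proof. by rewrite fine_ge0// holder_seminorm_ge0. Qed.
Let T0 : 0 <= T. Proof. exact: fine_Lnorm2_ge0. Qed.

(** Follows from [pointwise_bound] with [a = b^(2/alpha)]. *)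
Lemma pointwise_bound_rescaled (c : R4 R) (b : R) : 0 < b -> b < 1 ->
  `|u c| <= T * Num.sqrt (ln b^-1 / (8 * pi ^+ 2 * alpha) +
     bubble_const / (16 * pi ^+ 4)) + 3 * D * b.
Proof.
move=> b0 b1; pose a := b `^ (2 / alpha).
have a0 : 0 < a by rewrite powR_gt0.
have p0 : 0 < pi :> R := pi_gt0 R.
have lnb : ln b < 0 by apply: ln_lt0; rewrite b0.
have a1 : a < 1.
  rewrite -(expR0 R) -[a]lnK ?posrE// ltr_expR ln_powR nmulr_llt0//.
  by rewrite divr_gt0.
have ab : a `^ (alpha / 2) = b.
  rewrite -powRrM (_ : 2 / alpha * (alpha / 2) = 1) ?powRr1 ?(ltW b0)//.
  by field; rewrite gt_eqF.
have := pointwise_bound al0 al1 uH uh c a0 a1; rewrite ab -/D -/T.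
move=> /le_trans; apply; rewrite lerD2r// ler_wpM2l// ler_wsqrtr//.
rewrite le_eqVlt; apply/orP; left; apply/eqP.
rewrite !lnV ?posrE// ln_powR.
by move: (pi : R) p0 => q q0; field; rewrite !gt_eqF.
Qed.

(** With [T = 0] the bound is [3 D b], and [b] is arbitrarily small. *)
Lemma laplacian_eq0_eq0 : T = 0 -> forall c, u c = 0.
Proof.
move=> T00 c; apply/eqP; rewrite -normr_le0; apply/ler_addgt0Pl => e e0; rewrite addr0.
have d0 : 0 < 3 * D + e + 1 by rewrite ltr_pwDr// addr_ge0 ?mulr_ge0// ltW.
have := @pointwise_bound_rescaled c (e / (3 * D + e + 1)).
rewrite divr_gt0// ltr_pdivrMr// mul1r T00 mul0r add0r => /(_ isT).
have -> : e < 3 * D + e + 1 by have := D0; lra.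
move=> /(_ isT)/le_trans; apply.
rewrite mulrA ler_pdivrMr// [leLHS]mulrC ler_wpM2l ?(ltW e0)//; have := D0; lra.
Qed.

(** The choice [b = 1/(2 + N)] makes [3 D b <= 3 T]; the square of the sum is
    then expanded with a small weight [eta] on the cross term. *)
Lemma sup_bound (eta : R) : 0 < eta -> 0 < T -> forall c,
  `|u c| ^+ 2 <= T ^+ 2 * ((1 + eta) / (8 * pi ^+ 2 * alpha) * ln (2 + D / T) +
    ((1 + eta) * (bubble_const / (16 * pi ^+ 4)) + (1 + eta^-1) * 9)).
Proof.
move=> eta0 T_gt0 c; have p0 : 0 < pi :> R := pi_gt0 R.
set N := D / T; have N0 : 0 <= N by rewrite divr_ge0.
have N2 : 0 < 2 + N by rewrite ltr_pwDl.
have := @pointwise_bound_rescaled c (2 + N)^-1.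
rewrite invr_gt0 N2 invf_lt1// => /(_ isT).
have -> : 1 < 2 + N by lra.
rewrite invrK => /(_ isT).
set S := Num.sqrt _ => uS.
have S0 : 0 <= S by exact: sqrtr_ge0.
have DT : D = T * N by rewrite /N mulrC divfK// gt_eqF.
have uS3 : `|u c| <= T * (S + 3).
  rewrite (le_trans uS)// mulrDr lerD2l// DT.
  rewrite ler_pdivrMr//; have : 0 <= T * 6 by rewrite mulr_ge0.
  lra.
have lnN : 0 <= ln (2 + N) by rewrite ln_ge0//; lra.
have S2 : S ^+ 2 = ln (2 + N) / (8 * pi ^+ 2 * alpha) + bubble_const / (16 * pi ^+ 4).
  rewrite sqr_sqrtr//; apply: addr_ge0; apply: divr_ge0 => //.
  - by rewrite !mulr_ge0// ?exprn_ge0// ltW.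
  - by rewrite /bubble_const addr_ge0 ?ball_volume_ge0// mulr_ge0// sqr_ge0.
  - by rewrite mulr_ge0// exprn_ge0// ltW.
apply: (@le_trans _ _ ((T * (S + 3)) ^+ 2)).
  by rewrite lerXn2r ?nnegrE// mulr_ge0// addr_ge0.
rewrite exprMn ler_wpM2l ?sqr_ge0//.
rewrite (le_trans (sqr_add_le S 3 eta0))// S2.
rewrite le_eqVlt; apply/orP; left; apply/eqP.
by move: (pi : R) p0 => q q0; field; rewrite !gt_eqF.
Qed.

End one_function.

Lemma logarithmic_inequality (lambda : R) : 1 / (8 * pi ^+ 2 * alpha) < lambda ->
  exists C : R, 0 < C /\
    forall u : R4 R -> R, H20rad_holder alpha u -> u <> cst 0 ->
      (Linfnorm u ^+ 2 <=
       lambda%:E * L2norm (laplacian u) ^+ 2 * (ln (C + N_holder alpha u))%:E)%E.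
Proof.
set l0 := 1 / _ => ll0.
have l00 : 0 < l0 by rewrite divr_gt0 ?mulr_gt0 ?exprn_gt0 ?pi_gt0.
(* Half of the excess [lambda - l0] pays for the cross term of the square,
   the other half [d] for the bounded remainder [K]. *)
pose eta := (lambda - l0) / (2 * l0).
have eta0 : 0 < eta by apply: divr_gt0; [rewrite subr_gt0|exact: mulr_gt0].
pose K := (1 + eta) * (bubble_const / (16 * pi ^+ 4)) + (1 + eta^-1) * 9.
pose d := (lambda - l0) / 2.
have d0 : 0 < d by apply: divr_gt0; [rewrite subr_gt0|].
exists (2 + expR (K / d)); split; first by rewrite addr_gt0// expR_gt0.
move=> u [uH urad uh] u0.
have [uH2 _] := uH; have lL := laplacian_L2B uH2.
set T := fine (L2norm (laplacian u)).
have TE : L2norm (laplacian u) = T%:E by rewrite fineK// Lfun2_fin_num// lL.1.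
have T_ge0 : 0 <= T by exact: fine_Lnorm2_ge0.
have T0 : 0 < T.
  rewrite lt_neqAle T_ge0 andbT eq_sym; apply/eqP => T00; apply: u0.
  by apply/funext => c; exact: (laplacian_eq0_eq0 uH uh T00).
rewrite TE -EFin_expe -!EFinM; apply: Linfnorm_sqr_le => c.
apply: (le_trans (sup_bound uH uh eta0 T0 c)).
rewrite /N_holder -/T; set N := _ / T.
have N0 : 0 <= N by rewrite divr_ge0// fine_ge0// holder_seminorm_ge0.
rewrite -/K (mulrC lambda) -[leRHS]mulrA ler_wpM2l ?sqr_ge0//.
have E1 : (1 + eta) / (8 * pi ^+ 2 * alpha) = l0 + d.
  rewrite (_ : _ / _ = (1 + eta) * l0); last by rewrite /l0 mul1r.
  by rewrite /eta /d; field; rewrite gt_eqF.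
have E2 : lambda = (l0 + d) + d by rewrite /d; field.
rewrite E1 E2 [leRHS]mulrDl lerD//.
  rewrite ler_wpM2l ?addr_ge0 ?(ltW l00) ?(ltW d0)// ler_ln ?posrE.
  - by rewrite lerD2r lerDl expR_ge0.
  - by rewrite ltr_pwDl.
  - by rewrite ltr_pwDl// addr_gt0// expR_gt0.
rewrite mulrC -ler_pdivrMr// -[leLHS]expRK ler_ln ?posrE ?expR_gt0//.
  by rewrite -addrA addrCA lerDl addr_ge0.
by rewrite ltr_pwDl// addr_gt0// expR_gt0.
Qed.

End upper_bound.

(** * Radial test functions with a logarithmic peak *)

Section profile.
Context {R : realType}.
Notation mu := (@leb4 R).

Lemma flatn_bounded n : exists C : R, 0 <= C /\ forall y, `|flatn n y| <= C.
Proof.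
have [C HC] := horner_le_expR (flat_poly n : {poly R}).
exists `|C|; split=> // y; rewrite /flatn.
case: ifPn => y0; last by rewrite normr0.
have V0 : 0 <= y^-1 by rewrite invr_ge0 ltW.
rewrite normrM (ger0_norm (expR_ge0 _)) expRN ler_pdivrMr ?expR_gt0//.
by rewrite (le_trans (HC _ V0))// ler_wpM2r ?expR_ge0// ler_norm.
Qed.

Variable (a : R).
Hypothesis (a0 : 0 < a).

(** Equal to [s + a] for [s >= 1/2], but bounded below near [s = 0]
    independently of [a]: the added bump [exp(-1/(1/2 - s))] fills the dip. *)
Definition filled (s : R) : R := s + a + flat (2^-1 - s).

Definition log_profile (s : R) : R := 2^-1 * (ln (filled s) - ln (s + a)).

(** Half the difference of two logarithms, which coincide for [rho >= 1/2]:
    a test function that behaves like [- log(rho + a)/2] near the origin. *)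
Definition log_peak (x : R4 R) : R := log_profile (sqdist 0 x).

Definition filled_lb : R := expR (- 4).

Lemma filled_ge (s : R) : 0 <= s -> filled_lb <= filled s.
Proof.
move=> s0; have [s4|s4] := leP s 4^-1.
  rewrite /filled flatE; last by lra.
  have : (2^-1 - s)^-1 <= 4.
    rewrite invf_ple ?posrE//; lra.
  rewrite -lerN2 => h.
  have h' : filled_lb <= expR (- (2^-1 - s)^-1) by rewrite ler_expR.
  by rewrite (le_trans h')// lerDr addr_ge0// ltW.
have : expR (- 4) <= 4^-1 :> R.
  rewrite expRN lef_pV2 ?posrE ?expR_gt0//.
  have := expR_ge1Dx (4 : R); lra.
rewrite /filled_lb /filled => h; have := flat_ge0 (2^-1 - s); have := a0; lra.
Qed.

Lemma filled_gt0 s : 0 <= s -> 0 < filled s.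
Proof. by move=> s0; apply: lt_le_trans (filled_ge s0); exact: expR_gt0. Qed.

Lemma filled_ge_id s : s <= filled s.
Proof. by rewrite /filled -addrA lerDl addr_ge0 ?flat_ge0// ltW. Qed.

Lemma test_function_log_peak : test_function log_peak.
Proof.
have es := @elementary_sqdist R 0.
have e1 : elementary (fun x : R4 R => sqdist 0 x + a).
  by apply: elementaryD => //; exact: elementary_cst.
have sm : smooth log_peak.
  apply: elementary_smooth; apply: elementaryM; first exact: elementary_cst.
  apply: elementaryB; apply: elementary_ln => //.
  - by move=> x; apply: filled_gt0; exact: sqdist_ge0.
  - apply: elementaryD => //; apply: elementary_flat.
    by apply: elementaryB => //; exact: elementary_cst.
  - by move=> x; rewrite ltr_wpDl// sqdist_ge0.
apply: (@test_function_of_support _ _ 2^-1 sm); first lra.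
move=> x x2; rewrite /log_peak /log_profile /filled flat_eq0; last by rewrite subr_le0 ltW.
by rewrite addr0 subrr mulr0.
Qed.

Let filled' s : R := 1 - flatn 1 (2^-1 - s).
Let filled'' s : R := flatn 2 (2^-1 - s).

Lemma is_derive_flatn_opp n (s : R) :
  is_derive s 1 (fun z : R => flatn n (2^-1 - z)) (- flatn n.+1 (2^-1 - s)).
Proof.
have d1 : is_derive s 1 (fun z : R => 2^-1 - z) (-1).
  by apply: (is_derive_eq (is_deriveB (is_derive_cst (2^-1 : R) s 1) (is_derive_id s 1))); rewrite sub0r.
apply: (is_derive_eq (is_derive_comp1 d1 (is_derive_flatn n (2^-1 - s)))).
by rewrite mulrN1.
Qed.

Lemma is_derive_filled (s : R) : is_derive s 1 filled (filled' s).
Proof.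
have d := is_derive_flatn_opp 0 s.
have d1 : is_derive s 1 (fun z : R => z + a) 1 by apply: is_derive_eq; rewrite addr0.
exact: (is_derive_eq (is_deriveD d1 d)).
Qed.

Let is_derive_filled' (s : R) : is_derive s 1 filled' (filled'' s).
Proof.
have d := is_derive_flatn_opp 1 s.
by apply: (is_derive_eq (is_deriveB (is_derive_cst (1 : R) s 1) d)); rewrite sub0r opprK.
Qed.

Let profile' s : R := 2^-1 * (filled' s / filled s - (s + a)^-1).
Let profile'' s : R := 2^-1 * (filled'' s / filled s - filled' s ^+ 2 / filled s ^+ 2
  + (s + a) ^- 2).

Let is_derive_profile (s : R) : 0 <= s -> is_derive s 1 log_profile (profile' s).
Proof.
move=> s0; have k0 := filled_gt0 s0; have sa : 0 < s + a by rewrite ltr_wpDl.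
have d1 : is_derive s 1 (fun z : R => z + a) 1 by apply: is_derive_eq; rewrite addr0.
have dk := is_derive_comp1 (is_derive_filled s) (is_derive1_ln k0).
have da := is_derive_comp1 d1 (is_derive1_ln sa).
apply: (is_derive_eq (is_deriveZ 2^-1 (is_deriveB dk da))).
by rewrite /profile' /GRing.scale/= mulr1 [filled' s / _]mulrC.
Qed.

Let is_derive_profile' (s : R) : 0 <= s -> is_derive s 1 profile' (profile'' s).
Proof.
move=> s0; have k0 := filled_gt0 s0; have sa : 0 < s + a by rewrite ltr_wpDl.
have d1 : is_derive s 1 (fun z : R => z + a) 1 by apply: is_derive_eq; rewrite addr0.
have dk := @is_deriveV R filled s _ 1 (lt0r_neq0 k0) (is_derive_filled s).
have da := @is_deriveV R (fun z => z + a) s _ 1 (lt0r_neq0 sa) d1.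
have dm := is_deriveM (is_derive_filled' s) dk.
apply: (is_derive_eq (is_deriveZ 2^-1 (is_deriveB dm da))).
rewrite /profile'' /GRing.scale/=.
move: (filled s) k0 (filled' s) (filled'' s) => k k0 k1 k2.
by field; rewrite !gt_eqF.
Qed.

Lemma laplacian_log_peak x :
  \sum_(i < 4) partials [:: i; i] log_peak x =
  (2 * sqdist 0 x * (flatn 2 (2^-1 - sqdist 0 x) / filled (sqdist 0 x) -
     (1 - flatn 1 (2^-1 - sqdist 0 x)) ^+ 2 / filled (sqdist 0 x) ^+ 2) +
   4 * ((1 - flatn 1 (2^-1 - sqdist 0 x)) / filled (sqdist 0 x))) -
  (2 * (sqdist 0 x + a)^-1 + 2 * a * (sqdist 0 x + a) ^- 2).
Proof.
have sa : 0 < sqdist 0 x + a by rewrite ltr_wpDl// sqdist_ge0.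
have k0 := filled_gt0 (sqdist_ge0 0 x).
rewrite (laplacian_radial 0 is_derive_profile is_derive_profile').
rewrite /profile'' /profile' /filled' /filled''.
move: (filled (sqdist 0 x)) k0 (flatn 1 _) (flatn 2 _) => k k0 f1 f2.
by field; rewrite !gt_eqF.
Qed.

End profile.

(** * The energy of the logarithmic peak *)

Section log_peak_energy.
Context {R : realType}.
Notation mu := (@leb4 R).

(** The terms of the Laplacian that involve [filled] are bounded by [K]
    uniformly in [a]; the others come from [- log(rho + a)/2] and, with
    [y = 1/(rho + a)] and [a y <= 1], amount to [2 y + 2 a y^2 <= 4 y]. *)
Lemma laplacian_log_peak_le : exists K : R, 0 <= K /\
  forall (a : R) x, 0 < a -> unit_ball x ->
  (\sum_(i < 4) partials [:: i; i] (log_peak a) x) ^+ 2 <=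
  K ^+ 2 + (8 * K * (sqdist 0 x + a)^-1 +
    (4 * (sqdist 0 x + a) ^- 2 + 12 * a * (sqdist 0 x + a) ^- 3)).
Proof.
have [C1 [C10 HC1]] := @flatn_bounded R 1.
have [C2 [C20 HC2]] := @flatn_bounded R 2.
have m0 : 0 < filled_lb :> R by exact: expR_gt0.
pose m : R := filled_lb.
pose K := 2 * (C2 / m + (1 + C1) ^+ 2 / m ^+ 2) + 4 * ((1 + C1) / m).
have C11 : 0 <= 1 + C1 by rewrite addr_ge0.
have K0 : 0 <= K.
  by rewrite !addr_ge0// mulr_ge0// ?addr_ge0// divr_ge0// ?sqr_ge0// ltW.
exists K; split => // a x a0 xB.
rewrite laplacian_log_peak//; set s := sqdist 0 x.
have s0 : 0 <= s by exact: sqdist_ge0.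
have s1 : s <= 1 by move: xB; rewrite unit_ballE => /ltW.
have sa : 0 < s + a by rewrite ltr_wpDl.
have km := filled_ge a0 s0; have k0 := filled_gt0 a0 s0.
set e := 2 * s * _ + _; set v := 2 * _ + _.
have eK : `|e| <= K.
  have Vk : (filled a s)^-1 <= m^-1 by rewrite lef_pV2.
  have Vk0 : 0 <= (filled a s)^-1 by rewrite invr_ge0 ltW.
  have n1 : `|1 - flatn 1 (2^-1 - s)| <= 1 + C1.
    by rewrite (le_trans (ler_normB _ _))// normr1 lerD2l.
  have t1 : `|flatn 2 (2^-1 - s) / filled a s| <= C2 / m.
    by rewrite normrM (ger0_norm Vk0) ler_pM.
  have t2 : `|(1 - flatn 1 (2^-1 - s)) / filled a s| <= (1 + C1) / m.
    by rewrite normrM (ger0_norm Vk0) ler_pM.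
  have t3 : `|(1 - flatn 1 (2^-1 - s)) ^+ 2 / filled a s ^+ 2| <= (1 + C1) ^+ 2 / m ^+ 2.
    rewrite -!expr_div_n normrX lerXn2r ?nnegrE//.
    by rewrite (le_trans _ t2).
  rewrite /e /K (le_trans (ler_normD _ _))//; apply: lerD; last first.
    by rewrite normrM (ger0_norm (ler0n _ _)) ler_wpM2l.
  rewrite -mulrA normrM (ger0_norm (ler0n _ _)) ler_wpM2l// normrM (ger0_norm s0).
  rewrite (le_trans (ler_piMl (normr_ge0 _) s1))// (le_trans (ler_normB _ _))//.
  exact: lerD.
set y := (s + a)^-1 in v *; have y0 : 0 < y by rewrite invr_gt0.
have ay : a * y <= 1 by rewrite ler_pdivrMr// mul1r lerDr.
have vE : v = 2 * y + 2 * a * y ^+ 2 by rewrite /v -exprVn.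
have v0 : 0 <= v.
  by rewrite vE addr_ge0// !mulr_ge0// ?sqr_ge0 ?(ltW y0) ?(ltW a0).
have vy : v <= 4 * y.
  rewrite vE; have : 0 <= y * (1 - a * y) by rewrite mulr_ge0 ?(ltW y0)// subr_ge0.
  lra.
have v2 : v ^+ 2 <= 4 * y ^+ 2 + 12 * a * y ^+ 3.
  have : 0 <= a * y ^+ 3 * (1 - a * y).
    by rewrite !mulr_ge0 ?exprn_ge0 ?(ltW y0) ?(ltW a0)// subr_ge0.
  rewrite vE; lra.
rewrite -!exprVn -/y.
apply: (@le_trans _ _ ((K + v) ^+ 2)).
  have ev : `|e - v| <= K + v.
    by rewrite (le_trans (ler_normB _ _))// (ger0_norm v0) lerD2r.
  apply: (@le_trans _ _ (`|e - v| ^+ 2)); first by rewrite real_normK ?num_real.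
  by apply: lerXn2r => //; rewrite nnegrE; exact: addr_ge0.
have : 0 <= K * (4 * y - v) by rewrite mulr_ge0// subr_ge0.
lra.
Qed.

(** Of the terms in [laplacian_log_peak_le] only [4 (rho + a)^-2] has an
    unbounded integral over the ball, with leading part [4 pi^2 log(1/a)]. *)
Lemma L2norm_laplacian_log_peak : exists K1 : R, 0 <= K1 /\ forall a : R, 0 < a -> a < 1 ->
  fine (L2norm (laplacian (log_peak a))) ^+ 2 <= 4 * pi ^+ 2 * ln a^-1 + K1.
Proof.
have [K [K0 HK]] := laplacian_log_peak_le.
exists (K ^+ 2 * ball_volume + (8 * K * (2 * ball_volume + pi ^+ 2) +
  (4 * ball_volume + 6 * pi ^+ 2))).
have V0 := @ball_volume_ge0 R; have p2 : 0 <= pi ^+ 2 :> R by exact: sqr_ge0.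
split.
  apply: addr_ge0; first by rewrite mulr_ge0 ?sqr_ge0.
  have r n : 0 <= n%:R :> R := ler0n _ _.
  apply: addr_ge0; first exact: mulr_ge0 (mulr_ge0 (r 8%N) K0) (addr_ge0 (mulr_ge0 (r 2%N) V0) p2).
  exact: addr_ge0 (mulr_ge0 (r 4%N) V0) (mulr_ge0 (r 6%N) p2).
move=> a a0 a1; have tu := test_function_log_peak a0.
have lL := laplacian_L2B (test_function_H2 tu).
rewrite -lee_fin EFin_expe fineK ?Lfun2_fin_num ?lL.1//.
pose g x : R := \sum_(i < 4) partials [:: i; i] (log_peak a) x.
have mg : measurable_fun [set: mR4 R] g.
  have sg i : smooth (partials [:: i; i] (log_peak a)).
    exact/smooth_partials/test_function_smooth.
  apply: measurable_sum => i; exact: smooth_measurable.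
have -> : L2norm (laplacian (log_peak a)) = L2norm g.
  apply: ae_eq_Lnorm2 => //; first exact: (Lfun2_measurable lL.1).
  exact: test_function_laplacian.
rewrite sqr_Lnorm2.
have sa x : 0 < sqdist 0 x + a by rewrite ltr_wpDl// sqdist_ge0.
have g0 x : ~ unit_ball x -> g x = 0.
  move=> xB; rewrite /g big1// => i _.
  exact: (test_function_out (test_function_partials [:: i; i] tu)).
have mB := @measurable_unit_ball R.
have -> : (\int[mu]_x (g x ^+ 2)%:E = \int[mu]_(x in unit_ball) (g x ^+ 2)%:E)%E.
  rewrite [RHS]integral_mkcond; apply: eq_integral => x _; rewrite /patch.
  by case: ifPn => //; rewrite notin_setE => /g0 ->; rewrite expr0n.
have mS k (r : R) : measurable_fun (unit_ball : set (mR4 R))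
    (fun x => (r * (sqdist 0 x + a) ^- k)%:E).
  apply/measurable_EFinP; apply: measurable_funTS; apply: measurable_funM => //.
  exact: measurable_sqdistV.
have pS k (r : R) : 0 <= r -> forall x, unit_ball x -> (0 <= (r * (sqdist 0 x + a) ^- k)%:E)%E.
  by move=> r0 x _; rewrite lee_fin mulr_ge0// invr_ge0 exprn_ge0// ltW.
have IS k (r L : R) : 0 <= r -> 0 <= L ->
    (\int[mu]_(x in unit_ball) ((sqdist 0 x + a) ^- k)%:E <= L%:E)%E ->
    (\int[mu]_(x in unit_ball) (r * (sqdist 0 x + a) ^- k)%:E <= (r * L)%:E)%E.
  move=> r0 L0 hL; under eq_integral do rewrite EFinM.
  rewrite ge0_integralZl//.
  - by rewrite EFinM lee_wpmul2l.
  - by have := mS k 1; under eq_fun do rewrite mul1r.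
  - by move=> x xB; have := pS k 1 ler01 x xB; rewrite mul1r.
have a00 := ltW a0.
have r1 : 0 <= 8 * K by rewrite mulr_ge0.
have r2 : 0 <= 4 :> R by [].
have r3 : 0 <= 12 * a by rewrite mulr_ge0.
have lna : 0 <= ln a^-1 by rewrite ln_ge0// invf_ge1// ltW.
have B1 := IS 1%N (8 * K) (2 * ball_volume + pi ^+ 2) r1 (addr_ge0 (mulr_ge0 (ler0n _ _) V0) p2)
  (ball_integral_sqdistV1 0 a0 a1).
have B2 := IS 2%N 4 (ball_volume + pi ^+ 2 * ln a^-1) r2 (addr_ge0 V0 (mulr_ge0 p2 lna))
  (ball_integral_sqdistV2 0 a0 a1).
have J3 : (\int[mu]_(x in unit_ball) ((sqdist 0 x + a) ^- 3)%:E <= (pi ^+ 2 / (2 * a))%:E)%E.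
  rewrite -(integral_sqdistV3 0 a0); apply: ge0_subset_integral => //.
    by apply/measurable_EFinP; exact: measurable_sqdistV.
  by move=> x _; rewrite lee_fin invr_ge0 exprn_ge0// ltW.
have L3 : 0 <= pi ^+ 2 / (2 * a) :> R by apply: divr_ge0 => //; exact: mulr_ge0.
have B3 := IS 3%N (12 * a) (pi ^+ 2 / (2 * a)) r3 L3 J3.
have B0 : (\int[mu]_(x in unit_ball) (K ^+ 2)%:E = (K ^+ 2 * ball_volume)%:E)%E.
  by rewrite integral_cst// [X in (_ * X)%E]leb4_ballE.
apply: (@le_trans _ _ (\int[mu]_(x in unit_ball) (K ^+ 2)%:E +
  (\int[mu]_(x in unit_ball) (8 * K * (sqdist 0 x + a) ^- 1)%:E +
  (\int[mu]_(x in unit_ball) (4 * (sqdist 0 x + a) ^- 2)%:E +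
   \int[mu]_(x in unit_ball) (12 * a * (sqdist 0 x + a) ^- 3)%:E)))%E).
  have m34 := emeasurable_funD (mS 2%N 4) (mS 3%N (12 * a)).
  have m234 := emeasurable_funD (mS 1%N (8 * K)) m34.
  have p34 x : unit_ball x -> (0 <= (4 * (sqdist 0 x + a) ^- 2)%:E +
      (12 * a * (sqdist 0 x + a) ^- 3)%:E)%E.
    by move=> xB; apply: adde_ge0; [exact: pS|exact: pS].
  have p234 x : unit_ball x -> (0 <= (8 * K * (sqdist 0 x + a) ^- 1)%:E +
      ((4 * (sqdist 0 x + a) ^- 2)%:E + (12 * a * (sqdist 0 x + a) ^- 3)%:E))%E.
    by move=> xB; apply: adde_ge0; [exact: pS|exact: p34].
  rewrite -(ge0_integralD _ mB (pS 2%N 4 r2) (mS _ _) (pS 3%N _ r3) (mS _ _)).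
  rewrite -(ge0_integralD _ mB (pS 1%N _ r1) (mS _ _) p34 m34).
  rewrite -(ge0_integralD _ mB _ _ p234 m234); last 2 first.
  - by move=> x _; rewrite lee_fin sqr_ge0.
  - exact: measurable_cst.
  apply: ge0_le_integral => //.
  - by move=> x _; rewrite lee_fin sqr_ge0.
  - by apply/measurable_EFinP; apply: measurable_funTS; exact: measurable_funX.
  - by apply: emeasurable_funD.
  - by move=> x xB; rewrite -!EFinD lee_fin; exact: HK.
rewrite B0; apply: (@le_trans _ _ (_ + (_ + (_ + _)))%E).
  by apply: leeD2l; apply: leeD; [exact: B1|apply: leeD; [exact: B2|apply: B3]].
rewrite -!EFinD lee_fin le_eqVlt; apply/orP; left; apply/eqP.
move: (pi : R) {p2 B1 B2 B3 J3 L3 IS} => q; set V := ball_volume; set l := ln _.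
by field; rewrite gt_eqF.
Qed.

End log_peak_energy.

(** * Test functions in the Sobolev space; Hoelder continuity of logarithms *)

Section H20_test_functions.
Context {R : realType}.
Notation mu := (@leb4 R).

Lemma partials_cst0 s : partials s (fun _ : R4 R => 0 : R) = (fun _ => 0).
Proof.
elim: s => //= i s ->; apply/funext => x; exact: derive_cst.
Qed.

Lemma test_function_cst0 : test_function (fun _ : R4 R => 0 : R).
Proof.
apply: (@test_function_of_support _ _ 0) => //.
by apply: elementary_smooth; exact: elementary_cst.
Qed.

Lemma L2norm0 : L2norm (fun _ : R4 R => 0 : R) = 0%E.
Proof. by apply: Lnorm0. Qed.

Lemma H2norm0 : H2norm (fun _ : R4 R => 0 : R) = 0%E.
Proof.
have w s : L2norm (weak_partial s (fun _ : R4 R => 0 : R)) = 0%E.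
  have w0 := test_function_weak_partial s test_function_cst0.
  rewrite partials_cst0 in w0; rewrite -L2norm0; apply: (L2norm_unique _ w0).
  by apply: weak_partialP; eexists; exact: w0.
have z : (0 ^+ 2 = 0 :> \bar R)%E by rewrite expe2 mule0.
rewrite /H2norm L2norm0 z big1; last by move=> i _; rewrite w z.
rewrite big1; last by move=> i _; rewrite big1// => j _; rewrite w z.
by rewrite !adde0 poweR0r.
Qed.

Lemma test_function_H20 (phi : R4 R -> R) : test_function phi -> H20 phi.
Proof.
move=> tphi; split; first exact: test_function_H2.
move=> e e0; exists phi => //.
rewrite (_ : phi \- phi = fun=> 0); last by apply/funext => x /=; rewrite subrr.
by rewrite H2norm0 lte_fin.
Qed.

(** If the value at [c] exceeded the essential supremum, then by continuity so
    would the values on a box around [c], which has positive measure. *)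
Lemma Linfnorm_ge (u : R4 R -> R) c : continuous u -> (`|u c|%:E <= Linfnorm u)%E.
Proof.
move=> cu; rewrite /Linfnorm unlock leb4_setT_gt0 leNgt; apply/negP => h.
have := @ess_sup_ge _ _ _ mu (abse \o (EFin \o u)).
set m := ess_sup _ _ in h *; move=> [N [mN N0 subN]].
have m0 : (0 <= m)%E.
  by apply: ess_sup_gee; [exact: leb4_setT_gt0|apply: aeW => x /=].
have mf : m \is a fin_num by rewrite ge0_fin_numE// (lt_trans h)// ltry.
have cn : {for c, continuous (fun x => `|u x|)}.
  by apply: continuous_comp; [exact: cu|exact: norm_continuous].
have : nbhs c [set x | fine m < `|u x|].
  by apply: (cvgr_gt _ cn); rewrite -lte_fin fineK.
move=> /nbhs_ballP[e/= e0 ce].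
have bN : box4 c e `<=` N.
  move=> x xe; apply: subN => /= xm.
  have : fine m < `|u x|.
    apply: ce; case: x xe {xm} => [[[x0 x1] x2] x3] [[[/= k0 k1] k2] k3].
    by split; [split; [split|]|].
  by rewrite -lte_fin fineK// => /lt_geF; rewrite xm.
have : (mu (box4 c e) <= mu N)%E.
  by apply: le_measure; rewrite ?inE//; exact: measurable_box4.
by rewrite N0 leb4_box// lee_fin leNgt exprn_gt0// mulrn_wgt0.
Qed.

End H20_test_functions.

Section holder_log_peak.
Context {R : realType}.
Implicit Types (x y : R4 R).

(** For [t <= 1] this is [log(1 + t) <= t <= t^alpha]; for larger [t] it
    follows from [log(1 + t) <= 1 + log t] and [log z <= z - 1] at
    [z = t^alpha]. *)
Lemma ln1D_le_powR (alpha t : R) : 0 < alpha -> alpha < 1 -> 0 <= t ->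
  ln (1 + t) <= t `^ alpha / alpha.
Proof.
move=> al0 al1 t0; rewrite ler_pdivlMr//.
have l1D (s : R) : 0 <= s -> ln (1 + s) <= s.
  by move=> s0; apply: le_ln1Dx; rewrite (lt_le_trans _ s0)// ltrN10.
have [t1|t1] := leP t 1.
  have [->|tn0] := eqVneq t 0; first by rewrite addr0 ln1 mul0r powR_ge0.
  have tp : 0 < t by rewrite lt_neqAle eq_sym tn0.
  have h : t <= t `^ alpha by apply: ger1_powR; [rewrite tp|exact: ltW].
  have l0 : 0 <= ln (1 + t) by rewrite ln_ge0// lerDl.
  by rewrite (le_trans _ h)// (le_trans (ler_piMr l0 (ltW al1)))// l1D.
have tp : 0 < t by exact: lt_trans t1.
have l2 : ln (1 + t) <= ln 2 + ln t.
  by rewrite -lnM ?posrE// ler_ln ?posrE ?mulr_gt0 ?addr_gt0//; lra.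
have ln2 : ln 2 <= 1 :> R by rewrite (_ : 2 = 1 + 1) ?l1D// .
have lz : ln (t `^ alpha) <= t `^ alpha - 1.
  have := @le_ln1Dx R (t `^ alpha - 1); rewrite addrCA subrr addr0; apply.
  by rewrite ltrBrDr addrC subrr powR_gt0.
rewrite ln_powR in lz.
have h : ln (1 + t) * alpha <= (ln 2 + ln t) * alpha by rewrite ler_wpM2r// ltW.
have h2 : ln 2 * alpha <= 1 by rewrite (le_trans (ler_wpM2r (ltW al0) ln2))// mul1r ltW.
by rewrite (le_trans h)// mulrDl mulrC; lra.
Qed.

(** The reverse triangle inequality. The Cauchy-Schwarz inequality behind it is
    Lagrange's identity. *)
Lemma enorm_dist x y : (Num.sqrt (sqdist 0 x) - Num.sqrt (sqdist 0 y)) ^+ 2 <= sqdist y x.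
Proof.
have X0 := sqdist_ge0 0 x; have Y0 := sqdist_ge0 0 y.
pose p := \sum_(i < 4) coord4 i x * coord4 i y.
have cs : p <= Num.sqrt (sqdist 0 x) * Num.sqrt (sqdist 0 y).
  rewrite -sqrtrM// (le_trans (ler_norm _))// -sqrtr_sqr ler_wsqrtr//.
  rewrite /p /sqdist !big_ord_recr !big_ord0 /=.
  case: x y {X0 Y0 p} => [[[x0 x1] x2] x3] [[[y0 y1] y2] y3].
  rewrite /coord4/= -subr_ge0 !subr0.
  rewrite (_ : _ - _ = (x0 * y1 - x1 * y0) ^+ 2 + (x0 * y2 - x2 * y0) ^+ 2 +
    (x0 * y3 - x3 * y0) ^+ 2 + (x1 * y2 - x2 * y1) ^+ 2 + (x1 * y3 - x3 * y1) ^+ 2 +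
    (x2 * y3 - x3 * y2) ^+ 2); last by ring.
  by rewrite !addr_ge0// sqr_ge0.
have E : sqdist y x = sqdist 0 x + sqdist 0 y - 2 * p.
  rewrite /p /sqdist !big_ord_recr !big_ord0 /=.
  by case: x y {X0 Y0 p cs} => [[[x0 x1] x2] x3] [[[y0 y1] y2] y3]; rewrite /coord4/=; ring.
by rewrite E sqrrB !sqr_sqrtr//; lra.
Qed.

(** Divide the difference of [p] and [q] by [sqrt p + sqrt q], which is at
    least [sqrt s + sqrt t]. *)
Lemma sqrt_lipschitz (p q s t M : R) : 0 < p -> 0 < q -> 0 <= s -> 0 <= t ->
  s <= p -> t <= q -> `|p - q| <= M * `|s - t| -> 0 <= M ->
  `|Num.sqrt p - Num.sqrt q| <= M * `|Num.sqrt s - Num.sqrt t|.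
Proof.
move=> p0 q0 s0 t0 sp tq pq M0.
have sq (r : R) : 0 <= r -> exists2 z, 0 <= z & r = z ^+ 2.
  by move=> r0; exists (Num.sqrt r); rewrite ?sqr_sqrtr.
have [P P0 pE] := sq p (ltW p0); have [Q Q0 qE] := sq q (ltW q0).
have [S S0 sE] := sq s s0; have [T T0 tE] := sq t t0.
rewrite pE qE sE tE !sqrtr_sqr (ger0_norm P0) (ger0_norm Q0) (ger0_norm S0) (ger0_norm T0).
have Pp : 0 < P by rewrite lt_neqAle P0 andbT eq_sym; apply: contraTneq p0 => P00; rewrite pE P00 expr0n ltxx.
have SP : S <= P by rewrite -(@ler_pXn2r _ 2) ?nnegrE// -pE -sE.
have TQ : T <= Q by rewrite -(@ler_pXn2r _ 2) ?nnegrE// -qE -tE.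
have PQ : 0 < P + Q by rewrite ltr_pwDl.
rewrite -(ler_pM2r PQ); move: pq; rewrite pE qE sE tE !subr_sqr !normrM.
rewrite (ger0_norm (ltW PQ)) (ger0_norm (addr_ge0 S0 T0)) => /le_trans; apply.
by rewrite mulrA ler_wpM2l ?mulr_ge0// lerD.
Qed.

(** Half a logarithm of [p] is the logarithm of [sqrt p], and [sqrt p] exceeds
    [sqrt q] by a factor of at most [1 + r/m]. *)
Lemma ln_holder (alpha p q m r : R) : 0 < alpha -> alpha < 1 -> 0 < m ->
  m ^+ 2 <= p -> m ^+ 2 <= q -> `|Num.sqrt p - Num.sqrt q| <= r ->
  2^-1 * `|ln p - ln q| <= (r / m) `^ alpha / alpha.
Proof.
move=> al0 al1 m0 mp mq; have m2 : 0 < m ^+ 2 by exact: exprn_gt0.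
wlog pq : p q mp mq / q <= p.
  move=> W; have [qp|/ltW pq] := leP q p; first exact: W.
  by rewrite (distrC (ln p)) (distrC (Num.sqrt p)); exact: W.
move=> pqr.
have q0 := lt_le_trans m2 mq; have p0 := lt_le_trans m2 mp.
have sq0 : 0 < Num.sqrt q by rewrite sqrtr_gt0.
have sp0 : 0 < Num.sqrt p by rewrite sqrtr_gt0.
have msq : m <= Num.sqrt q by rewrite -[m]ger0_norm ?(ltW m0)// -sqrtr_sqr ler_wsqrtr.
have r0 : 0 <= r by exact: le_trans pqr.
have spq : Num.sqrt p <= Num.sqrt q + r.
  by have := le_trans (ler_norm _) pqr; lra.
rewrite ger0_norm ?subr_ge0 ?ler_ln ?posrE//.
have -> : 2^-1 * (ln p - ln q) = ln (Num.sqrt p / Num.sqrt q).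
  rewrite ln_div ?posrE// -!powR12_sqrt ?(ltW p0) ?(ltW q0)// !ln_powR; ring.
apply: le_trans (ln1D_le_powR al0 al1 (divr_ge0 r0 (ltW m0))).
rewrite ler_ln ?posrE ?divr_gt0//; last by rewrite ltr_wpDr// divr_ge0// ltW.
rewrite ler_pdivrMr// (le_trans spq)// mulrDl mul1r lerD2l.
by rewrite mulrAC ler_pdivlMr// ler_wpM2l.
Qed.

End holder_log_peak.

(** * Failure at the critical constant *)

Section sharpness.
Context {R : realType}.
Implicit Types (x y : R4 R).

Lemma filled_lipschitz : exists M : R, 1 <= M /\
  forall a s t, `|filled a s - filled a t| <= M * `|s - t|.
Proof.
have [C [C0 HC]] := @flatn_bounded R 1.
exists (1 + C); split=> [|a s t]; first by rewrite lerDl.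
wlog st : s t / s < t.
  move=> W; have [st|ts|->] := ltgtP s t; [exact: W| |by rewrite !subrr normr0 mulr0].
  by rewrite distrC (distrC s); exact: W.
have d z := is_derive_filled a z.
have cf : {within `[s, t], continuous (filled a)}.
  apply: continuous_subspaceT => z; apply: differentiable_continuous.
  by apply/derivable1_diffP; have [] := d z.
have [z _] := MVT st (fun z _ => d z) cf.
rewrite distrC => ->; rewrite normrM (distrC t) ler_wpM2r//.
by rewrite (le_trans (ler_normB _ _))// normr1 lerD2l.
Qed.

(** The two logarithms are estimated by [ln_holder], with lower bound
    [m = exp(-L)] for [sqrt(rho + a)] and [m = exp(-2)] for the square root of
    [filled]; the former dominates. *)
Lemma holder_log_peak (alpha : R) : 0 < alpha -> alpha < 1 ->
  exists K2 : R, 0 < K2 /\ forall L, 0 <= L ->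
    (holder_seminorm alpha (log_peak (expR (- L) ^+ 2)) <= (K2 * expR (alpha * L))%:E)%E.
Proof.
move=> al0 al1; have [M [M1 HM]] := filled_lipschitz.
have M0 : 0 <= M by exact: le_trans M1.
pose k := (M * expR 2) `^ alpha.
have k0 : 0 <= k by exact: powR_ge0.
exists ((1 + k) / alpha); split; first by rewrite divr_gt0// ltr_pwDl.
move=> L L0; apply: ge_ereal_sup => _ [[x y] /= xy <-].
set a := expR (- L) ^+ 2; have a0 : 0 < a by rewrite exprn_gt0// expR_gt0.
rewrite enorm_sub lee_fin.
have s0 := sqdist_ge0 0 x; have t0 := sqdist_ge0 0 y.
have d0 := sqdist_gt0 xy; set r := Num.sqrt (sqdist y x).
have r0 : 0 < r by rewrite sqrtr_gt0.
have str : `|Num.sqrt (sqdist 0 x) - Num.sqrt (sqdist 0 y)| <= r.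
  by rewrite -sqrtr_sqr ler_wsqrtr// enorm_dist.
rewrite ler_pdivrMr ?powR_gt0// /log_peak /log_profile.
move: (sqdist 0 x) (sqdist 0 y) s0 t0 str => s t s0 t0 str.
have sa : 0 < s + a by rewrite ltr_wpDl.
have ta : 0 < t + a by rewrite ltr_wpDl.
have E1 : 2^-1 * `|ln (s + a) - ln (t + a)| <= (r / expR (- L)) `^ alpha / alpha.
  apply: ln_holder => //; rewrite ?expR_gt0//; first by rewrite -/a lerDr.
    by rewrite -/a lerDr.
  rewrite (le_trans _ str)// -[leRHS]mul1r; apply: sqrt_lipschitz => //.
  - by rewrite lerDl ltW.
  - by rewrite lerDl ltW.
  - by rewrite mul1r opprD addrACA subrr addr0.
have E2 : 2^-1 * `|ln (filled a s) - ln (filled a t)| <=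
    (M * r / expR (- 2)) `^ alpha / alpha.
  have lbE : expR (- 2) ^+ 2 = filled_lb :> R.
    by rewrite /filled_lb -expRM_natl; congr expR; ring.
  apply: ln_holder => //; rewrite ?expR_gt0 ?lbE//; [exact: filled_ge|exact: filled_ge|].
  apply: (@le_trans _ _ (M * `|Num.sqrt s - Num.sqrt t|)); last by rewrite ler_wpM2l.
  by apply: sqrt_lipschitz => //; [exact: filled_gt0|exact: filled_gt0|
    exact: filled_ge_id|exact: filled_ge_id].
apply: (@le_trans _ _ ((M * r / expR (- 2)) `^ alpha / alpha + (r / expR (- L)) `^ alpha / alpha)).
  rewrite (le_trans _ (lerD E2 E1))// -mulrDr -mulrBr normrM ger0_norm ?invr_ge0//.
  rewrite ler_wpM2l// ?invr_ge0// opprB addrACA -opprD.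
  rewrite [X in `|X|](_ : _ = (ln (filled a s) - ln (filled a t)) - (ln (s + a) - ln (t + a))).
    exact: ler_normB.
  ring.
have eL : (r / expR (- L)) `^ alpha = expR (alpha * L) * r `^ alpha.
  rewrite expRN invrK powRM ?(ltW r0) ?expR_ge0// mulrC; congr (_ * _).
  by rewrite -expRM mulrC.
have eM : (M * r / expR (- 2)) `^ alpha = k * r `^ alpha.
  by rewrite expRN invrK mulrAC powRM ?(ltW r0) ?mulr_ge0 ?expR_ge0.
rewrite eL eM.
have e1 : 1 <= expR (alpha * L) by rewrite -(expR0 R) ler_expR mulr_ge0// ltW.
rewrite -2!mulrDl [leRHS](_ : _ = (expR (alpha * L) + k * expR (alpha * L)) * r `^ alpha / alpha).
  rewrite ler_wpM2r ?invr_ge0 ?(ltW al0)// ?ler_wpM2r ?powR_ge0//.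
  by rewrite addrC lerD2l ler_peMr.
ring.
Qed.

Lemma log_peak_center (L : R) : L - 1 <= log_peak (expR (- L) ^+ 2) 0.
Proof.
set a := expR (- L) ^+ 2; have a0 : 0 < a by rewrite exprn_gt0// expR_gt0.
have -> : log_peak a 0 = 2^-1 * (ln (filled a 0) - ln a).
  rewrite /log_peak /log_profile.
  have -> : sqdist 0 (0 : R4 R) = 0.
    by rewrite /sqdist big1// => i _; rewrite subrr expr0n.
  by rewrite add0r.
have lna : ln a = - 2 * L.
  by rewrite /a -expRM_natl expRK; ring.
have lnf : - 2 <= ln (filled a 0).
  rewrite -(expRK (-2 : R)) ler_ln ?posrE ?expR_gt0 ?filled_gt0//.
  rewrite /filled flatE subr0// invrK add0r lerDr ltW//.
rewrite lna; lra.
Qed.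

Lemma radial_log_peak (a : R) : radial (log_peak a).
Proof.
move=> x y; rewrite -[x]subr0 -[y]subr0 !enorm_sub !subr0 => /(congr1 (fun z => z ^+ 2)).
by rewrite !sqr_sqrtr ?sqdist_ge0// /log_peak => ->.
Qed.

(** Up to the constant [exp 1], which keeps the logarithm above [1], this says
    that [t^2 log(C + H/t)] increases with [t]: enlarging [t] by a factor [s]
    lowers the logarithm by at most [log s], which is at most [s^2 - 1]. *)
Lemma sqr_ln_le (C T P H H1 : R) : 0 < C -> 0 <= T -> 0 < P -> T ^+ 2 <= P ->
  0 <= H -> H <= H1 ->
  T ^+ 2 * ln (C + H / T) <= P * ln (C + expR 1 + H1 / Num.sqrt P).
Proof.
move=> C0 T0 P0 TP H0 HH1.
have sP : 0 < Num.sqrt P by rewrite sqrtr_gt0.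
have e1 : 1 <= expR 1 :> R by rewrite -(expR0 R) ler_expR.
have h0 : 0 <= H1 / Num.sqrt P by rewrite divr_ge0 ?(ltW sP)// (le_trans H0).
set l := ln (C + expR 1 + _).
have A0 : 0 < C + expR 1 + H1 / Num.sqrt P by rewrite ltr_pwDl// addr_gt0// expR_gt0.
have l1 : 1 <= l.
  rewrite -[1](@expRK R) ler_ln ?posrE ?expR_gt0//.
  by rewrite addrAC lerDr addr_ge0// ltW.
have l0 : 0 <= l by exact: le_trans l1.
have [->|Tn0] := eqVneq T 0; first by rewrite expr0n mul0r mulr_ge0// ltW.
have Tp : 0 < T by rewrite lt_neqAle eq_sym Tn0.
pose s := Num.sqrt P / T.
have sp : 0 < s by rewrite divr_gt0.
have s2 : T ^+ 2 * s ^+ 2 = P by rewrite /s expr_div_n sqr_sqrtr ?(ltW P0)// mulrC divfK// expf_neq0.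
have s1 : 1 <= s ^+ 2 by rewrite -(ler_pM2l (exprn_gt0 2 Tp)) s2 mulr1.
have s1' : 1 <= s by rewrite -(@ler_pXn2r _ 2) ?nnegrE ?(ltW sp)// expr1n.
have lns : ln s <= (s ^+ 2 - 1) * l.
  have h : ln (s ^+ 2) <= s ^+ 2 - 1.
    have := @le_ln1Dx R (s ^+ 2 - 1); rewrite addrCA subrr addr0; apply.
    by rewrite ltrBrDr addrC subrr exprn_gt0.
  have ln0 : 0 <= ln s by exact: ln_ge0.
  have : s ^+ 2 - 1 <= (s ^+ 2 - 1) * l by rewrite ler_peMr// subr_ge0.
  by move: h; rewrite lnXn// mulr2n; lra.
have arg : C + H / T <= s * (C + expR 1 + H1 / Num.sqrt P).
  rewrite mulrDr lerD//.
    rewrite (@le_trans _ _ (C + expR 1)) ?lerDl ?expR_ge0//.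
    by rewrite ler_peMl// addr_ge0 ?expR_ge0// ltW.
  have -> : s * (H1 / Num.sqrt P) = H1 / T by rewrite /s; field; rewrite !gt_eqF.
  by rewrite ler_wpM2r ?invr_ge0.
have : ln (C + H / T) <= s ^+ 2 * l.
  apply: (@le_trans _ _ (ln s + l)); last by lra.
  have A1 : 0 < C + H / T by apply: ltr_pwDl => //; exact: divr_ge0.
  rewrite -lnM ?posrE// ler_ln ?posrE//.
  exact: mulr_gt0.
by move=> h; rewrite -s2 -[leRHS]mulrA ler_wpM2l ?sqr_ge0.
Qed.

(** No pair of norms [T] and [H] within the bounds satisfied by [log_peak] is
    compatible with the critical inequality. The bound [H/T] is at worst of
    order [exp(alpha L)/sqrt L], and the resulting gain [log L/2] beats all
    constants. *)
Lemma log_gap (alpha C K1 K2 : R) : 0 < alpha -> alpha < 1 -> 0 < C -> 0 <= K1 -> 0 < K2 ->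
  exists L : R, 1 < L /\ forall T H : R, 0 <= T -> T ^+ 2 <= 8 * pi ^+ 2 * L + K1 ->
    0 <= H -> H <= K2 * expR (alpha * L) ->
    1 / (8 * pi ^+ 2 * alpha) * T ^+ 2 * ln (C + H / T) < (L - 1) ^+ 2.
Proof.
move=> al0 al1 C0 K10 K20.
have e0 : 0 < expR 1 :> R by exact: expR_gt0.
pose C' := C + expR 1; have C'0 : 0 < C' by rewrite addr_gt0.
pose k := C' / alpha + K2; have k0 : 0 < k by rewrite addr_gt0// divr_gt0.
(* With [L = exp w], the logarithm to be bounded is at most
   [alpha L - w/2 + ln k], and the final comparison needs this to be at most
   [alpha (L - K1 - 2)]. *)
pose w := 2 * alpha * (K1 + 2) + 2 * `|ln k|.
have w0 : 0 < w by rewrite ltr_pwDl ?mulr_ge0// !mulr_gt0// ltr_wpDl.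
pose L := expR w; have L1 : 1 < L by rewrite -(expR0 R) ltr_expR.
have L0 : 0 < L by exact: lt_trans L1.
exists L; split=> // T H T0 TP H0 HH.
set Q := 8 * pi ^+ 2 in TP *.
have Q1 : 1 <= Q.
  have p2 := pi_ge2 R.
  have : 2 * 2 <= pi * pi :> R by rewrite ler_pM.
  rewrite /Q expr2; lra.
have Q0 : 0 < Q by exact: lt_le_trans Q1.
set P := Q * L + K1 in TP *.
have LP : L <= P by rewrite (@le_trans _ _ (Q * L)) ?lerDl// ler_peMl// ltW.
have P0 : 0 < P by exact: lt_le_trans LP.
have hT := sqr_ln_le C0 T0 P0 TP H0 HH.
set l := ln (C + expR 1 + _) in hT.
have sL : 0 < Num.sqrt L by rewrite sqrtr_gt0.
have e1 : alpha * L <= expR (alpha * L).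
  by rewrite (le_trans _ (expR_ge1Dx _))// lerDr.
have arg : C' + K2 * expR (alpha * L) / Num.sqrt P <= expR (alpha * L) / Num.sqrt L * k.
  rewrite /k mulrDr lerD//.
    have sLL : Num.sqrt L <= L.
      rewrite -[leRHS]ger0_norm ?(ltW L0)// -sqrtr_sqr ler_wsqrtr//.
      by rewrite expr2 ler_peMl// ltW.
    rewrite (_ : _ * (C' / alpha) = C' * (expR (alpha * L) / (alpha * Num.sqrt L))); last first.
      by field; rewrite !gt_eqF.
    rewrite ler_peMr ?(ltW C'0)// ler_pdivlMr ?mulr_gt0// mul1r (le_trans _ e1)//.
    by rewrite ler_wpM2l// ltW.
  rewrite -mulrA mulrC ler_wpM2r ?(ltW K20)// ler_wpM2l ?expR_ge0//.
  by rewrite lef_pV2 ?posrE ?sqrtr_gt0// ler_wsqrtr.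
have l_le : l <= alpha * (L - K1 - 2).
  have A0 : 0 < C' + K2 * expR (alpha * L) / Num.sqrt P.
    by rewrite ltr_pwDl// divr_ge0 ?sqrtr_ge0// mulr_ge0 ?expR_ge0// ltW.
  have : l <= ln (expR (alpha * L) / Num.sqrt L * k).
    have A1 := lt_le_trans A0 arg; rewrite /l ler_ln ?posrE//.
  rewrite lnM ?posrE ?divr_gt0 ?expR_gt0// ln_div ?posrE ?expR_gt0// expRK.
  rewrite -powR12_sqrt ?(ltW L0)// ln_powR expRK /w.
  have := ler_norm (ln k); lra.
have e1' : 1 <= expR 1 :> R by rewrite -(expR0 R) ler_expR.
have l0 : 0 <= l.
  rewrite ln_ge0// (le_trans e1')// addrAC lerDr addr_ge0 ?(ltW C0)//.
  by rewrite divr_ge0 ?sqrtr_ge0// mulr_ge0 ?expR_ge0// ltW.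
have PQ : P <= Q * (L + K1) by rewrite mulrDr lerD2l ler_peMl.
have Qa : 0 < Q * alpha by exact: mulr_gt0.
rewrite -/Q mul1r -mulrA mulrC ltr_pdivrMr//.
rewrite (le_lt_trans hT)// (le_lt_trans (ler_wpM2r l0 PQ))//.
have LK : 0 <= Q * (L + K1) by rewrite mulr_ge0 ?(ltW Q0)// addr_ge0// ltW.
rewrite (le_lt_trans (ler_wpM2l LK l_le))//.
rewrite (_ : _ * (alpha * _) = (L + K1) * (L - K1 - 2) * (Q * alpha)); last by ring.
rewrite ltr_pM2r// -subr_gt0.
rewrite (_ : _ - _ = 1 + K1 ^+ 2 + 2 * K1); last by ring.
by rewrite !ltr_pwDl// ?mulr_ge0// sqr_ge0.
Qed.

Lemma logarithmic_inequality_sharp (alpha : R) : 0 < alpha -> alpha < 1 ->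
  ~ (exists C : R, 0 < C /\
    forall u : R4 R -> R, H20rad_holder alpha u -> u <> cst 0 ->
      (Linfnorm u ^+ 2 <=
       (1 / (8 * pi ^+ 2 * alpha))%:E * L2norm (laplacian u) ^+ 2
       * (ln (C + N_holder alpha u))%:E)%E).
Proof.
move=> al0 al1 [C [C0 HC]].
have [K1 [K10 HK1]] := @L2norm_laplacian_log_peak R.
have [K2 [K20 HK2]] := holder_log_peak al0 al1.
have [L [L1 HL]] := log_gap al0 al1 C0 K10 K20.
have L0 : 0 < L by exact: lt_trans L1.
pose a := expR (- L) ^+ 2.
have a0 : 0 < a by rewrite exprn_gt0// expR_gt0.
have aE : a = expR (- (2 * L)) by rewrite /a -expRM_natl; congr expR; ring.
have a1 : a < 1 by rewrite aE -(expR0 R) ltr_expR oppr_lt0 mulr_gt0.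
have tu := test_function_log_peak a0.
have hh := HK2 L (ltW L0); rewrite -/a in hh.
have u0 := log_peak_center L; rewrite -/a in u0.
have uX : H20rad_holder alpha (log_peak a).
  split; [exact: test_function_H20|exact: radial_log_peak|].
  by rewrite (le_lt_trans hh)// ltry.
have un0 : log_peak a <> cst 0.
  by move=> E; move: u0; rewrite E /=; lra.
have := HC _ uX un0; apply/negP; rewrite -ltNge.
have lL := laplacian_L2B (test_function_H2 tu).
have T0 := fine_Lnorm2_ge0 (@leb4 R) (laplacian (log_peak a)).
have := HK1 a a0 a1; rewrite /N_holder.
set T := fine (L2norm _) in T0 *.
have -> : L2norm (laplacian (log_peak a)) = T%:E by rewrite fineK// Lfun2_fin_num// lL.1.
have -> : 4 * pi ^+ 2 * ln a^-1 = 8 * pi ^+ 2 * L :> R.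
  by rewrite aE -expRN opprK expRK; ring.
move=> T2.
have hf : holder_seminorm alpha (log_peak a) \is a fin_num.
  by rewrite ge0_fin_numE ?holder_seminorm_ge0// (le_lt_trans hh)// ltry.
have H0 : 0 <= fine (holder_seminorm alpha (log_peak a)).
  by rewrite fine_ge0// holder_seminorm_ge0.
have HH : fine (holder_seminorm alpha (log_peak a)) <= K2 * expR (alpha * L).
  by rewrite -lee_fin fineK.
rewrite -EFin_expe -!EFinM.
apply: (@lt_le_trans _ _ (((L - 1) ^+ 2)%:E)); first by rewrite lte_fin; exact: HL.
have cu : continuous (log_peak a) by exact/smooth_continuous/test_function_smooth.
have := Linfnorm_ge 0 cu => h.
have LL : ((L - 1)%:E <= Linfnorm (log_peak a))%E.
  by rewrite (le_trans _ h)// lee_fin (le_trans u0)// ler_norm.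
rewrite EFin_expe !expe2; apply: lee_pmul => //; rewrite lee_fin; lra.
Qed.

End sharpness.

Theorem theorem1p4 (R : realType) (alpha : R) (alpha_gt0 : 0 < alpha)
    (alpha_lt1 : alpha < 1) :
  (forall lambda : R, 1 / (8 * pi ^+ 2 * alpha) < lambda ->
    exists C : R, 0 < C /\
      forall u : R4 R -> R, H20rad_holder alpha u -> u <> cst 0 ->
        (Linfnorm u ^+ 2 <=
         lambda%:E * L2norm (laplacian u) ^+ 2 * (ln (C + N_holder alpha u))%:E)%E)
  /\
  ~ (exists C : R, 0 < C /\
      forall u : R4 R -> R, H20rad_holder alpha u -> u <> cst 0 ->
        (Linfnorm u ^+ 2 <=
         (1 / (8 * pi ^+ 2 * alpha))%:E * L2norm (laplacian u) ^+ 2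
         * (ln (C + N_holder alpha u))%:E)%E).
Proof.
split=> [lambda|]; first exact: logarithmic_inequality.
exact: logarithmic_inequality_sharp.
Qed.
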